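(* Let $\Pi$ be a complex-analytic distribution of $\alpha$-planes on an open subset $A^C$ of $\mathbb{C}^4$, let $p\in A^C$, and let $J$ (respectively $W$) be the corresponding almost Hermitian structure on $A^4=A^C\cap\mathbb{R}^4_p$ (respectively distribution of null directions on $A^M=A^C\cap\mathbb{M}^4_p$), i.e. $J_q=-i$ on $\Pi_q$ and $+i$ on $\overline{\Pi}_q$ for $q\in A^4$, and $W_q=\Pi_q\cap T_q\mathbb{M}^4_p$ for $q\in A^M$. Then the following conditions are equivalent: (i) $\Pi$ is integrable on $A^C$; (ii) $J$ is integrable on $A^4$; (iii) $W$ defines a shear-free ray congruence on $A^M$ (i.e. the integral curves of $W$ form a shear-free ray congruence).
   Context: $\mathbb{C}^4=\{(x_0,x_1,x_2,x_3)\}$ carries the holomorphic metric $g^{\mathrm C}=dx_0^2+dx_1^2+dx_2^2+dx_3^2$. For $p\in\mathbb{C}^4$: $\mathbb{R}^4_p=\{p+(x_0,x_1,x_2,x_3):x_i\in\mathbb{R}\}$ with Euclidean metric and standard orientation; $\mathbb{M}^4_p=\{p+(-it,x_1,x_2,x_3):t,x_i\in\mathbb{R}\}$, with induced Minkowski metric $-dt^2+dx_1^2+dx_2^2+dx_3^2$. $T_q\mathbb{C}^4=T_q\mathbb{R}^4_q\otimes\mathbb{C}$. An $\alpha$-plane at $q$ is a subspace $\mathrm{span}_{\mathbb C}\{e_0+ie_1,e_2+ie_3\}\subset T_q\mathbb{C}^4$ with $\{e_0,\dots,e_3\}$ a positively oriented orthonormal basis of $T_q\mathbb{R}^4_q$.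 A complex-analytic distribution of $\alpha$-planes on $A^C$ assigns to each $q$ an $\alpha$-plane $\Pi_q$ spanned (locally) by complex-analytic vector fields; it is integrable if $[w_1,w_2]\in\Gamma(\Pi)$ for all $w_1,w_2\in\Gamma(\Pi)$. An almost Hermitian structure (isometric $J$ with $J^2=-I$) is integrable if its Nijenhuis tensor vanishes. Shear-free ray congruence on an open subset of Minkowski space: a smooth foliation by (open pieces of) affine null lines, with tangent field normalized as $w=\partial/\partial t+U$, $U$ a unit vector field tangent to the slices $t=$ const, such that, with $W=\mathrm{span}\{w\}$, $\Sigma$ the space of vectors tangent to the slices $t=$ const and orthogonal to $U$ (a complement of $W$ in $W^\perp$, oriented by $U$ and the orientation of $\mathbb{R}^3$), $J^\perp$ the rotation through $+\pi/2$ on $\Sigma$ and $\{\ \}^\Sigma$ the projection $W^\perp\to\Sigma$ along $W$, one has $\{\nabla_{J^\perp X}w\}^\Sigma=J^\perp\{\nabla_Xw\}^\Sigma$ for all $X\in\Sigma$, where $\nabla$ is the Levi-Civita connection.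
   Formalization: The open set A^C is assumed connected; otherwise the claim fails, e.g. for two disjoint balls, p in the first, the second missing both real slices through p, with Π constant on the first and non-integrable on the second. *)

(* Defs.v *)
From HB Require Import structures.
From mathcomp Require Import all_boot all_order all_algebra.
From mathcomp Require Import complex.
From mathcomp Require Import all_classical all_reals all_analysis.

Set Implicit Arguments.
Unset Strict Implicit.
Unset Printing Implicit Defensive.

Import Order.TTheory GRing.Theory Num.Theory.
Import numFieldNormedType.Exports.

Local Open Scope classical_set_scope.
Local Open Scope ring_scope.

(* The complex numbers, packed as a numClosedFieldType so that they carry the
   topology given by their norm; 'i and ^* are those of this structure. *)
Definition Cplx (R : realType) : numClosedFieldType := R[i].

(* Points, tangent vectors and vector fields on K^n are written in the affine
   coordinates, as row vectors; 'D_v is then differentiation along v, in the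
   complex sense when K is the field of complex numbers. *)
Definition lie_bracket (K : numFieldType) (n : nat)
    (X Y : 'rV[K]_n.+1 -> 'rV[K]_n.+1) (q : 'rV[K]_n.+1) : 'rV[K]_n.+1 :=
  'D_(X q) Y q - 'D_(Y q) X q.

(* Near a, f is the sum of an absolutely convergent power series
   \sum_m c_m v^m, m ranging over the multi-indices: the sums of
   the |c_m| r^|m| over the cubes {m | all m_i < N} are bounded, and those of
   the c_m v^m tend to f (a + v) for v in the open polydisc of radius r. *)
Definition analytic_at (K : numFieldType) (n : nat)
    (f : 'rV[K]_n.+1 -> K) (a : 'rV[K]_n.+1) : Prop :=
  exists (c : {ffun 'I_n.+1 -> nat} -> K) (r M : K),
    [/\ 0 < r,
        forall N : nat,
          \sum_(m : {ffun 'I_n.+1 -> 'I_N})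
             `|c [ffun i => m i : nat]| * r ^+ (\sum_i m i)%N <= M
      & forall v : 'rV[K]_n.+1, (forall i, `|v 0 i| < r) ->
          (fun N : nat => \sum_(m : {ffun 'I_n.+1 -> 'I_N})
             c [ffun i => m i : nat] * \prod_i v 0 i ^+ m i)
            @ \oo --> f (a + v)].

Definition analytic_field (K : numFieldType) (n : nat)
    (V : set 'rV[K]_n.+1) (w : 'rV[K]_n.+1 -> 'rV[K]_n.+1) : Prop :=
  forall q, V q -> forall j, analytic_at (fun x => w x 0 j) q.

Fixpoint Ck (R : realType) (n : nat) (k : nat) (V : set 'rV[R]_n.+1)
    (f : 'rV[R]_n.+1 -> 'rV[R]_n.+1) : Prop :=
  match k with
  | 0 => forall x, V x -> {for x, continuous f}
  | k'.+1 => forall v, (forall x, V x -> derivable f x v) /\ Ck k' V ('D_v f)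
  end.

Definition smooth_field (R : realType) (n : nat) (V : set 'rV[R]_n.+1)
    (f : 'rV[R]_n.+1 -> 'rV[R]_n.+1) : Prop :=
  forall k, Ck k V f.

(* The inclusion of T_q R^4_q, and that of T_q M^4_p with v = (t, x1, x2, x3)
   sent to (- i t, x1, x2, x3). *)
Definition eucl (R : realType) (v : 'rV[R]_4) : 'rV[Cplx R]_4 :=
  \row_j (v 0 j)%:C%C.

Definition mink (R : realType) (v : 'rV[R]_4) : 'rV[Cplx R]_4 :=
  \row_j (if j == 0 then - 'i * (v 0 j)%:C%C else (v 0 j)%:C%C).

Definition conjv (R : realType) (v : 'rV[Cplx R]_4) : 'rV[Cplx R]_4 :=
  \row_j (v 0 j)^*.

(* The rows of E are the positively oriented orthonormal basis e_0, .., e_3. *)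
Definition is_alpha_plane (R : realType) (P : {vspace 'rV[Cplx R]_4}) : Prop :=
  exists E : 'M[R]_4, let e := fun j => eucl (row j E) in
    [/\ E *m E^T = 1%:M, \det E = 1
      & P = span [:: e 0 + 'i *: e 1; e 2 + 'i *: e 3]].

Definition alpha_distribution (R : realType) (A : set 'rV[Cplx R]_4)
    (Pi : 'rV[Cplx R]_4 -> {vspace 'rV[Cplx R]_4}) : Prop :=
  (forall q, A q -> is_alpha_plane (Pi q)) /\
  (forall q, A q -> exists (V : set 'rV[Cplx R]_4)
                           (w1 w2 : 'rV[Cplx R]_4 -> 'rV[Cplx R]_4),
     [/\ open V /\ V q, V `<=` A, analytic_field V w1, analytic_field V w2
       & forall q', V q' -> Pi q' = <<[:: w1 q'; w2 q']>>%VS]).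

(* Complex-analytic sections of Pi over V. *)
Definition section_over (R : realType)
    (Pi : 'rV[Cplx R]_4 -> {vspace 'rV[Cplx R]_4}) (V : set 'rV[Cplx R]_4)
    (w : 'rV[Cplx R]_4 -> 'rV[Cplx R]_4) : Prop :=
  analytic_field V w /\ forall q, V q -> w q \in Pi q.

(* Sections are local: a complex-analytic distribution need not have enough
   sections over the whole of A. *)
Definition integrable_distribution (R : realType) (A : set 'rV[Cplx R]_4)
    (Pi : 'rV[Cplx R]_4 -> {vspace 'rV[Cplx R]_4}) : Prop :=
  forall (V : set 'rV[Cplx R]_4) (w1 w2 : 'rV[Cplx R]_4 -> 'rV[Cplx R]_4),
    open V -> V `<=` A ->
    section_over Pi V w1 -> section_over Pi V w2 ->
    section_over Pi V (lie_bracket w1 w2).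

(* A^4 and A^M, in the coordinates x and (t, x1, x2, x3) centred at p. *)
Definition eucl_slice (R : realType) (A : set 'rV[Cplx R]_4)
    (p : 'rV[Cplx R]_4) : set 'rV[R]_4 := [set x | A (p + eucl x)].

Definition mink_slice (R : realType) (A : set 'rV[Cplx R]_4)
    (p : 'rV[Cplx R]_4) : set 'rV[R]_4 := [set x | A (p + mink x)].

(* J x acts on (complexified) tangent vectors by v |-> v *m J x.  Since an
   alpha-plane P satisfies P (+) conj P = C^4 and is null for g^C, the two
   eigenspace conditions determine J x, and make it orthogonal with square
   -1. *)
Definition corresponding_J (R : realType) (A : set 'rV[Cplx R]_4)
    (Pi : 'rV[Cplx R]_4 -> {vspace 'rV[Cplx R]_4}) (p : 'rV[Cplx R]_4)
    (J : 'rV[R]_4 -> 'M[R]_4) : Prop :=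
  forall x, eucl_slice A p x -> forall v, v \in Pi (p + eucl x) ->
    v *m map_mx (real_complex R) (J x) = - 'i *: v /\
    conjv v *m map_mx (real_complex R) (J x) = 'i *: conjv v.

Definition actJ (R : realType) (J : 'rV[R]_4 -> 'M[R]_4)
    (X : 'rV[R]_4 -> 'rV[R]_4) : 'rV[R]_4 -> 'rV[R]_4 :=
  fun x => X x *m J x.

Definition nijenhuis (R : realType) (J : 'rV[R]_4 -> 'M[R]_4)
    (X Y : 'rV[R]_4 -> 'rV[R]_4) (x : 'rV[R]_4) : 'rV[R]_4 :=
  lie_bracket (actJ J X) (actJ J Y) x
  - actJ J (lie_bracket (actJ J X) Y) x
  - actJ J (lie_bracket X (actJ J Y)) x
  - lie_bracket X Y x.

Definition integrable_J (R : realType) (A4 : set 'rV[R]_4)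
    (J : 'rV[R]_4 -> 'M[R]_4) : Prop :=
  forall X Y : 'rV[R]_4 -> 'rV[R]_4, smooth_field A4 X -> smooth_field A4 Y ->
    forall x, A4 x -> nijenhuis J X Y x = 0.

(* Below, vectors of Minkowski space are v = (t, x1, x2, x3). *)
Definition mink_dot (R : realType) (u v : 'rV[R]_4) : R :=
  - (u 0 0 * v 0 0) + u 0 1 * v 0 1 + u 0 2 * v 0 2 + u 0 3 * v 0 3.

Definition ddt (R : realType) : 'rV[R]_4 := delta_mx 0 0.

Definition corresponding_W (R : realType)
    (Pi : 'rV[Cplx R]_4 -> {vspace 'rV[Cplx R]_4}) (p : 'rV[Cplx R]_4)
    (x : 'rV[R]_4) : set 'rV[R]_4 :=
  [set v | mink v \in Pi (p + mink x)].

Definition null_line (R : realType) (L : set 'rV[R]_4) : Prop :=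
  exists q v : 'rV[R]_4, [/\ v != 0, mink_dot v v = 0
    & L = [set q + s *: v | s in [set: R]]].

Definition integral_curve (R : realType) (AM : set 'rV[R]_4)
    (w : 'rV[R]_4 -> 'rV[R]_4) (a b : R) (g : R -> 'rV[R]_4) : Prop :=
  forall s, a < s < b -> AM (g s) /\ is_derive s 1 g (w (g s)).

(* The leaves, i.e. the integral curves of w, fill AM and are pieces of null
   lines. *)
Definition foliates_by_null_lines (R : realType) (AM : set 'rV[R]_4)
    (w : 'rV[R]_4 -> 'rV[R]_4) : Prop :=
  (forall x, AM x -> exists (a b : R) (g : R -> 'rV[R]_4),
     [/\ a < 0 < b, integral_curve AM w a b g & g 0 = x]) /\
  (forall (a b : R) (g : R -> 'rV[R]_4), integral_curve AM w a b g ->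
     exists2 L, null_line L & forall s, a < s < b -> L (g s)).

(* The space Sigma: tangent to the slices t = const and orthogonal to U. *)
Definition screen (R : realType) (U : 'rV[R]_4) : set 'rV[R]_4 :=
  [set X : 'rV[R]_4 | X 0 0 = 0 /\ mink_dot X U = 0].

(* Rotation through + pi/2 on screen U, for U a unit vector with no
   t-component: the cross product U x X in the slice R^3. *)
Definition Jperp (R : realType) (U X : 'rV[R]_4) : 'rV[R]_4 :=
  \row_j nth 0 [:: 0;
    U 0 2 * X 0 3 - U 0 3 * X 0 2;
    U 0 3 * X 0 1 - U 0 1 * X 0 3;
    U 0 1 * X 0 2 - U 0 2 * X 0 1] j.

(* For Y orthogonal to w = d/dt + U, the projection of Y on screen U along w:
   the only multiple of w that makes the t-component vanish is subtracted. *)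
Definition screen_proj (R : realType) (w Y : 'rV[R]_4) : 'rV[R]_4 :=
  Y - Y 0 0 *: w.

(* The Levi-Civita connection of the (constant) metric is nabla_X w = 'D_X w. *)
Definition shear_free (R : realType) (AM : set 'rV[R]_4)
    (w : 'rV[R]_4 -> 'rV[R]_4) : Prop :=
  forall x, AM x -> let U := w x - ddt R in forall X : 'rV[R]_4, screen U X ->
    screen_proj (w x) ('D_(Jperp U X) w x)
    = Jperp U (screen_proj (w x) ('D_X w x)).

Definition defines_shear_free_ray_congruence (R : realType)
    (AM : set 'rV[R]_4) (W : 'rV[R]_4 -> set 'rV[R]_4) : Prop :=
  exists U : 'rV[R]_4 -> 'rV[R]_4, let w := fun x => ddt R + U x in
    [/\ forall x, AM x -> [/\ U x 0 0 = 0, mink_dot (U x) (U x) = 1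
                            & W x = [set s *: w x | s in [set: R]]],
        smooth_field AM w,
        foliates_by_null_lines AM w
      & shear_free AM w].

(* Main.v *)
(* Pi_q is the -i eigenspace of the self-dual complex structure J_u of a unit
   vector u(q) of R^3, and it is its own orthogonal for the complex metric g.
   For a local frame w1, w2 put beta(v) = g(D_v w1, w2).  Since g(w_i, w_j) = 0,
   the products of [w1, w2] with w1 and w2 are - beta(w1) and - beta(w2), so Pi
   is integrable iff beta vanishes on Pi.  The functions beta(w1), beta(w2) are
   holomorphic: A being connected, they vanish everywhere as soon as they vanish
   on a totally real slice through p.
   On R^4_p a section is w = X + i J X, and [w, w'] = B1 + i B2 gives
   N_J(X, X') = - B1 - J B2, which is 0 iff [w, w'] is in Pi.
   On M^4_p, Pi is spanned by w = d/dt + u and by the X + i (u x X) with X in the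
   screen of u.  Differentiating g(w, w_i) = 0 turns beta(w) = 0 into D_w u = 0,
   which says that the integral curves of w are null lines, and turns
   beta(X + i (u x X)) = 0 into the shear-free equation. *)
Require Import Defs.
From HB Require Import structures.
From mathcomp Require Import all_boot all_order all_algebra.
From mathcomp Require Import complex.
From mathcomp Require Import all_classical all_reals all_analysis.
From mathcomp Require Import ring lra.

Set Implicit Arguments.
Unset Strict Implicit.
Unset Printing Implicit Defensive.

Import Order.TTheory GRing.Theory Num.Theory.
Import numFieldNormedType.Exports.

Local Open Scope classical_set_scope.
Local Open Scope ring_scope.

(** The obstacle is the passage from a slice to the whole of A: beta belongs to a local frame,
    frames change with the point, and no single function on A carries the argument. What propagates
    is a property of points, quantified over all frames: every iterated partial derivative of
    beta(w1) and beta(w2) vanishes there. It holds at p because the derivative along a real axis of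
    a slice is a nonzero scalar times the corresponding complex partial, so vanishing on the slice
    near p reaches all iterated partials. It defines a relatively closed set by continuity, and an
    open one because an analytic germ with zero partials is zero nearby. The vector u is not
    holomorphic. On each slice it is recovered as a quotient built from the real and imaginary parts
    of a section, which makes it smooth. Condition (iii) asks for an integral curve through every
    point. The straight lines themselves serve, so no existence theorem for differential equations
    enters: only the constancy of u along them has to be proved. *)

Section ComplexModulus.
Variable R : realType.
Implicit Types x y z : Cplx R.

(** The norm of [Cplx R] takes values in [Cplx R]; a modulus in [R] keeps the estimates in a totally
    ordered field. *)
Definition cmod z : R := Normc.normc z.

Lemma normE z : `|z| = (cmod z)%:C%C. Proof. by []. Qed.
Lemma cmod_ge0 z : 0 <= cmod z.
Proof. by case: z => a b; exact: sqrtr_ge0. Qed.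
Lemma cmod0 : cmod 0 = 0. Proof. exact: Normc.normc0. Qed.
Lemma cmod1 : cmod 1 = 1. Proof. exact: Normc.normc1. Qed.
Lemma cmodM x y : cmod (x * y) = cmod x * cmod y. Proof. exact: Normc.normcM. Qed.
Lemma cmodD x y : cmod (x + y) <= cmod x + cmod y. Proof. exact: le_normcD. Qed.
Lemma cmodN x : cmod (- x) = cmod x. Proof. exact: normcN. Qed.
Lemma cmod_eq0 x : cmod x = 0 -> x = 0. Proof. exact: Normc.eq0_normc. Qed.
Lemma cmod_le0 x : cmod x <= 0 -> x = 0.
Proof. by move=> h; apply: cmod_eq0; apply/eqP; rewrite eq_le h cmod_ge0. Qed.
Lemma cmodR (a : R) : cmod a%:C%C = `|a|.
Proof. by rewrite /cmod /= expr0n addr0 sqrtr_sqr. Qed.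
Lemma cmodB x y : cmod (x - y) <= cmod x + cmod y.
Proof. by rewrite -(cmodN y); exact: cmodD. Qed.
Lemma cmodBC x y : cmod (x - y) = cmod (y - x).
Proof. by rewrite -cmodN opprB. Qed.
Lemma cmod_tri x y z : cmod (x - z) <= cmod (x - y) + cmod (y - z).
Proof. by rewrite -{1}(subrK y x) -addrA cmodD. Qed.
Lemma cmod_sum (I : Type) (s : seq I) (F : I -> Cplx R) :
  cmod (\sum_(i <- s) F i) <= \sum_(i <- s) cmod (F i).
Proof.
elim: s => [|i s IH]; first by rewrite !big_nil cmod0.
by rewrite !big_cons (le_trans (cmodD _ _)) // lerD2l.
Qed.
Lemma Re_cmod x : `|complex.Re x| <= cmod x.
Proof.
case: x => a b; rewrite /cmod /= -sqrtr_sqr ler_sqrt ?addr_ge0 ?sqr_ge0 //.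
by rewrite lerDl sqr_ge0.
Qed.
Lemma Im_cmod x : `|complex.Im x| <= cmod x.
Proof.
case: x => a b; rewrite /cmod /= -sqrtr_sqr ler_sqrt ?addr_ge0 ?sqr_ge0 //.
by rewrite lerDr sqr_ge0.
Qed.
Lemma cmod_ReIm x : cmod x <= `|complex.Re x| + `|complex.Im x|.
Proof.
case: x => a b; rewrite /cmod /= -[leRHS]ger0_norm ?addr_ge0 // -sqrtr_sqr.
rewrite ler_sqrt ?sqr_ge0 // sqrrD !real_normK ?num_real //.
by rewrite lerD2r lerDl mulrn_wge0 // mulr_ge0.
Qed.
End ComplexModulus.

(** * Power series *)

Section GeometricCauchy.
Variable R : realType.

(** Stands in for a passage to the limit: since N < 2^N, the error falls below any positive x -
    y. *)
Lemma le_geo (x y c : R) : (forall N, x <= y + c / 2 ^+ N) -> x <= y.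
Proof.
move=> h; rewrite leNgt; apply/negP => yx.
have e0 : 0 < x - y by rewrite subr_gt0.
have c0 : 0 <= c by have := h 0; rewrite expr0 divr1; lra.
have := archi_boundP (divr_ge0 c0 (ltW e0)).
set N := Num.bound _ => hN; have := h N.
have N2 : N%:R < 2 ^+ N :> R by rewrite -natrX ltr_nat ltn_expl.
have : c < (x - y) * 2 ^+ N.
  by rewrite mulrC -ltr_pdivrMr //; apply: lt_trans hN N2.
rewrite -ltr_pdivrMr ?exprn_gt0 //; lra.
Qed.

(** The intervals of radius 2M/2^N about [y N] are nested, because M/2^N is exactly the difference
    of two successive radii. The limit is the supremum of their left ends. *)
Lemma real_geo_cauchy (y : nat -> R) (M : R) :
  (forall N, `|y N.+1 - y N| <= M / 2 ^+ N) ->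
  exists l, forall N, `|l - y N| <= 2 * M / 2 ^+ N.
Proof.
move=> h.
have M0 : 0 <= M by have := le_trans (normr_ge0 _) (h 0); rewrite expr0 divr1.
have tw N : M / 2 ^+ N = 2 * M / 2 ^+ N - 2 * M / 2 ^+ N.+1.
  by rewrite exprS; field; rewrite expf_neq0.
pose lo N := y N - 2 * M / 2 ^+ N; pose hi N := y N + 2 * M / 2 ^+ N.
have loS N : lo N <= lo N.+1.
  by have := h N; rewrite tw /lo ler_norml => /andP[]; lra.
have hiS N : hi N.+1 <= hi N.
  by have := h N; rewrite tw /hi ler_norml => /andP[]; lra.
have lohi N K : lo N <= hi K.
  have a1 : lo N <= lo (maxn N K).
    by apply: (@homo_leq _ lo (fun x y => x <= y)); rewrite ?leq_maxl //; exact: le_trans.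
  have a2 : hi (maxn N K) <= hi K.
    by apply: (@homo_leq _ hi (fun x y => y <= x)); rewrite ?leq_maxr // => a b c ? ?; apply: le_trans; eassumption.
  apply: le_trans a1 (le_trans _ a2); rewrite /lo /hi.
  have : 0 <= 2 * M / 2 ^+ (maxn N K) by rewrite !mulr_ge0 ?invr_ge0 ?exprn_ge0.
  by lra.
exists (sup [set lo N | N in setT]) => N.
have hs : has_sup [set lo N | N in setT].
  split; first by exists (lo 0), 0.
  by exists (hi 0) => _ [K _ <-].
have l1 : lo N <= sup [set lo N | N in setT] by apply: sup_upper_bound => //; exists N.
have l2 : sup [set lo N | N in setT] <= hi N.
  by apply: ge_sup; [exists (lo 0), 0|move=> _ [K _ <-]].
by rewrite ler_norml; move: l1 l2; rewrite /lo /hi => ? ?; apply/andP; split; lra.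
Qed.

(** Real and imaginary parts converge separately, but adding their errors would double the constant.
    It is recovered by telescoping from [N] to [N + K], using the crude bound only at [N + K], and
    letting [K] grow. *)
Lemma geo_cauchy (x : nat -> Cplx R) (M : R) :
  (forall N, cmod (x N.+1 - x N) <= M / 2 ^+ N) ->
  exists l, forall N, cmod (l - x N) <= 2 * M / 2 ^+ N.
Proof.
move=> h.
have [l1 h1] : exists l, forall N, `|l - complex.Re (x N)| <= 2 * M / 2 ^+ N.
  apply: real_geo_cauchy => N; apply: le_trans (h N); apply: le_trans (Re_cmod _).
  by rewrite raddfB.
have [l2 h2] : exists l, forall N, `|l - complex.Im (x N)| <= 2 * M / 2 ^+ N.
  apply: real_geo_cauchy => N; apply: le_trans (h N); apply: le_trans (Im_cmod _).
  by rewrite raddfB.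
exists (Complex l1 l2) => N.
have M0 : 0 <= M by have := le_trans (cmod_ge0 _) (h 0); rewrite expr0 divr1.
have step K : cmod (x (N + K)%N - x N) <= 2 * M / 2 ^+ N - 2 * M / 2 ^+ (N + K).
  elim: K => [|K IH]; first by rewrite addn0 !subrr cmod0.
  apply: le_trans (cmod_tri _ (x (N + K)%N) _) _; rewrite addnS.
  apply: le_trans (lerD (h _) IH) _.
  suff -> : M / 2 ^+ (N + K) = 2 * M / 2 ^+ (N + K) - 2 * M / 2 ^+ (N + K).+1 by lra.
  by rewrite exprS; field; rewrite expf_neq0.
apply: (@le_geo _ _ (4 * M)) => K.
apply: le_trans (cmod_tri _ (x (N + K)%N) _) _.
have a2 : 2 * M / 2 ^+ (N + K) <= 2 * M / 2 ^+ K.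
  by rewrite ler_wpM2l ?mulr_ge0 // lef_pV2 ?posrE ?exprn_gt0 // ler_weXn2l ?ler1n // leq_addl.
have a3 : cmod (Complex l1 l2 - x (N + K)%N) <= 2 * M / 2 ^+ (N + K) + 2 * M / 2 ^+ (N + K).
  apply: le_trans (cmod_ReIm _) _; apply: lerD; last by move: (h2 (N + K)%N); case: (x (N + K)%N).
  by move: (h1 (N + K)%N); case: (x (N + K)%N).
have a4 := step K.
have a5 : 0 <= 2 * M / 2 ^+ (N + K) by rewrite !mulr_ge0 ?invr_ge0 ?exprn_ge0.
have -> : 4 * M / 2 ^+ K = 2 * M / 2 ^+ K + 2 * M / 2 ^+ K by field; rewrite expf_neq0.
by lra.
Qed.
End GeometricCauchy.

Section Terms.
Variables (R : realType) (n : nat).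
Local Notation C := (Cplx R).
Local Notation I := 'I_n.+1.
Local Notation V := 'rV[Cplx R]_n.+1.
Local Notation term := (Cplx R * seq 'I_n.+1)%type.
Implicit Types (t : term) (P Q : seq term) (v h : V) (w : seq I) (r : R).

Definition polydisc r v := forall i, cmod (v 0 i) <= r.

(* A power series is a sequence of lists of terms [(c, w)], the word [w] listing
   the variables of a monomial with repetition: sums, products and derivatives
   then need no reindexing of multi-indices. *)
Definition weval w v : C := \prod_(i <- w) v 0 i.
Definition teval P v : C := \sum_(t <- P) t.1 * weval t.2 v.
Definition tnorm r P : R := \sum_(t <- P) cmod t.1 * r ^+ size t.2.

Lemma teval_cat P Q v : teval (P ++ Q) v = teval P v + teval Q v.
Proof. by rewrite /teval big_cat. Qed.
Lemma tnorm_cat r P Q : tnorm r (P ++ Q) = tnorm r P + tnorm r Q.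
Proof. by rewrite /tnorm big_cat. Qed.
Lemma tnorm_ge0 r P : 0 <= r -> 0 <= tnorm r P.
Proof. by move=> r0; apply: sumr_ge0 => t _; rewrite mulr_ge0 ?cmod_ge0 ?exprn_ge0. Qed.
Lemma tnorm_le r r' P : 0 <= r -> r <= r' -> tnorm r P <= tnorm r' P.
Proof.
move=> r0 rr; apply: ler_sum => t _; apply: ler_wpM2l; first exact: cmod_ge0.
by apply: lerXn2r; rewrite ?nnegrE // (le_trans r0).
Qed.

Lemma weval_cons i w v : weval (i :: w) v = v 0 i * weval w v.
Proof. by rewrite /weval big_cons. Qed.
Lemma weval_cat w w' v : weval (w ++ w') v = weval w v * weval w' v.
Proof. by rewrite /weval big_cat. Qed.
Lemma weval_nil v : weval [::] v = 1. Proof. by rewrite /weval big_nil. Qed.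

Lemma weval_le r w v : polydisc r v -> cmod (weval w v) <= r ^+ size w.
Proof.
move=> b; elim: w => [|i w IH]; first by rewrite weval_nil cmod1 expr0.
by rewrite weval_cons cmodM exprS ler_pM ?cmod_ge0.
Qed.
Lemma teval_le r P v : polydisc r v -> cmod (teval P v) <= tnorm r P.
Proof.
move=> b; apply: le_trans (cmod_sum _ _) _; apply: ler_sum => t _.
by rewrite cmodM ler_wpM2l ?cmod_ge0 // weval_le.
Qed.

Definition tmul P Q : seq term :=
  [seq (t.1 * u.1, t.2 ++ u.2) | t <- P, u <- Q].
Lemma teval_mul P Q v : teval (tmul P Q) v = teval P v * teval Q v.
Proof.
rewrite /teval /tmul big_allpairs_dep mulr_suml; apply: eq_bigr => t _.
rewrite mulr_sumr; apply: eq_bigr => u _ /=; rewrite weval_cat; ring.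
Qed.
Lemma tnorm_mul r P Q : tnorm r (tmul P Q) = tnorm r P * tnorm r Q.
Proof.
rewrite /tnorm /tmul big_allpairs_dep mulr_suml; apply: eq_bigr => t _.
rewrite mulr_sumr; apply: eq_bigr => u _ /=; rewrite cmodM size_cat exprD; ring.
Qed.

(** Leibniz rule on words: each occurrence of [k] is deleted in turn, so the exponent appears as the
    number of words in the list. *)
Fixpoint wderiv (k : I) w : seq (seq I) :=
  if w is i :: w' then
    (if i == k then [:: w'] else [::]) ++ [seq i :: u | u <- wderiv k w']
  else [::].
Definition tderiv (k : I) P : seq term :=
  [seq (t.1, u) | t <- P, u <- wderiv k t.2].
Definition wsum (s : seq (seq I)) v : C := \sum_(u <- s) weval u v.

Lemma wsum_wderiv_cons k i w v :
  wsum (wderiv k (i :: w)) v = (i == k)%:R * weval w v + v 0 i * wsum (wderiv k w) v.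
Proof.
rewrite /wsum /= big_cat big_map mulr_sumr; congr (_ + _).
  by case: eqP => _; rewrite ?big_seq1 ?big_nil ?mul1r ?mul0r.
by apply: eq_bigr => u _; rewrite weval_cons.
Qed.
Lemma teval_tderiv k P v : teval (tderiv k P) v = \sum_(t <- P) t.1 * wsum (wderiv k t.2) v.
Proof.
rewrite /teval /tderiv big_allpairs_dep; apply: eq_bigr => t _.
by rewrite /wsum mulr_sumr.
Qed.

Lemma wderiv_bound k w r : 0 <= r ->
  r * \sum_(u <- wderiv k w) r ^+ size u <= (size w)%:R * r ^+ size w.
Proof.
move=> r0; elim: w => [|i w IH] /=; first by rewrite big_nil mulr0 mul0r.
rewrite big_cat big_map /= mulrDr -natr1 exprS mulrDl mul1r addrC; apply: lerD.
  have -> : \sum_(j <- wderiv k w) r ^+ (size j).+1 = r * \sum_(j <- wderiv k w) r ^+ size j.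
    by rewrite mulr_sumr; apply: eq_bigr => u _; rewrite exprS.
  by rewrite [leRHS]mulrCA ler_wpM2l.
case: eqP => _; rewrite ?big_seq1 ?big_nil // mulr0 mulr_ge0 // exprn_ge0 //.
Qed.

Lemma nat_le_2X m : m%:R <= 2 ^+ m :> R.
Proof. by rewrite -natrX ler_nat ltnW // ltn_expl. Qed.

(** Differentiation costs a factor [size w], absorbed by shrinking the radius. The ratio 4 is chosen
    for the second-order remainder as well, where the factor is (size w)^2 <= (2^size w)^2 = 4^size
    w. *)
Lemma tnorm_tderiv k P r : 0 < r -> tnorm (r / 4) (tderiv k P) <= tnorm r P / (r / 4).
Proof.
move=> r0; rewrite /tnorm /tderiv big_allpairs_dep mulr_suml; apply: ler_sum => t _ /=.
rewrite -mulr_sumr -mulrA ler_wpM2l ?cmod_ge0 // ler_pdivlMr ?divr_gt0 // mulrC.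
apply: le_trans (wderiv_bound _ _ _) _; first by rewrite ltW ?divr_gt0.
rewrite expr_div_n mulrCA ler_piMr ?exprn_ge0 ?(ltW r0) //.
rewrite ler_pdivrMr ?exprn_gt0 // mul1r; apply: le_trans (nat_le_2X _) _.
by apply: lerXn2r; rewrite ?nnegrE // ler_nat.
Qed.

Definition l1 h : R := \sum_i cmod (h 0 i).
Lemma l1_ge0 h : 0 <= l1 h.
Proof. by apply: sumr_ge0 => i _; exact: cmod_ge0. Qed.
Lemma cmod_l1 h i : cmod (h 0 i) <= l1 h.
Proof. by rewrite /l1 (bigD1 i) //= lerDl sumr_ge0 // => j _; exact: cmod_ge0. Qed.

Definition wdiff w v h : C := \sum_k h 0 k * wsum (wderiv k w) v.
Lemma wdiff_cons i w v h : wdiff (i :: w) v h = h 0 i * weval w v + v 0 i * wdiff w v h.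
Proof.
rewrite /wdiff; under eq_bigr do rewrite wsum_wderiv_cons mulrDr.
rewrite big_split /= (bigD1 i) //= eqxx mul1r big1 ?addr0; last first.
  by move=> j /negbTE; rewrite eq_sym => ->; rewrite mul0r mulr0.
by congr (_ + _); rewrite mulr_sumr; apply: eq_bigr => k _; ring.
Qed.

Lemma wdiff_le r w v h : 0 <= r -> polydisc r v ->
  r * cmod (wdiff w v h) <= (size w)%:R * r ^+ size w * l1 h.
Proof.
move=> r0 bv; elim: w => [|i w IH].
  rewrite /wdiff big1 ?cmod0 ?mulr0 ?mul0r // => k _.
  by rewrite /wsum big_nil mulr0.
rewrite wdiff_cons /= -natr1 exprS.
have h1 : cmod (h 0 i * weval w v) <= l1 h * r ^+ size w.
  by rewrite cmodM ler_pM ?cmod_ge0 ?cmod_l1 ?weval_le.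
have h2 : cmod (v 0 i * wdiff w v h) <= r * cmod (wdiff w v h).
  by rewrite cmodM ler_wpM2r ?cmod_ge0.
apply: le_trans (_ : r * (l1 h * r ^+ size w + (size w)%:R * r ^+ size w * l1 h) <= _).
  by rewrite ler_wpM2l // (le_trans (cmodD _ _)) // lerD // (le_trans h2).
by rewrite le_eqVlt; apply/orP; left; apply/eqP; ring.
Qed.

Definition wremainder w v h : C := weval w (v + h) - weval w v - wdiff w v h.

(** Induction on the word: the remainder of [i :: w] is (v + h)_i times that of [w] plus h_i times
    the differential of [w], and the bound closes because n^2 + n <= (n + 1)^2. The factor r^2 on
    the left avoids the exponent [size w - 2]. *)
Lemma wremainder_le r w v h : 0 <= r -> polydisc r v -> polydisc r (v + h) ->
  r ^+ 2 * cmod (wremainder w v h) <= (size w)%:R ^+ 2 * r ^+ size w * l1 h ^+ 2.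
Proof.
move=> r0 bv bvh; elim: w => [|i w IH].
  rewrite /wremainder /wdiff !weval_nil big1 ?subr0 ?subrr ?cmod0 ?mulr0 ?expr0n ?mul0r // => k _.
  by rewrite /wsum big_nil mulr0.
have -> : wremainder (i :: w) v h = (v + h) 0 i * wremainder w v h + h 0 i * wdiff w v h.
  by rewrite /wremainder wdiff_cons !weval_cons !mxE; ring.
have e1 : cmod ((v + h) 0 i * wremainder w v h) <= r * cmod (wremainder w v h).
  by rewrite cmodM ler_wpM2r ?cmod_ge0.
have e2 : cmod (h 0 i * wdiff w v h) <= l1 h * cmod (wdiff w v h).
  by rewrite cmodM ler_wpM2r ?cmod_ge0 ?cmod_l1.
have e3 := wdiff_le w h r0 bv.
have l0 := l1_ge0 h.
apply: le_trans (_ : r ^+ 2 * (r * cmod (wremainder w v h) + l1 h * cmod (wdiff w v h)) <= _).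
  by rewrite ler_wpM2l ?exprn_ge0 // (le_trans (cmodD _ _)) // lerD.
rewrite mulrDr (mulrCA _ r) [X in _ + X](_ : _ = r * l1 h * (r * cmod (wdiff w v h))); last ring.
have e4 : r * (r ^+ 2 * cmod (wremainder w v h)) <= r * ((size w)%:R ^+ 2 * r ^+ size w * l1 h ^+ 2).
  by rewrite ler_wpM2l.
have e5 : r * l1 h * (r * cmod (wdiff w v h)) <= r * l1 h * ((size w)%:R * r ^+ size w * l1 h).
  by rewrite ler_wpM2l ?mulr_ge0.
apply: le_trans (lerD e4 e5) _ => /=; rewrite -natr1 (exprS r (size w)) -subr_ge0.
have -> : ((size w)%:R + 1) ^+ 2 * (r * r ^+ size w) * l1 h ^+ 2
  - (r * ((size w)%:R ^+ 2 * r ^+ size w * l1 h ^+ 2)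
     + r * l1 h * ((size w)%:R * r ^+ size w * l1 h))
  = ((size w)%:R + 1) * (r * r ^+ size w * l1 h ^+ 2) by ring.
by rewrite !mulr_ge0 ?exprn_ge0 // addr_ge0.
Qed.

Lemma teval_rem P r v h : 0 < r -> polydisc (r / 4) v -> polydisc (r / 4) (v + h) ->
  cmod (teval P (v + h) - teval P v - \sum_k h 0 k * teval (tderiv k P) v)
  <= tnorm r P / (r / 4) ^+ 2 * l1 h ^+ 2.
Proof.
move=> r0 bv bvh; have r4 : 0 < r / 4 by rewrite divr_gt0.
have -> : teval P (v + h) - teval P v - \sum_k h 0 k * teval (tderiv k P) v
   = \sum_(t <- P) t.1 * wremainder t.2 v h.
  have -> : \sum_k h 0 k * teval (tderiv k P) v = \sum_(t <- P) t.1 * wdiff t.2 v h.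
    under eq_bigr do rewrite teval_tderiv mulr_sumr; rewrite exchange_big /=.
    apply: eq_bigr => t _; rewrite /wdiff mulr_sumr; apply: eq_bigr => k _; ring.
  by rewrite /teval -!sumrB; apply: eq_bigr => t _; rewrite /wremainder; ring.
apply: le_trans (cmod_sum _ _) _; rewrite /tnorm !mulr_suml; apply: ler_sum => t _.
rewrite cmodM -!mulrA ler_wpM2l ?cmod_ge0 // mulrA mulrAC ler_pdivlMr ?exprn_gt0 // mulrC.
apply: le_trans (wremainder_le _ (ltW r4) bv bvh) _.
rewrite ler_wpM2r ?exprn_ge0 ?l1_ge0 // expr_div_n mulrCA ler_piMr ?exprn_ge0 ?(ltW r0) //.
rewrite ler_pdivrMr ?exprn_gt0 // mul1r.
have -> : (4 : R) ^+ size t.2 = (2 ^+ size t.2) ^+ 2.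
  have -> : (4 : R) = 2 ^+ 2 by ring.
  by rewrite -!exprM mulnC.
by apply: lerXn2r; rewrite ?nnegrE ?exprn_ge0 // nat_le_2X.
Qed.

Definition tprefix (p : nat -> seq term) (N : nat) : seq term :=
  flatten [seq p j | j <- iota 0 N].

Lemma tprefixS p N : tprefix p N.+1 = tprefix p N ++ p N.
Proof.
have e : iota 0 N.+1 = iota 0 N ++ [:: N] by rewrite -addn1 iotaD.
by rewrite /tprefix e map_cat flatten_cat /= cats0.
Qed.

(* The block [p N] collects terms of any degree, and the rates [2 ^- N] replace
   all limits by explicit inequalities, at the cost of shrinking [r]. *)
Definition expands (f : V -> C) (a : V) (r M : R) (p : nat -> seq term) :=
  (forall N, tnorm r (p N) <= M / 2 ^+ N) /\
  (forall v, polydisc r v -> forall N, cmod (f (a + v) - teval (tprefix p N) v) <= 2 * M / 2 ^+ N).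

Definition analytic_germ f a := exists r M p, 0 < r /\ expands f a r M p.

Lemma tprefix_tnorm r M p : 0 <= r -> (forall N, tnorm r (p N) <= M / 2 ^+ N) ->
  forall N, tnorm r (tprefix p N) <= 2 * M - 2 * M / 2 ^+ N.
Proof.
move=> r0 h; elim=> [|N IH].
  by rewrite /tprefix /tnorm big_nil expr0 divr1 subrr.
rewrite tprefixS tnorm_cat; apply: le_trans (lerD IH (h N)) _.
by rewrite le_eqVlt; apply/orP; left; apply/eqP; rewrite exprS; field; rewrite expf_neq0.
Qed.

Lemma expands_M f a r M p : 0 <= r -> expands f a r M p -> 0 <= M.
Proof.
by move=> r0 [h _]; have := le_trans (tnorm_ge0 _ r0) (h 0); rewrite expr0 divr1.
Qed.

Lemma tprefix_tnorm2 f a r M p N : 0 <= r -> expands f a r M p -> tnorm r (tprefix p N) <= 2 * M.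
Proof.
move=> r0 e; have M0 := expands_M r0 e; apply: le_trans (tprefix_tnorm r0 e.1 N) _.
by rewrite gerBl !mulr_ge0 ?invr_ge0 ?exprn_ge0.
Qed.

Lemma polydisc_le r r' v : r <= r' -> polydisc r v -> polydisc r' v.
Proof. by move=> rr b i; exact: le_trans (b i) rr. Qed.

Lemma expands_le f a r r' M M' p : 0 <= r' -> r' <= r -> M <= M' ->
  expands f a r M p -> expands f a r' M' p.
Proof.
move=> r0 rr MM [h1 h2]; split=> [N|v b N].
  apply: le_trans (tnorm_le _ r0 rr) (le_trans (h1 N) _).
  by rewrite ler_wpM2r ?invr_ge0 ?exprn_ge0.
apply: le_trans (h2 v (polydisc_le rr b) N) _.
by rewrite ler_wpM2r ?invr_ge0 ?exprn_ge0 // ler_wpM2l.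
Qed.

Lemma expands_ext f g a r M p : (forall v, polydisc r v -> f (a + v) = g (a + v)) ->
  expands f a r M p -> expands g a r M p.
Proof. by move=> fg [h1 h2]; split=> // v b N; rewrite -fg //; exact: h2. Qed.

Lemma analytic_germ_ext f g a r : 0 < r -> (forall v, polydisc r v -> f (a + v) = g (a + v)) ->
  analytic_germ f a -> analytic_germ g a.
Proof.
move=> r0 fg [r' [M [p [r'0 e]]]]; exists (Num.min r r'), M, p.
have m0 : 0 < Num.min r r' by rewrite lt_min r0.
split=> //; apply: (@expands_ext f); last first.
  by apply: expands_le e; rewrite ?ge_min ?lexx ?orbT ?(ltW m0).
by move=> v b; apply: fg; apply: polydisc_le b; rewrite ge_min lexx.
Qed.

Lemma analytic_germ_cst c a : analytic_germ (fun=> c) a.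
Proof.
exists 1, (cmod c), (fun N => if N is 0 then [:: (c, [::])] else [::]); split=> //; split.
  case=> [|N]; rewrite /tnorm ?big_nil ?big_seq1 /= ?expr0 ?mulr1 ?divr1 //.
  by rewrite mulr_ge0 ?cmod_ge0 ?invr_ge0 ?exprn_ge0.
move=> v _; case=> [|N].
  rewrite /tprefix /teval big_nil subr0 expr0 divr1; have := cmod_ge0 c; lra.
have -> : teval (tprefix (fun N : nat => if N is 0%N then [:: (c, [::])] else [::]) N.+1) v = c.
  elim: N => [|N IH]; last by rewrite tprefixS teval_cat IH /teval big_nil addr0.
  by rewrite tprefixS teval_cat /tprefix /= /teval big_nil big_seq1 add0r weval_nil mulr1.
by rewrite subrr cmod0 !mulr_ge0 ?cmod_ge0 ?invr_ge0 ?exprn_ge0.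
Qed.

Lemma teval_tprefix_pair p q N v :
  teval (tprefix (fun N => p N ++ q N) N) v = teval (tprefix p N) v + teval (tprefix q N) v.
Proof.
elim: N => [|N IH]; first by rewrite /tprefix /= /teval !big_nil addr0.
by rewrite !tprefixS !teval_cat IH; ring.
Qed.

Lemma analytic_germ_common f g a : analytic_germ f a -> analytic_germ g a -> exists r M p q, [/\ 0 < r, 0 <= M,
   expands f a r M p & expands g a r M q].
Proof.
move=> [r [M [p [r0 e]]]] [r' [M' [p' [r'0 e']]]].
exists (Num.min r r'), (Num.max M M'), p, p'.
have m0 : 0 < Num.min r r' by rewrite lt_min r0.
split=> //.
- by rewrite le_max (expands_M (ltW r0) e).
- by apply: expands_le e; rewrite ?ge_min ?le_max ?lexx ?orbT ?(ltW m0).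
- by apply: expands_le e'; rewrite ?ge_min ?le_max ?lexx ?orbT ?(ltW m0).
Qed.

Lemma analytic_germ_add f g a : analytic_germ f a -> analytic_germ g a -> analytic_germ (fun x => f x + g x) a.
Proof.
move=> /analytic_germ_common h /h [r [M [p [q [r0 M0 [e1 e2] [h1 h2]]]]]].
exists r, (M + M), (fun N => p N ++ q N); split=> //; split=> [N|v b N].
  by rewrite tnorm_cat mulrDl lerD.
rewrite teval_tprefix_pair mulrDr mulrDl opprD addrACA (le_trans (cmodD _ _)) // lerD //.
  exact: e2.
exact: h2.
Qed.

Lemma analytic_germ_mul f g a : analytic_germ f a -> analytic_germ g a -> analytic_germ (fun x => f x * g x) a.
Proof.
move=> /analytic_germ_common h /h [r [M [p [q [r0 M0 e h']]]]].
have nP N := tprefix_tnorm2 N (ltW r0) e; have nQ N := tprefix_tnorm2 N (ltW r0) h'.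
(* Block N is the increment of the product of the prefixes: P' Q' - P Q = (P' - P) Q' + P (Q' - Q).
   Both prefixes have norm at most 2M, which gives 2M * M twice. *)
exists r, (4 * M * M), (fun N => tmul (p N) (tprefix q N.+1) ++ tmul (tprefix p N) (q N)).
split=> //; have e' := e.1; have h1' := h'.1; split=> [N|v b N].
  rewrite tnorm_cat !tnorm_mul.
  have a1 := ler_pM (tnorm_ge0 _ (ltW r0)) (tnorm_ge0 _ (ltW r0)) (e' N) (nQ N.+1).
  have a2 := ler_pM (tnorm_ge0 _ (ltW r0)) (tnorm_ge0 _ (ltW r0)) (nP N) (h1' N).
  apply: le_trans (lerD a1 a2) _; rewrite le_eqVlt; apply/orP; left; apply/eqP; ring.
have -> : teval (tprefix (fun N => tmul (p N) (tprefix q N.+1) ++ tmul (tprefix p N) (q N)) N) v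
   = teval (tprefix p N) v * teval (tprefix q N) v.
  elim: N => [|N IH]; first by rewrite /tprefix /= /teval !big_nil mul0r.
  rewrite tprefixS teval_cat IH teval_cat !teval_mul (tprefixS p) (tprefixS q) !teval_cat; ring.
have E := e.2 v b N; have H := h'.2 v b N.
have g0 : cmod (g (a + v)) <= 2 * M.
  by have := h'.2 v b 0; rewrite /tprefix /teval big_nil subr0 expr0 divr1.
have f0 : cmod (teval (tprefix p N) v) <= 2 * M := le_trans (teval_le _ b) (nP N).
have -> : f (a + v) * g (a + v) - teval (tprefix p N) v * teval (tprefix q N) v =
  (f (a + v) - teval (tprefix p N) v) * g (a + v) +
  teval (tprefix p N) v * (g (a + v) - teval (tprefix q N) v) by ring.
apply: le_trans (cmodD _ _) _; rewrite !cmodM.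
apply: le_trans (lerD (ler_pM (cmod_ge0 _) (cmod_ge0 _) E g0) (ler_pM (cmod_ge0 _) (cmod_ge0 _) f0 H)) _.
by rewrite le_eqVlt; apply/orP; left; apply/eqP; ring.
Qed.

Lemma analytic_germ_sum (J : Type) (s : seq J) (F : J -> V -> C) a :
  (forall j, analytic_germ (F j) a) -> analytic_germ (fun x => \sum_(j <- s) F j x) a.
Proof.
move=> h; elim: s => [|j s IH].
  by rewrite (_ : (fun _ => _) = fun=> 0) ?funeqE => [|x]; [exact: analytic_germ_cst|rewrite big_nil].
rewrite (_ : (fun _ => _) = fun x => F j x + \sum_(j <- s) F j x); first exact: analytic_germ_add.
by rewrite funeqE => x; rewrite big_cons.
Qed.

Lemma tprefix_tderiv k p N : tprefix (fun j => tderiv k (p j)) N = tderiv k (tprefix p N).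
Proof.
elim: N => [|N IH]; first by [].
by rewrite !tprefixS IH /tderiv map_cat flatten_cat.
Qed.

Lemma teval_tprefix_cauchy r M p v : 0 <= r -> polydisc r v ->
  (forall N, tnorm r (p N) <= M / 2 ^+ N) ->
  exists l, forall N, cmod (l - teval (tprefix p N) v) <= 2 * M / 2 ^+ N.
Proof.
move=> r0 b h; apply: geo_cauchy => N.
by rewrite tprefixS teval_cat addrC addKr (le_trans (teval_le _ b)).
Qed.

(** Term-by-term differentiation. The quadratic estimate for the prefixes has a constant independent
    of N, so it survives the limit. It is stated about every point of the smaller polydisc, so that
    the [g k] are the partials of [f] near [a] and not only at [a]. *)
Lemma analytic_germ_deriv f a r M p : 0 < r -> expands f a r M p -> exists g : I -> V -> C,
  (forall k, expands (g k) a (r / 4) (M / (r / 4)) (fun N => tderiv k (p N))) /\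
  (forall v h, polydisc (r / 4) v -> polydisc (r / 4) (v + h) ->
     cmod (f (a + (v + h)) - f (a + v) - \sum_k h 0 k * g k (a + v))
     <= 2 * M / (r / 4) ^+ 2 * l1 h ^+ 2).
Proof.
move=> r0 e; have M0 := expands_M (ltW r0) e; have r4 : 0 < r / 4 by rewrite divr_gt0.
have rr : r / 4 <= r by lra.
have hn k N : tnorm (r / 4) (tderiv k (p N)) <= M / (r / 4) / 2 ^+ N.
  apply: le_trans (tnorm_tderiv _ _ r0) _; rewrite mulrAC ler_wpM2r ?invr_ge0 ?(ltW r4) //.
  exact: e.1.
(* The limits are chosen at all points at once; outside the polydisc the value is arbitrary. *)
have /choice [g hg] : forall kv : I * V, exists l, polydisc (r / 4) (kv.2 - a) ->
    forall N, cmod (l - teval (tprefix (fun N => tderiv kv.1 (p N)) N) (kv.2 - a))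
       <= 2 * (M / (r / 4)) / 2 ^+ N.
  move=> [k x] /=; have [b|nb] := pselect (polydisc (r / 4) (x - a)); last by exists 0.
  by have [l hl] := teval_tprefix_cauchy (ltW r4) b (hn k); exists l.
have gE k : expands (fun x => g (k, x)) a (r / 4) (M / (r / 4)) (fun N => tderiv k (p N)).
  by split=> // v b N; have /= := hg (k, a + v); rewrite addrC addKr; exact.
exists (fun k x => g (k, x)); split=> // v h bv bvh.
apply: (@le_geo _ _ _ (4 * M + l1 h * (2 * (M / (r / 4))))) => N.
have E1 := e.2 (v + h) (polydisc_le rr bvh) N; have E2 := e.2 v (polydisc_le rr bv) N.
have E3 := teval_rem (tprefix p N) r0 bv bvh.
have E4 : cmod (\sum_k h 0 k * (teval (tderiv k (tprefix p N)) v - g (k, a + v)))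
    <= l1 h * (2 * (M / (r / 4)) / 2 ^+ N).
  apply: le_trans (cmod_sum _ _) _; rewrite /l1 mulr_suml; apply: ler_sum => k _.
  rewrite cmodM ler_wpM2l ?cmod_ge0 // cmodBC -tprefix_tderiv; exact: (gE k).2.
have E5 : tnorm r (tprefix p N) / (r / 4) ^+ 2 * l1 h ^+ 2 <= 2 * M / (r / 4) ^+ 2 * l1 h ^+ 2.
  rewrite !ler_wpM2r ?exprn_ge0 ?l1_ge0 ?invr_ge0 ?exprn_ge0 ?(ltW r4) //.
  exact: tprefix_tnorm2 (ltW r0) e.
have -> : f (a + (v + h)) - f (a + v) - \sum_k h 0 k * g (k, a + v) =
  (f (a + (v + h)) - teval (tprefix p N) (v + h)) - (f (a + v) - teval (tprefix p N) v)
  + (teval (tprefix p N) (v + h) - teval (tprefix p N) v - \sum_k h 0 k * teval (tderiv k (tprefix p N)) v)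
  + \sum_k h 0 k * (teval (tderiv k (tprefix p N)) v - g (k, a + v)).
  under [X in _ = _ + X]eq_bigr do rewrite mulrBr; rewrite sumrB; ring.
apply: le_trans (cmodD _ _) _; apply: le_trans (lerD (cmodD _ _) E4) _.
apply: le_trans (lerD (lerD (cmodB _ _) (le_trans E3 E5)) (lexx _)) _.
have -> : (4 * M + l1 h * (2 * (M / (r / 4)))) / 2 ^+ N =
  2 * M / 2 ^+ N + 2 * M / 2 ^+ N + l1 h * (2 * (M / (r / 4)) / 2 ^+ N) by ring.
lra.
Qed.
End Terms.

Lemma geo_small (R : realType) (c e : R) : 0 < e ->
  exists N0, forall N, (N0 <= N)%N -> c / 2 ^+ N <= e.
Proof.
move=> e0; have := archi_boundP (divr_ge0 (normr_ge0 c) (ltW e0)).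
set N0 := Num.bound _ => hN; exists N0 => N NN.
have N2 : N0%:R <= 2 ^+ N :> R.
  by rewrite -natrX ler_nat (leq_trans NN) // ltnW // ltn_expl.
rewrite ler_pdivrMr ?exprn_gt0 // mulrC -ler_pdivrMr //.
apply: le_trans (le_trans (ltW hN) N2); rewrite ler_pM2r ?invr_gt0 //; exact: ler_norm.
Qed.

(** * Iterated partial derivatives and flat analytic germs *)

Section Partials.
Variables (R : realType) (n : nat).
Local Notation C := (Cplx R).
Local Notation I := 'I_n.+1.
Local Notation V := 'rV[Cplx R]_n.+1.
Local Notation term := (Cplx R * seq 'I_n.+1)%type.
Implicit Types (f g : V -> C) (x a v h L : V) (k : I) (w : seq I) (r M : R).

(** Bilinear, without conjugation: it serves both as the pairing of a vector with a gradient and as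
    the holomorphic metric g^C. *)
Definition dot h L : C := \sum_k h 0 k * L 0 k.

(** A quadratic remainder is what power series provide. As an explicit inequality it restricts at
    once to real slices and yields real differentiability there. *)
Definition strong_diff f x L := exists (K d : R), 0 < d /\
  forall h, polydisc d h -> cmod (f (x + h) - f x - dot h L) <= K * l1 h ^+ 2.

(** The default 0 makes partial derivatives total functions, so that [pderivs] can iterate them
    without carrying proofs of differentiability. *)
Definition grad f x : V := xget 0 [set L | strong_diff f x L].
Definition pderiv k f : V -> C := fun x => grad f x 0 k.
Definition pderivs (ks : seq I) f : V -> C := foldr pderiv f ks.

Lemma nbhs_polydisc a (S : set V) :
  nbhs a S <-> exists2 d : R, 0 < d & forall v, polydisc d v -> S (a + v).
Proof.
split=> [/nbhs_ballP[e /= e0 es]|[d d0 h]].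
  have eR : e = (complex.Re e)%:C%C by move: e0; rewrite ltcE => /andP[/eqP]; case: (e) => x y /= ->.
  have e'0 : 0 < complex.Re e by move: e0; rewrite ltcE => /andP[].
  exists (complex.Re e / 2) => [|v b]; first by rewrite divr_gt0.
  apply: es; split=> // i j; rewrite /ball /= mxE opprD addNKr normrN normE eR.
  rewrite ltcR (ord1 i); apply: le_lt_trans (b j) _; lra.
apply/nbhs_ballP; exists d%:C%C => /=; first by rewrite ltcR.
move=> y [_ yb]; rewrite -(subrK a y) addrC; apply: h => i.
have := yb 0 i; rewrite /ball /= normE ltcR => /ltW; rewrite !mxE cmodBC.
by [].
Qed.

Lemma strong_diff_near f g x L : (\forall y \near x, f y = g y) -> strong_diff f x L -> strong_diff g x L.
Proof.
move=> /nbhs_polydisc[d d0 e] [K [d' [d'0 h]]]; exists K, (Num.min d d'); split.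
  by rewrite lt_min d0.
move=> v b; rewrite -e; last by apply: polydisc_le b; rewrite ge_min lexx.
have -> : g x = f x by rewrite -(addr0 x) e // => i; rewrite mxE cmod0 ltW.
by apply: h; apply: polydisc_le b; rewrite ge_min lexx orbT.
Qed.

Lemma grad_near f g x : (\forall y \near x, f y = g y) -> grad f x = grad g x.
Proof.
move=> e; rewrite /grad; congr (xget _ _); apply/funext => L.
apply/propext; split; first exact: strong_diff_near.
by apply: strong_diff_near; apply: filterS e => y ->.
Qed.

Lemma strong_diff_uniq f x L L' : strong_diff f x L -> strong_diff f x L' -> L = L'.
Proof.
move=> [K [d [d0 h]]] [K' [d' [d'0 h']]]; apply/rowP => k.
apply/eqP; rewrite -subr_eq0; apply/eqP/cmod_le0.
pose e := Num.min d d'; have e0 : 0 < e by rewrite lt_min d0.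
apply: (@le_geo _ _ _ ((K + K') * e)) => N; rewrite add0r.
(* Increments t along the k-th axis: the two quadratic bounds, divided by t, leave an error
   proportional to 2^-N. *)
pose t := e / 2 ^+ N; have t0 : 0 < t by rewrite divr_gt0 ?exprn_gt0.
have te : t <= e by rewrite ler_pdivrMr ?exprn_gt0 // ler_peMr ?(ltW e0) ?exprn_ege1 ?ler1n.
pose v : V := \row_j (if j == k then t%:C%C else 0).
have b : polydisc e v.
  by move=> i; rewrite mxE; case: eqP => _; rewrite ?cmodR ?cmod0 ?ger0_norm ?(ltW t0) ?(ltW e0).
have vd (M : V) : dot v M = t%:C%C * M 0 k.
  rewrite /dot (bigD1 k) //= mxE eqxx big1 ?addr0 // => j /negbTE jk.
  by rewrite mxE jk mul0r.
have vl : l1 v = t.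
  rewrite /l1 (bigD1 k) //= mxE eqxx cmodR ger0_norm ?(ltW t0) // big1 ?addr0 // => j /negbTE jk.
  by rewrite mxE jk cmod0.
have H1 := h v (polydisc_le (_ : e <= d) b); rewrite ge_min lexx /= in H1.
have H2 := h' v (polydisc_le (_ : e <= d') b); rewrite ge_min lexx orbT /= in H2.
have {}H1 := H1 isT; have {}H2 := H2 isT.
rewrite -(ler_pM2l t0) (_ : t * ((K + K') * e / 2 ^+ N) = K' * l1 v ^+ 2 + K * l1 v ^+ 2); last first.
  by rewrite vl /t; field; rewrite expf_neq0.
apply: le_trans (lerD H2 H1).
have -> : t * cmod (L 0 k - L' 0 k) = cmod (dot v L - dot v L').
  by rewrite !vd -mulrBr cmodM cmodR ger0_norm // ltW.
rewrite (_ : dot v L - _ = (f (x + v) - f x - dot v L') - (f (x + v) - f x - dot v L)); last by ring.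
exact: cmodB.
Qed.

Lemma strong_diff_grad f x L : strong_diff f x L -> grad f x = L.
Proof.
move=> h; apply: strong_diff_uniq (h).
by rewrite /grad; case: xgetP => [y -> //|/(_ L)] /(_ h).
Qed.

Lemma expands_strong_diff f a r M p : 0 < r -> expands f a r M p ->
  (forall v, polydisc (r / 8) v -> exists L, strong_diff f (a + v) L) /\  (forall k, expands (pderiv k f) a (r / 8) (M / (r / 4)) (fun N => tderiv k (p N))).
Proof.
move=> r0 e; have [g [ge gd]] := analytic_germ_deriv r0 e.
have hs v : polydisc (r / 8) v -> strong_diff f (a + v) (\row_k g k (a + v)).
  (* Half of r/4: for [v] and [h] in the polydisc of radius r/8, both [v] and [v + h] stay in that
     of radius r/4. *)
  move=> b; exists (2 * M / (r / 4) ^+ 2), (r / 8); split; first by rewrite divr_gt0.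
  move=> h bh; rewrite -(addrA a) (_ : dot _ _ = \sum_k h 0 k * g k (a + v)).
    apply: gd => [|i]; first by apply: polydisc_le b; lra.
    by rewrite mxE (le_trans (cmodD _ _)) // (le_trans (lerD (b i) (bh i))) //; lra.
  by apply: eq_bigr => k _; rewrite mxE.
split=> [v b|k]; first by exists (\row_k g k (a + v)); exact: hs.
apply: (@expands_ext _ _ (g k)); first by move=> v b; rewrite /pderiv (strong_diff_grad (hs v b)) mxE.
apply: expands_le (ge k); rewrite ?divr_ge0 ?(ltW r0) //; lra.
Qed.

Lemma analytic_germ_strong_diff f a : analytic_germ f a -> strong_diff f a (grad f a).
Proof.
move=> [r [M [p [r0 e]]]]; have [h _] := expands_strong_diff r0 e.
have [|L] := h 0; first by move=> i; rewrite mxE cmod0 divr_ge0 // ltW.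
by rewrite addr0 => hL; rewrite (strong_diff_grad hL).
Qed.

Lemma analytic_germ_pderiv k f a : analytic_germ f a -> analytic_germ (pderiv k f) a.
Proof.
move=> [r [M [p [r0 e]]]]; have [_ /(_ k) h] := expands_strong_diff r0 e.
by exists (r / 8), (M / (r / 4)), (fun N => tderiv k (p N)); split; first by rewrite divr_gt0.
Qed.

Lemma analytic_germ_pderivs ks f a : analytic_germ f a -> analytic_germ (pderivs ks f) a.
Proof. by move=> h; elim: ks => //= k ks; exact: analytic_germ_pderiv. Qed.

Lemma analytic_germ_near f g a : (\forall x \near a, f x = g x) -> analytic_germ f a -> analytic_germ g a.
Proof. by move=> /nbhs_polydisc[d d0 h]; apply: analytic_germ_ext d0 _. Qed.

Lemma cmod_dot_le h L : cmod (dot h L) <= l1 h * l1 L.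
Proof.
apply: le_trans (cmod_sum _ _) _; rewrite /l1 mulr_suml; apply: ler_sum => k _.
by rewrite cmodM ler_pM ?cmod_ge0 //; exact: cmod_l1.
Qed.

Lemma l1_polydisc h d : polydisc d h -> l1 h <= n.+1%:R * d.
Proof.
move=> b; apply: le_trans (ler_sum _ (fun i _ => b i)) _.
by rewrite sumr_const card_ord mulr_natl.
Qed.

Lemma strong_diff_cont f x L : strong_diff f x L -> forall e : R, 0 < e ->
  \forall y \near x, cmod (f y - f x) <= e.
Proof.
move=> [K [d [d0 hd]]] e e0.
pose c : R := n.+1%:R * (`|K| + l1 L) + 1.
have c0 : 0 < c by rewrite ltr_pwDr // mulr_ge0 // addr_ge0 // l1_ge0.
(* The radius [d] validates the estimate, 1/(n + 1) forces [l1 v <= 1] so that the quadratic term is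
   below the linear one, and e/c makes the resulting linear bound at most [e]. *)
apply/nbhs_polydisc; exists (Num.min (Num.min d n.+1%:R^-1) (e / c)).
  by rewrite !lt_min d0 invr_gt0 ltr0n divr_gt0.
move=> v b.
have b1 : polydisc d v by apply: polydisc_le b; rewrite !ge_min lexx.
have b2 : polydisc n.+1%:R^-1 v by apply: polydisc_le b; rewrite !ge_min lexx orbT.
have b3 : polydisc (e / c) v by apply: polydisc_le b; rewrite !ge_min lexx !orbT.
have v1 : l1 v <= 1 by apply: le_trans (l1_polydisc b2) _; rewrite mulfV // pnatr_eq0.
have vv := l1_polydisc b3; have v0 := l1_ge0 v; have L0 := l1_ge0 L.
rewrite -(subrK (dot v L) (f (x + v) - f x)).
apply: le_trans (cmodD _ _) _; apply: le_trans (lerD (hd v b1) (cmod_dot_le _ _)) _.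
have E1 : K * l1 v ^+ 2 <= `|K| * l1 v.
  rewrite expr2; apply: le_trans (_ : `|K| * (l1 v * l1 v) <= _).
    by rewrite ler_wpM2r ?mulr_ge0 // ler_norm.
  by rewrite ler_wpM2l // ler_piMr.
apply: le_trans (lerD E1 (lexx _)) _; rewrite [l1 v * _]mulrC -mulrDl.
apply: le_trans (ler_wpM2l _ vv) _; first by rewrite addr_ge0.
have -> : (`|K| + l1 L) * (n.+1%:R * (e / c)) = e * ((n.+1%:R * (`|K| + l1 L)) / c).
  by move: (c) (l1 L) => c' l'; ring.
by rewrite ler_piMr ?(ltW e0) // ler_pdivrMr // mul1r /c; lra.
Qed.

Lemma vanish_near_pderivs f x : (\forall y \near x, f y = 0) -> forall ks, pderivs ks f x = 0.
Proof.
move=> h ks; suff /nbhs_singleton : \forall y \near x, pderivs ks f y = 0 by [].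
elim: ks => [//|k ks IH]; have := nbhs_interior IH; apply: filterS => y e /=.
rewrite /pderiv (strong_diff_grad (_ : strong_diff _ y 0)) ?mxE //.
apply: (@strong_diff_near (fun=> 0)); first by apply: filterS e => z ->.
exists 0, 1; split=> // v _; rewrite subrr sub0r cmodN /dot big1 ?cmod0 ?mul0r // => i _.
by rewrite mxE mulr0.
Qed.

Definition homog l (P : seq term) v : C := \sum_(t <- P | size t.2 == l) t.1 * weval t.2 v.
Definition homog_ge l (P : seq term) v : C := \sum_(t <- P | (l <= size t.2)%N) t.1 * weval t.2 v.

Lemma homog_ge0 P v : homog_ge 0 P v = teval P v. Proof. by []. Qed.
Lemma homog_geS l P v : homog_ge l P v = homog l P v + homog_ge l.+1 P v.
Proof.
rewrite /homog_ge /homog big_mkcond [X in _ = X + _]big_mkcond [X in _ = _ + X]big_mkcond.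
rewrite -big_split /=; apply: eq_bigr => t _; rewrite leq_eqVlt eq_sym.
by case: eqP => [<-|_] /=; rewrite ?ltnn ?addr0 ?add0r.
Qed.
Lemma homog_ge_le r l P v : 0 <= r -> polydisc (r / 2) v -> cmod (homog_ge l P v) <= tnorm r P / 2 ^+ l.
Proof.
move=> r0 b; rewrite /homog_ge big_mkcond; apply: le_trans (cmod_sum _ _) _.
rewrite /tnorm mulr_suml; apply: ler_sum => t _; case: leqP => h; last first.
  by rewrite cmod0 !mulr_ge0 ?cmod_ge0 ?exprn_ge0 ?invr_ge0.
rewrite cmodM -mulrA ler_wpM2l ?cmod_ge0 // (le_trans (weval_le _ b)) // expr_div_n.
rewrite ler_wpM2l ?exprn_ge0 // lef_pV2 ?posrE ?exprn_gt0 // ler_weXn2l // ler1n //.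
Qed.

Lemma wdiff_euler w v : wdiff w v v = (size w)%:R * weval w v.
Proof.
elim: w => [|i w IH].
  by rewrite mul0r /wdiff big1 // => k _; rewrite /wsum big_nil mulr0.
by rewrite wdiff_cons IH weval_cons /= -natr1; ring.
Qed.

Lemma size_wderiv k w u : u \in wderiv k w -> (size u).+1 = size w.
Proof.
elim: w u => //= i w IH u; rewrite mem_cat => /orP[|/mapP[u' /IH <- ->] //].
by case: eqP => // _; rewrite inE => /eqP ->.
Qed.

Lemma homog_tderiv l P v : l.+1%:R * homog l.+1 P v = \sum_k v 0 k * homog l (tderiv k P) v.
Proof.
have E k : homog l (tderiv k P) v =
   \sum_(t <- P | size t.2 == l.+1) t.1 * wsum (wderiv k t.2) v.
  rewrite /homog big_mkcond /tderiv big_allpairs_dep [RHS]big_mkcond; apply: eq_bigr => t _ /=.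
  rewrite /wsum mulr_sumr; case: eqP => h.
    by apply: eq_big_seq => u ut; rewrite -eqSS (size_wderiv ut) h eqxx.
  by rewrite big_seq big1 // => u ut; rewrite -eqSS (size_wderiv ut); case: eqP.
under eq_bigr do rewrite E mulr_sumr; rewrite exchange_big /= /homog mulr_sumr.
apply: eq_bigr => t /eqP ht; rewrite -ht mulrCA -wdiff_euler /wdiff mulr_sumr.
by apply: eq_bigr => k _; ring.
Qed.

(* By Euler's identity the part of degree [l + 1] is determined by the parts of
   degree [l] of the partial derivatives. *)
Lemma homog_lim l f a r M p : 0 < r -> expands f a r M p -> (forall ks, pderivs ks f a = 0) ->
  forall v, exists K, forall N, cmod (homog l (tprefix p N) v) <= K / 2 ^+ N.
Proof.
elim: l f r M p => [|l IH] f r M p r0 e z v.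
  exists (2 * M) => N; rewrite -cmodN.
  have -> : - homog 0 (tprefix p N) v = f (a + 0) - teval (tprefix p N) 0.
    rewrite addr0 [f a](z [::]) sub0r; congr (- _); rewrite /homog /teval big_mkcond.
    apply: eq_bigr => -[c w] _ /=; case: w => [|i w] /=; first by rewrite !weval_nil.
    by rewrite weval_cons mxE mul0r mulr0.
  by apply: e.2 => i; rewrite mxE cmod0 ltW.
have [_ he] := expands_strong_diff r0 e.
have z' k ks : pderivs ks (pderiv k f) a = 0.
  by have := z (ks ++ [:: k]); rewrite /pderivs foldr_cat.
have /choice [K hK] : forall k, exists K, forall N, cmod (homog l (tderiv k (tprefix p N)) v) <= K / 2 ^+ N.
  move=> k; have [|K hK] := IH _ _ _ _ _ (he k) (z' k) v; first by rewrite divr_gt0.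
  by exists K => N; rewrite -tprefix_tderiv.
exists (\sum_k cmod (v 0 k) * K k) => N.
apply: le_trans (_ : cmod (l.+1%:R * homog l.+1 (tprefix p N) v) <= _).
  rewrite cmodM ler_peMl ?cmod_ge0 //.
  have -> : (l.+1%:R : C) = (l.+1%:R : R)%:C%C by rewrite rmorph_nat.
  by rewrite cmodR ger0_norm // ler1n.
rewrite homog_tderiv (le_trans (cmod_sum _ _)) // mulr_suml; apply: ler_sum => k _.
by rewrite cmodM -mulrA ler_wpM2l ?cmod_ge0.
Qed.

(** The coefficients of the blocks need not be zero: equal monomials may be spread over several
    blocks and cancel only in the limit. For a fixed degree l the parts of degree below l of the
    prefixes tend to 0, while the rest is at most 2M/2^l on the polydisc of half radius. So N goes
    to infinity first, then l. *)
Lemma flat_vanish f a : analytic_germ f a -> (forall ks, pderivs ks f a = 0) -> \forall x \near a, f x = 0.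
Proof.
move=> [r [M [p [r0 e]]]] z; apply/nbhs_polydisc; exists (r / 2) => [|v b]; first by rewrite divr_gt0.
have M0 := expands_M (ltW r0) e.
have H (l : nat) : exists K : R, forall N, cmod (teval (tprefix p N) v) <= K / 2 ^+ N + cmod (homog_ge l (tprefix p N) v).
  elim: l => [|l [K hK]]; first by exists 0 => N; rewrite mul0r add0r homog_ge0.
  have [K' hK'] := homog_lim l r0 e z v; exists (K + K') => N.
  apply: le_trans (hK N) _; rewrite homog_geS mulrDl -addrA lerD2l.
  by apply: le_trans (cmodD _ _) _; rewrite lerD2r.
apply: cmod_le0; apply: (@le_geo _ _ _ (2 * M)) => L'; rewrite add0r.
have [K hK] := H L'; apply: (@le_geo _ _ _ (2 * M + K)) => N.
rewrite -(subrK (teval (tprefix p N) v) (f _)); apply: le_trans (cmodD _ _) _.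
have E1 := e.2 v (polydisc_le (_ : r / 2 <= r) b) N.
have rr : r / 2 <= r by lra.
have E2 := homog_ge_le L' (tprefix p N) (ltW r0) b.
have E3 : tnorm r (tprefix p N) / 2 ^+ L' <= 2 * M / 2 ^+ L'.
  by rewrite ler_wpM2r ?invr_ge0 ?exprn_ge0 // (tprefix_tnorm2 _ (ltW r0) e).
have := hK N; have := E1 rr; rewrite [(2 * M + K) / _]mulrDl; lra.
Qed.

End Partials.

(** * Agreement of the block expansions with power series in multi-indices *)

Section PowerSeries.
Variables (R : realType) (n : nat).
Local Notation C := (Cplx R).
Local Notation I := 'I_n.+1.
Local Notation V := 'rV[Cplx R]_n.+1.
Local Notation term := (Cplx R * seq 'I_n.+1)%type.
Local Notation mi := {ffun 'I_n.+1 -> nat}.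
Implicit Types (f : V -> C) (a v : V) (w : seq I) (r M : R) (P : seq term) (m : mi).

Lemma ltcP (e : C) : 0 < e -> exists2 d : R, 0 < d & e = d%:C%C.
Proof.
move=> e0; exists (complex.Re e); first by move: e0; rewrite ltcE => /andP[].
by move: e0; rewrite ltcE => /andP[/eqP]; case: (e) => x y /= ->.
Qed.

Lemma realC_prod (r : R) k : (r%:C%C : C) ^+ k = (r ^+ k)%:C%C.
Proof. by rewrite rmorphXn. Qed.

Definition cube_index (N : nat) (m : {ffun I -> 'I_N}) : mi := [ffun i => m i : nat].
Definition index_word m : seq I := flatten [seq nseq (m i) i | i <- enum I].
Definition index_deg m : nat := (\sum_i m i)%N.
Definition word_count w : mi := [ffun i => count_mem i w].

Lemma size_index_word m : size (index_word m) = index_deg m.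
Proof.
rewrite /index_word size_flatten /shape -map_comp sumnE big_map big_enum /=.
by apply: eq_bigr => i _; rewrite size_nseq.
Qed.

Lemma weval_index_word m v : weval (index_word m) v = \prod_i v 0 i ^+ m i.
Proof.
rewrite /weval /index_word big_flatten big_map big_enum /=; apply: eq_bigr => i _.
by rewrite big_nseq iter_mulr mulr1.
Qed.

Lemma weval_word_count w v : weval w v = \prod_i v 0 i ^+ word_count w i.
Proof.
elim: w => [|j w IH]; first by rewrite weval_nil big1 // => i _; rewrite ffunE.
rewrite weval_cons IH (bigD1 j) // [in RHS](bigD1 j) //= !ffunE /= eqxx exprS mulrA.
congr (_ * _); apply: eq_bigr => i ij; rewrite !ffunE /=.
by rewrite eq_sym (negbTE ij) add0n.
Qed.

Lemma size_word_count w : size w = index_deg (word_count w).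
Proof.
elim: w => [|j w IH]; first by rewrite /index_deg big1 // => i _; rewrite ffunE.
rewrite /= IH /index_deg (bigD1 j) // [in RHS](bigD1 j) //= !ffunE /= eqxx add1n addSn.
congr (_ + _).+1; apply: eq_bigr => i ij; rewrite !ffunE /=.
by rewrite eq_sym (negbTE ij) add0n.
Qed.

Lemma index_deg_ge m i : (m i <= index_deg m)%N.
Proof. by rewrite /index_deg (bigD1 i) //= leq_addr. Qed.

(** The multi-indices of the cube of side N + 1 that are not in the cube of side N. Having an entry
    equal to N, they have degree at least N, so halving the radius gains the factor 2^-N required of
    a block. *)
Definition shell (c : mi -> C) (N : nat) : seq term :=
  [seq (c (cube_index u), index_word (cube_index u)) | u : {ffun I -> 'I_N.+1} <- enum {ffun I -> 'I_N.+1} & [exists i, u i == N :> nat]].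

Lemma shellE (T : nmodType) (F : mi -> T) (N : nat) :
  \sum_(m : {ffun I -> 'I_N.+1}) F (cube_index m) =
  \sum_(m : {ffun I -> 'I_N}) F (cube_index m) +
  \sum_(m : {ffun I -> 'I_N.+1} | [exists i, m i == N :> nat]) F (cube_index m).
Proof.
rewrite (bigID (fun m : {ffun I -> 'I_N.+1} => [exists i, m i == N :> nat])) /= addrC.
congr (_ + _); case: N => [|N].
  rewrite big_pred0; last first.
    by move=> m; apply/negbTE; rewrite negbK; apply/existsP; exists ord0; rewrite ord1.
  by rewrite big_pred0 // => m; case: (m ord0).
rewrite (reindex_onto (fun m : {ffun I -> 'I_N.+1} => [ffun i => widen_ord (leqnSn N.+1) (m i)])
   (fun m : {ffun I -> 'I_N.+2} => [ffun i => inord (m i) : 'I_N.+1])) /=; last first.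
  move=> m /existsPn h; apply/ffunP => i; rewrite !ffunE; apply/val_inj => /=.
  rewrite inordK // ltn_neqAle; have := h i; have := ltn_ord (m i).
  by rewrite ltnS => -> ->.
apply: eq_big => [m|m _].
  apply/andP; split.
    by apply/existsPn => i; rewrite ffunE /= neq_ltn ltn_ord.
  by apply/eqP/ffunP => i; rewrite !ffunE /= inord_val.
by congr F; apply/ffunP => i; rewrite !ffunE.
Qed.

Lemma big_shell (T : nmodType) (F : term -> T) c N :
  \sum_(t <- shell c N) F t = \sum_(u : {ffun I -> 'I_N.+1} | [exists i, u i == N :> nat])
     F (c (cube_index u), index_word (cube_index u)).
Proof. by rewrite /shell big_map big_filter big_enum_cond. Qed.

Lemma teval_shell c N v : teval (tprefix (shell c) N) v =
  \sum_(u : {ffun I -> 'I_N}) c (cube_index u) * \prod_i v 0 i ^+ cube_index u i.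
Proof.
elim: N => [|N IH].
  by rewrite /tprefix /teval big_nil big_pred0 // => m; case: (m ord0).
rewrite tprefixS teval_cat IH (shellE (fun m : mi => c m * \prod_i v 0 i ^+ m i)).
by congr (_ + _); rewrite /teval big_shell; apply: eq_bigr => u _; rewrite weval_index_word.
Qed.

Lemma analytic_at_germ f a : analytic_at f a -> analytic_germ f a.
Proof.
move=> [c [r' [M' [/ltcP[r r0 ->] hb hc]]]].
pose M := complex.Re M'.
have bound N : \sum_(u : {ffun I -> 'I_N}) cmod (c (cube_index u)) * r ^+ index_deg (cube_index u) <= M.
  have := hb N; rewrite lecE => /andP[_]; apply: le_trans.
  rewrite le_eqVlt; apply/orP; left; apply/eqP.
  rewrite raddf_sum; apply: eq_bigr => u _.
  rewrite normE realC_prod -rmorphM /= /index_deg.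
  by congr (_ * _ ^+ _); apply: eq_bigr => i _; rewrite ffunE.
have r2 : 0 < r / 2 by rewrite divr_gt0.
have nb N : tnorm (r / 2) (shell c N) <= M / 2 ^+ N.
  rewrite /tnorm big_shell /=.
  apply: le_trans (_ : (\sum_(u : {ffun I -> 'I_N.+1}) cmod (c (cube_index u)) * r ^+ index_deg (cube_index u)) / 2 ^+ N <= _); last first.
    by rewrite ler_wpM2r ?invr_ge0 ?exprn_ge0.
  rewrite mulr_suml big_mkcond; apply: ler_sum => u _.
  case: existsP => [[i /eqP ui]|_]; last by rewrite !mulr_ge0 ?cmod_ge0 ?invr_ge0 ?exprn_ge0 ?(ltW r0).
  rewrite size_index_word -mulrA ler_wpM2l ?cmod_ge0 // expr_div_n ler_wpM2l ?exprn_ge0 ?(ltW r0) //.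
  rewrite lef_pV2 ?posrE ?exprn_gt0 // ler_weXn2l ?ler1n //.
  by apply: leq_trans (index_deg_ge _ i); rewrite ffunE ui.
exists (r / 2), M, (shell c); split=> //; split=> // v b N.
have [l hl] := teval_tprefix_cauchy (ltW r2) b nb.
suff -> : f (a + v) = l by [].
apply/eqP; rewrite -subr_eq0; apply/eqP/cmod_le0; apply: (@le_geo _ _ _ (1 + 2 * M)) => K.
rewrite add0r; have vr i : `|v 0 i| < r%:C%C.
  by rewrite normE ltcR (le_lt_trans (b i)) //; lra.
have e0 : 0 < (1 / 2 ^+ K)%:C%C :> C by rewrite ltcR divr_gt0 ?exprn_gt0.
have /cvgrPdist_le /(_ _ e0) [N0 _ hN] := hc v vr.
have := hN (maxn N0 K) (leq_maxl _ _); rewrite /= normE lecR.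
have -> : \sum_(m : {ffun I -> 'I_(maxn N0 K)}) c [ffun i => m i : nat] * \prod_i v 0 i ^+ m i
  = teval (tprefix (shell c) (maxn N0 K)) v.
  rewrite teval_shell; apply: eq_bigr => u _; congr (_ * _).
  by apply: eq_bigr => i _; rewrite ffunE.
move=> h1; have h2 := hl (maxn N0 K).
have h3 : 2 * M / 2 ^+ (maxn N0 K) <= 2 * M / 2 ^+ K.
  rewrite ler_wpM2l ?lef_pV2 ?posrE ?exprn_gt0 // ?ler_weXn2l ?ler1n ?leq_maxr //.
  have := le_trans (tnorm_ge0 _ (ltW r2)) (nb 0); rewrite expr0 divr1; lra.
apply: le_trans (cmod_tri _ (teval (tprefix (shell c) (maxn N0 K)) v) _) _.
rewrite mulrDl; rewrite cmodBC in h2; lra.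
Qed.

Definition tcoef P m : C := \sum_(t <- P | word_count t.2 == m) t.1.

Lemma tcoef_cat P P' m : tcoef (P ++ P') m = tcoef P m + tcoef P' m.
Proof. by rewrite /tcoef big_cat. Qed.

Lemma cube_index_inj N : injective (@cube_index N).
Proof.
move=> u u' /ffunP h; apply/ffunP => i; apply/val_inj.
by have := h i; rewrite !ffunE.
Qed.

Lemma sum_cube (T : nmodType) (F : term -> T) P N :
  \sum_(u : {ffun I -> 'I_N}) \sum_(t <- P | word_count t.2 == cube_index u) F t
  = \sum_(t <- P | [forall i, (word_count t.2 i < N)%N]) F t.
Proof.
under eq_bigr do rewrite big_mkcond; rewrite exchange_big /= [RHS]big_mkcond.
apply: eq_bigr => t _; case: forallP => [h|h].
  rewrite (bigD1 [ffun i => Ordinal (h i)]) //= big1 => [|u hu].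
    rewrite addr0; case: eqP => // -[]; apply/ffunP => i.
    by rewrite [RHS]ffunE [in RHS]ffunE.
  case: eqP => // e; case/eqP: hu; apply: cube_index_inj; rewrite -e.
  by apply/ffunP => i; rewrite [RHS]ffunE [in RHS]ffunE.
apply: big1 => u _; case: eqP => // e; case: h => i; rewrite e ffunE; exact: ltn_ord.
Qed.

(** The coefficient of a multi-index is the limit of its coefficients in the prefixes, which
    converge because the norm of a block bounds each coefficient times r^degree. Limit and sum are
    exchanged on one cube at a time: the error B N * 2M/2^K contains the number B N of its
    multi-indices and vanishes as K grows with N fixed. *)
Lemma germ_analytic_at f a : analytic_germ f a -> analytic_at f a.
Proof.
move=> [r [M [p [r0 e]]]]; have M0 := expands_M (ltW r0) e.
have cb m K : cmod (tcoef (tprefix p K.+1) m - tcoef (tprefix p K) m) <= (M / r ^+ index_deg m) / 2 ^+ K.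
  rewrite tprefixS tcoef_cat addrC addKr mulrAC ler_pdivlMr ?exprn_gt0 //.
  apply: le_trans (e.1 K); rewrite /tcoef big_mkcond.
  apply: le_trans (ler_wpM2r _ (cmod_sum _ _)) _; first by rewrite exprn_ge0 ?ltW.
  rewrite mulr_suml; apply: ler_sum => t _; case: eqP => [<-|_].
    by rewrite -size_word_count.
  by rewrite cmod0 mul0r mulr_ge0 ?cmod_ge0 ?exprn_ge0 ?(ltW r0).
have /choice [c hc] : forall m, exists l, forall K, cmod (l - tcoef (tprefix p K) m) <= 2 * (M / r ^+ index_deg m) / 2 ^+ K.
  by move=> m; exact: geo_cauchy (cb m).
have hc' m K : cmod (c m - tcoef (tprefix p K) m) * r ^+ index_deg m <= 2 * M / 2 ^+ K.
  have := hc m K; rewrite -ler_pdivlMr ?exprn_gt0 // => h; apply: le_trans h _.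
  by rewrite le_eqVlt; apply/orP; left; apply/eqP; ring.
pose B N : R := #|{ffun I -> 'I_N}|%:R.
have sumc N K : \sum_(u : {ffun I -> 'I_N}) cmod (c (cube_index u) - tcoef (tprefix p K) (cube_index u)) * r ^+ index_deg (cube_index u)
   <= B N * (2 * M) / 2 ^+ K.
  apply: le_trans (ler_sum _ (fun u _ => hc' (cube_index u) K)) _.
  rewrite sumr_const -(mulr_natl _ #|_|) le_eqVlt; apply/orP; left; apply/eqP.
  by rewrite -(mulrA (B N)).
exists c, (r / 2)%:C%C, (2 * M)%:C%C; split.
- by rewrite ltcR divr_gt0.
- move=> N.
  have -> : \sum_(m : {ffun I -> 'I_N}) `|c [ffun i => m i : nat]| * (r / 2)%:C%C ^+ (\sum_i m i)%N
    = (\sum_(u : {ffun I -> 'I_N}) cmod (c (cube_index u)) * (r / 2) ^+ index_deg (cube_index u))%:C%C.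
    rewrite rmorph_sum; apply: eq_bigr => u _; rewrite normE realC_prod -rmorphM /index_deg /=.
    by congr (_ * _ ^+ _)%:C%C; apply: eq_bigr => i _; rewrite ffunE.
  rewrite lecR; apply: (@le_geo _ _ _ (B N * (2 * M))) => K.
  apply: le_trans (_ : \sum_(u : {ffun I -> 'I_N}) (cmod (tcoef (tprefix p K) (cube_index u)) * r ^+ index_deg (cube_index u)
     + cmod (c (cube_index u) - tcoef (tprefix p K) (cube_index u)) * r ^+ index_deg (cube_index u)) <= _).
    apply: ler_sum => u _; rewrite -mulrDl; apply: ler_pM; rewrite ?cmod_ge0 ?exprn_ge0 ?divr_ge0 ?(ltW r0) //.
      by rewrite -{1}(subrK (tcoef (tprefix p K) (cube_index u)) (c _)) addrC cmodD.
    by apply: lerXn2r; rewrite ?nnegrE ?divr_ge0 ?(ltW r0) //; lra.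
  rewrite big_split /=; apply: lerD (sumc N K).
  apply: le_trans (tprefix_tnorm2 K (ltW r0) e).
  apply: le_trans (_ : \sum_(u : {ffun I -> 'I_N}) \sum_(t <- tprefix p K | word_count t.2 == cube_index u) cmod t.1 * r ^+ size t.2 <= _).
    apply: ler_sum => u _; rewrite /tcoef big_mkcond.
    apply: le_trans (ler_wpM2r _ (cmod_sum _ _)) _; first by rewrite exprn_ge0 ?ltW.
    rewrite mulr_suml [leRHS]big_mkcond; apply: ler_sum => t _; case: eqP => [<-|_].
      by rewrite -size_word_count.
    by rewrite cmod0 mul0r.
  rewrite sum_cube big_mkcond; apply: ler_sum => t _; case: ifP => // _.
  by rewrite mulr_ge0 ?cmod_ge0 ?exprn_ge0 ?(ltW r0).
- move=> v vb; have b : polydisc (r / 2) v.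
    by move=> i; have := vb i; rewrite normE ltcR => /ltW.
  have b' : polydisc r v by apply: polydisc_le b; lra.
  have main N : cmod (f (a + v) - \sum_(u : {ffun I -> 'I_N}) c (cube_index u) * \prod_i v 0 i ^+ cube_index u i)
     <= 2 * M / 2 ^+ N.
    apply: (@le_geo _ _ _ (2 * M + B N * (2 * M))) => K.
    set S := \sum_(u : _) _.
    (* The part of the K-th prefix lying in the cube. What is left out has degree at least N, hence
       is at most 2M/2^N at half the radius, whatever K. *)
    pose S' := \sum_(u : {ffun I -> 'I_N}) tcoef (tprefix p K) (cube_index u) * \prod_i v 0 i ^+ cube_index u i.
    have E1 : cmod (S' - S) <= B N * (2 * M) / 2 ^+ K.
      apply: le_trans (sumc N K); rewrite /S' /S -sumrB.
      apply: le_trans (cmod_sum _ _) _; apply: ler_sum => u _.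
      rewrite -mulrBl cmodM cmodBC ler_wpM2l ?cmod_ge0 // -weval_index_word -size_index_word.
      exact: weval_le.
    have E2 : cmod (teval (tprefix p K) v - S') <= 2 * M / 2 ^+ N.
      have -> : S' = \sum_(t <- tprefix p K | [forall i, (word_count t.2 i < N)%N]) t.1 * weval t.2 v.
        rewrite -(sum_cube (fun t : term => t.1 * weval t.2 v)); apply: eq_bigr => u _.
        by rewrite /tcoef mulr_suml; apply: eq_bigr => t /eqP <-; rewrite weval_word_count.
      apply: le_trans (ler_wpM2r _ (tprefix_tnorm2 K (ltW r0) e)); last by rewrite invr_ge0 exprn_ge0.
      rewrite big_mkcond /teval -sumrB; apply: le_trans (cmod_sum _ _) _.
      rewrite /tnorm mulr_suml; apply: ler_sum => t _; case: (boolP [forall i, _]) => [_|].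
        by rewrite subrr cmod0 !mulr_ge0 ?cmod_ge0 ?invr_ge0 ?exprn_ge0 ?(ltW r0).
      move=> /forallPn /= [j]; rewrite -leqNgt => Ni.
      rewrite subr0 cmodM -mulrA ler_wpM2l ?cmod_ge0 // (le_trans (weval_le _ b)) // expr_div_n.
      rewrite ler_wpM2l ?exprn_ge0 ?(ltW r0) // lef_pV2 ?posrE ?exprn_gt0 // ler_weXn2l ?ler1n //.
      by rewrite size_word_count (leq_trans Ni) // index_deg_ge.
    have E3 := e.2 v b' K.
    apply: le_trans (cmod_tri _ (teval (tprefix p K) v) _) _.
    have := cmod_tri (teval (tprefix p K) v) S' S.
    rewrite (mulrDl (2 * M)); lra.
  apply/cvgrPdist_le => _ /ltcP[d d0 ->].
  have [N0 hN0] := geo_small (2 * M) d0.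
  exists N0 => // N /= NN; rewrite normE lecR; apply: le_trans (hN0 N NN).
  apply: le_trans (main N); rewrite le_eqVlt; apply/orP; left; apply/eqP.
  congr (cmod (_ - _)); apply: eq_bigr => u _; congr (_ * _).
  by apply: eq_bigr => i _; rewrite ffunE.
Qed.
End PowerSeries.

(** * Differentiability and smoothness of real functions *)

Section RealDiff.
Variables (R : realType) (n : nat).
Local Notation RV := 'rV[R]_n.+1.
Implicit Types (phi psi : RV -> R) (x v h a : RV) (V W : set RV).

Definition rdot a h : R := \sum_k h 0 k * a 0 k.

Lemma rdot_is_linear a : linear (rdot a : RV -> R).
Proof.
move=> c u v; rewrite /rdot scaler_sumr -big_split; apply: eq_bigr => k _ /=.
by rewrite !mxE mulrDl scalerAl.
Qed.
HB.instance Definition _ a := GRing.isLinear.Build R RV R _ (rdot a : RV -> R) (rdot_is_linear a).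

Lemma coord_le_norm h k : `|h 0 k| <= `|h|.
Proof.
rewrite [leRHS]/Num.norm /= mx_normrE; exact: (le_bigmax _ _ (0, k)).
Qed.

Lemma rdot_continuous a : continuous (rdot a).
Proof.
move=> x; apply: differentiable_continuous.
have -> : rdot a = \sum_k (fun h : RV => h 0 k * a 0 k).
  by apply/funext => h; rewrite /rdot fct_sumE.
apply: differentiable_sum => k; apply: differentiableM => //.
exact: differentiable_coord.
Qed.

Definition quad_diff phi x a := exists K d : R, 0 < d /\
  forall h, (forall i, `|h 0 i| <= d) -> `|phi (x + h) - phi x - rdot a h| <= K * (\sum_i `|h 0 i|) ^+ 2.

Lemma quad_diff_diff phi x a : quad_diff phi x a -> is_diff x phi (rdot a).
Proof.
move=> [K [d [d0 hd]]].
have lo : phi \o shift x = cst (phi x) + rdot a +o_ (0 : RV) id.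
  apply/eqaddoP => e e0.
  pose c := `|K| * n.+1%:R ^+ 2 + 1; have c0 : 0 < c.
    by rewrite ltr_pwDr // mulr_ge0 // exprn_ge0.
  have m0 : 0 < Num.min d (e / c) by rewrite lt_min d0 divr_gt0.
  apply/nbhs_ballP; exists (Num.min d (e / c)) => // h.
  rewrite -ball_normE /= sub0r normrN lt_min => /andP[h1 h2].
  have -> : (phi \o +%R^~ x - (cst (phi x) + rdot a)) h = phi (x + h) - phi x - rdot a h.
    by rewrite [x + h]addrC -addrA -opprD.
  apply: le_trans (hd h _) _.
    by move=> i; apply: le_trans (coord_le_norm _ _) (ltW h1).
  have s1 : \sum_i `|h 0 i| <= n.+1%:R * `|h|.
    apply: le_trans (ler_sum _ (fun i _ => coord_le_norm h i)) _.
    by rewrite sumr_const card_ord mulr_natl.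
  have s0 : 0 <= \sum_i `|h 0 i| by exact: sumr_ge0.
  apply: le_trans (_ : `|K| * (n.+1%:R * `|h|) ^+ 2 <= _).
    apply: le_trans (_ : `|K| * (\sum_i `|h 0 i|) ^+ 2 <= _).
      by rewrite ler_wpM2r ?exprn_ge0 // ler_norm.
    by rewrite ler_wpM2l // lerXn2r // ?nnegrE // mulr_ge0.
  rewrite exprMn mulrA expr2 mulrA ler_wpM2r //.
  apply: le_trans (_ : c * `|h| <= _); first by rewrite ler_wpM2r // /c; lra.
  by rewrite mulrC -ler_pdivlMr // ltW.
have dE : 'd phi x = rdot a :> (RV -> R) by apply: diff_unique lo; exact: rdot_continuous.
split=> //; apply/diff_locallyP; rewrite dE; split=> //; exact: rdot_continuous.
Qed.

(** Differentiability is asked at every order, and not only directional derivatives as in [Ck]: the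
    chain rule and the linearity of ['D_v] in [v] call for it. [Ck] is recovered in
    [smooth_order_Ck]. *)
Fixpoint smooth_order (k : nat) V phi : Prop :=
  (forall x, V x -> differentiable phi x) /\
  (if k is k'.+1 then forall v, smooth_order k' V ('D_v phi) else True).

Lemma smooth_order_diff k V phi x : smooth_order k V phi -> V x -> differentiable phi x.
Proof. by case: k => [|k] [h _]; exact: h. Qed.

Lemma open_near V x (P : RV -> Prop) : open V -> V x -> (forall y, V y -> P y) -> \forall y \near x, P y.
Proof. by move=> oV Vx h; apply: filterS h _; exact: open_nbhs_nbhs. Qed.

Lemma differentiable_near phi psi x : (\forall y \near x, phi y = psi y) ->
  differentiable phi x -> differentiable psi x.
Proof.
move=> e /diff_locallyP [c lo].
have e0 : phi x = psi x by exact: nbhs_singleton e.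
have lo' : psi \o shift x = cst (psi x) + 'd phi x +o_ (0 : RV) id.
  move: lo => /eqaddoP lo; apply/eqaddoP => r r0; have := lo r r0; rewrite -e0.
  have es : \forall h \near (0 : RV), phi (h + x) = psi (h + x).
    by move: e; rewrite (near_shift 0) /= => e; apply: filterS e => y; rewrite /= subr0.
  by apply: filterS2 es => h /= eh; rewrite /= /GRing.add /= eh.
have dE : 'd psi x = 'd phi x :> (RV -> R) by exact: diff_unique lo'.
by apply/diff_locallyP; rewrite dE; split.
Qed.

Lemma derive_near phi psi x v : (\forall y \near x, phi y = psi y) -> 'D_v phi x = 'D_v psi x.
Proof. exact: near_eq_derive. Qed.

Lemma smooth_order_ext k V phi psi : open V -> (forall x, V x -> phi x = psi x) -> smooth_order k V phi -> smooth_order k V psi.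
Proof.
move=> oV; elim: k phi psi => [|k IH] phi psi e [h1 h2]; split=> //.
- by move=> x Vx; apply: differentiable_near (h1 x Vx); exact: open_near e.
- by move=> x Vx; apply: differentiable_near (h1 x Vx); exact: open_near e.
- move=> v; apply: IH (h2 v) => x Vx; apply: derive_near; exact: open_near e.
Qed.

Lemma smooth_order_pred k V phi : smooth_order k.+1 V phi -> smooth_order k V phi.
Proof.
elim: k phi => [|k IH] phi [h1 h2]; split=> // v; exact/IH/h2.
Qed.

Lemma smooth_orderD k V phi psi : open V -> smooth_order k V phi -> smooth_order k V psi -> smooth_order k V (fun x => phi x + psi x).
Proof.
move=> oV; elim: k phi psi => [|k IH] phi psi [h1 h2] [g1 g2].
  by split=> // x Vx; apply: differentiableD; [exact: h1|exact: g1].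
split=> [x Vx|v]; first by apply: differentiableD; [exact: h1|exact: g1].
apply: (smooth_order_ext oV _ (IH _ _ (h2 v) (g2 v))) => x Vx.
by rewrite [RHS]deriveD //; apply: diff_derivable; [exact: h1|exact: g1].
Qed.

Lemma smooth_orderM k V phi psi : open V -> smooth_order k V phi -> smooth_order k V psi -> smooth_order k V (fun x => phi x * psi x).
Proof.
move=> oV; elim: k phi psi => [|k IH] phi psi h g.
  by split=> // x Vx; apply: differentiableM; [exact: smooth_order_diff h Vx|exact: smooth_order_diff g Vx].
split=> [x Vx|v]; first by apply: differentiableM; [exact: smooth_order_diff h Vx|exact: smooth_order_diff g Vx].
have h' := smooth_order_pred h; have g' := smooth_order_pred g.
apply: (smooth_order_ext oV _ (smooth_orderD oV (IH _ _ h' (g.2 v)) (IH _ _ g' (h.2 v)))) => x Vx.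
rewrite [RHS]deriveM //; apply: diff_derivable; [exact: smooth_order_diff h Vx|exact: smooth_order_diff g Vx].
Qed.

Lemma smooth_order_cst k V (c : R) : open V -> smooth_order k V (fun=> c).
Proof.
move=> oV; elim: k c => [|k IH] c; split=> // v.
by apply: (smooth_order_ext oV _ (IH 0)) => x Vx; rewrite derive_cst.
Qed.

Lemma smooth_orderN k V phi : open V -> smooth_order k V phi -> smooth_order k V (fun x => - phi x).
Proof.
move=> oV h; apply: (smooth_order_ext oV _ (smooth_orderM oV (smooth_order_cst k (-1) oV) h)) => x Vx; exact: mulN1r.
Qed.

Lemma smooth_orderV k V phi : open V -> (forall x, V x -> phi x != 0) -> smooth_order k V phi -> smooth_order k V (fun x => (phi x)^-1).
Proof.
move=> oV nz; elim: k phi nz => [|k IH] phi nz h.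
  by split=> // x Vx; apply: differentiableV; [exact: smooth_order_diff h Vx|exact: nz].
split=> [x Vx|v]; first by apply: differentiableV; [exact: smooth_order_diff h Vx|exact: nz].
have i := IH _ nz (smooth_order_pred h).
apply: (smooth_order_ext oV _ (smooth_orderN oV (smooth_orderM oV (smooth_orderM oV i i) (h.2 v)))) => x Vx.
rewrite [RHS]deriveV ?nz //; last by apply: diff_derivable; exact: smooth_order_diff h Vx.
by rewrite /GRing.scale /= expr2 invfM mulNr.
Qed.

Lemma smooth_order_local k V phi : (forall x, V x -> exists W, [/\ W x & smooth_order k W phi]) -> smooth_order k V phi.
Proof.
elim: k phi => [|k IH] phi h; split=> //.
- by move=> x /h[W [Wx hW]]; exact: smooth_order_diff hW Wx.
- by move=> x /h[W [Wx hW]]; exact: smooth_order_diff hW Wx.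
- by move=> v; apply: IH => x /h[W [Wx hW]]; exists W; split=> //; exact: hW.2.
Qed.

Lemma rV_continuous (f : RV -> RV) x : (forall j, {for x, continuous (fun y => f y 0 j)}) ->
  {for x, continuous f}.
Proof.
move=> h; apply: (proj2 (@cvgrPdist_le _ _ _ _ (nbhs_filter x) f (f x))) => e e0.
have H : \forall y \near x, forall j, `|f x 0 j - f y 0 j| <= e.
  apply: (@filter_forall _ _ _ _ (nbhs_filter x)) => j.
  exact: (proj1 (@cvgrPdist_le _ _ _ _ (nbhs_filter x) (fun y => f y 0 j) (f x 0 j)) (h j) e e0).
apply: (@filterS _ _ (nbhs_filter x) _ _ _ H) => y hy.
rewrite [leLHS]/Num.norm /= mx_normrE (bigmax_le _ (ltW e0))//= => -[i j] _ /=.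
by rewrite !mxE (ord1 i).
Qed.

Lemma smooth_order_Ck k V (f : RV -> RV) : open V -> (forall j, smooth_order k V (fun x => f x 0 j)) -> Ck k V f.
Proof.
move=> oV; elim: k f => [|k IH] f h /=.
  move=> x Vx; apply: rV_continuous => j; apply: differentiable_continuous.
  exact: smooth_order_diff (h j) Vx.
have dv x v : V x -> derivable f x v.
  move=> Vx; apply/derivable_mxP => i j; rewrite (ord1 i); apply: diff_derivable.
  exact: smooth_order_diff (h j) Vx.
move=> v; split=> [x Vx|]; first exact: dv.
apply: IH => j; apply: (smooth_order_ext oV _ ((h j).2 v)) => x Vx.
by rewrite derive_mx ?mxE //; exact: dv.
Qed.
End RealDiff.

Section ReIm.
Variable R : realType.
Implicit Types z w : Cplx R.
Lemma cReD z w : complex.Re (z + w) = complex.Re z + complex.Re w.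
Proof. by case: z w => [a b] [c d]. Qed.
Lemma cImD z w : complex.Im (z + w) = complex.Im z + complex.Im w.
Proof. by case: z w => [a b] [c d]. Qed.
Lemma cReN z : complex.Re (- z) = - complex.Re z. Proof. by case: z. Qed.
Lemma cImN z : complex.Im (- z) = - complex.Im z. Proof. by case: z. Qed.
Lemma cReM z w : complex.Re (z * w) = complex.Re z * complex.Re w - complex.Im z * complex.Im w.
Proof. by case: z w => [a b] [c d]. Qed.
Lemma cImM z w : complex.Im (z * w) = complex.Re z * complex.Im w + complex.Im z * complex.Re w.
Proof. by case: z w => [a b] [c d]. Qed.
Lemma cRe_sum (J : Type) (r : seq J) (F : J -> Cplx R) :
  complex.Re (\sum_(j <- r) F j) = \sum_(j <- r) complex.Re (F j).
Proof. by elim: r => [|j r IH]; rewrite ?big_nil // !big_cons cReD IH. Qed.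
Lemma cIm_sum (J : Type) (r : seq J) (F : J -> Cplx R) :
  complex.Im (\sum_(j <- r) F j) = \sum_(j <- r) complex.Im (F j).
Proof. by elim: r => [|j r IH]; rewrite ?big_nil // !big_cons cImD IH. Qed.
Lemma cReMr z (c : R) : complex.Re (z * c%:C%C) = complex.Re z * c.
Proof. by case: z => a b /=; rewrite mulr0 subr0. Qed.
Lemma cImMr z (c : R) : complex.Im (z * c%:C%C) = complex.Im z * c.
Proof. by case: z => a b /=; rewrite mulr0 add0r. Qed.
Lemma Cplx_eq z w : complex.Re z = complex.Re w -> complex.Im z = complex.Im w -> z = w.
Proof. by case: z w => [a b] [c d] /= -> ->. Qed.
End ReIm.

(** * Totally real slices *)

Section Slices.
Variables (R : realType) (n : nat).
Local Notation C := (Cplx R).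
Local Notation I := 'I_n.+1.
Local Notation V := 'rV[Cplx R]_n.+1.
Local Notation RV := 'rV[R]_n.+1.
Implicit Types (f g : V -> C) (p q : V) (x v : RV) (s : I -> C) (F G : RV -> C).

(** Treats both totally real slices at once: all [s j] equal to 1 give R^4_p, and the coefficients
    (-i, 1, 1, 1) give M^4_p. Only |s j| = 1 is ever asked. *)
Definition slice s v : V := \row_j (s j * (v 0 j)%:C%C).

Lemma sliceD s v v' : slice s (v + v') = slice s v + slice s v'.
Proof. by apply/rowP => j; rewrite !mxE rmorphD mulrDr. Qed.
Lemma dotD (h h' L : V) : dot (h + h') L = dot h L + dot h' L.
Proof. by rewrite /dot -big_split; apply: eq_bigr => k _; rewrite mxE mulrDl. Qed.
Lemma dotZ (c : C) (h L : V) : dot (c *: h) L = c * dot h L.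
Proof. by rewrite /dot mulr_sumr; apply: eq_bigr => k _; rewrite mxE mulrA. Qed.

Lemma slice_cube_polydisc s (d : R) v : (forall j, cmod (s j) = 1) ->
  (forall j, `|v 0 j| <= d) -> polydisc d (slice s v).
Proof. by move=> s1 h j; rewrite mxE cmodM s1 mul1r cmodR. Qed.

Lemma nbhs_cube x (S : set RV) :
  nbhs x S <-> exists2 d : R, 0 < d & forall v, (forall j, `|v 0 j| <= d) -> S (x + v).
Proof.
split=> [/nbhs_ballP[e /= e0 es]|[d d0 h]].
  exists (e / 2) => [|v b]; first by rewrite divr_gt0.
  apply: es; split=> // i j; rewrite /ball /= mxE opprD addNKr normrN (ord1 i).
  apply: le_lt_trans (b j) _; lra.
apply/nbhs_ballP; exists d => //= y [_ yb]; rewrite -(subrK x y) addrC; apply: h => j.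
by have := yb 0 j; rewrite /ball /= distrC !mxE => /ltW.
Qed.

Lemma slice_near s p x (P : V -> Prop) : (forall j, cmod (s j) = 1) ->
  (\forall y \near p + slice s x, P y) -> \forall x' \near x, P (p + slice s x').
Proof.
move=> s1 /nbhs_polydisc[d d0 h]; apply/nbhs_cube; exists d => // v b.
by rewrite sliceD addrA; apply: h; exact: slice_cube_polydisc.
Qed.

Lemma slice_open s p (A : set V) : (forall j, cmod (s j) = 1) -> open A ->
  open [set x | A (p + slice s x)].
Proof.
move=> s1 oA; rewrite openE => x Ax; apply: slice_near => //.
exact: open_nbhs_nbhs.
Qed.

(** The source is a real space and the target a complex one; splitting into real and imaginary parts
    keeps a single field of scalars. *)
Definition cplx_derive F x v (L : C) :=
  is_derive x v (fun y => complex.Re (F y)) (complex.Re L) /\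
  is_derive x v (fun y => complex.Im (F y)) (complex.Im L).

Lemma rdot_Re s v (L : V) : rdot (\row_k complex.Re (s k * L 0 k)) v = complex.Re (dot (slice s v) L).
Proof.
by rewrite /dot cRe_sum; apply: eq_bigr => k _; rewrite !mxE [in RHS]mulrAC cReMr mulrC.
Qed.
Lemma rdot_Im s v (L : V) : rdot (\row_k complex.Im (s k * L 0 k)) v = complex.Im (dot (slice s v) L).
Proof.
by rewrite /dot cIm_sum; apply: eq_bigr => k _; rewrite !mxE [in RHS]mulrAC cImMr mulrC.
Qed.

Lemma strong_diff_quad_diff s f p x (L : V) : (forall j, cmod (s j) = 1) ->
  strong_diff f (p + slice s x) L ->
  quad_diff (fun y => complex.Re (f (p + slice s y))) x (\row_k complex.Re (s k * L 0 k)) /\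
  quad_diff (fun y => complex.Im (f (p + slice s y))) x (\row_k complex.Im (s k * L 0 k)).
Proof.
move=> s1 [K [d [d0 hd]]].
have lE (v : RV) : l1 (slice s v) = \sum_i `|v 0 i|.
  by apply: eq_bigr => i _; rewrite mxE cmodM s1 mul1r cmodR.
split; exists K, d; split=> // h b.
  rewrite rdot_Re.
  have := hd _ (slice_cube_polydisc s1 b); rewrite -(addrA p) -sliceD lE => h1.
  by apply: le_trans h1; apply: le_trans (Re_cmod _); rewrite !(cReD, cReN).
rewrite rdot_Im.
have := hd _ (slice_cube_polydisc s1 b); rewrite -(addrA p) -sliceD lE => h1.
by apply: le_trans h1; apply: le_trans (Im_cmod _); rewrite !(cImD, cImN).
Qed.

Lemma analytic_germ_diff s f p x : (forall j, cmod (s j) = 1) -> analytic_germ f (p + slice s x) ->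
  differentiable (fun y => complex.Re (f (p + slice s y))) x /\
  differentiable (fun y => complex.Im (f (p + slice s y))) x.
Proof.
by move=> s1 /analytic_germ_strong_diff /(strong_diff_quad_diff s1) [/quad_diff_diff[h1 _] /quad_diff_diff[h2 _]].
Qed.

Lemma diff_is_derive (phi : RV -> R) x v (df : RV -> R) : is_diff x phi df -> is_derive x v phi (df v).
Proof. by move=> [h e]; split; [exact: diff_derivable|rewrite deriveE // e]. Qed.

Lemma analytic_germ_cplx_derive s f p x v : (forall j, cmod (s j) = 1) -> analytic_germ f (p + slice s x) ->
  cplx_derive (fun y => f (p + slice s y)) x v (dot (slice s v) (grad f (p + slice s x))).
Proof.
move=> s1 /analytic_germ_strong_diff /(strong_diff_quad_diff s1) [/quad_diff_diff h1 /quad_diff_diff h2].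
split; first by rewrite -rdot_Re; exact: diff_is_derive h1.
by rewrite -rdot_Im; exact: diff_is_derive h2.
Qed.

Lemma cplx_derive_uniq F x v (L L' : C) : cplx_derive F x v L -> cplx_derive F x v L' -> L = L'.
Proof.
move=> [[_ h1] [_ h2]] [[_ h3] [_ h4]].
by case: L L' h1 h2 h3 h4 => [a b] [c d] /= <- <- -> ->.
Qed.

Lemma cplx_derive_near F G x v (L : C) : (\forall y \near x, F y = G y) -> cplx_derive F x v L -> cplx_derive G x v L.
Proof.
move=> e [h1 h2]; split.
  by apply: near_eq_is_derive h1; apply: filterS e => y ->.
by apply: near_eq_is_derive h2; apply: filterS e => y ->.
Qed.

Lemma is_deriveDr (a b : RV -> R) x v (da db : R) : is_derive x v a da -> is_derive x v b db ->
  is_derive x v (fun y => a y + b y) (da + db).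
Proof.
move=> [a1 <-] [b1 <-]; split; first exact: (@derivableD R _ _ a b x v a1 b1).
exact: (@deriveD R _ _ a b x v a1 b1).
Qed.

Lemma is_deriveBr (a b : RV -> R) x v (da db : R) : is_derive x v a da -> is_derive x v b db ->
  is_derive x v (fun y => a y - b y) (da - db).
Proof.
move=> [a1 <-] [b1 <-]; split; first exact: (@derivableB R _ _ a b x v a1 b1).
exact: (@deriveB R _ _ a b x v a1 b1).
Qed.

Lemma is_deriveMr (a b : RV -> R) x v (da db : R) : is_derive x v a da -> is_derive x v b db ->
  is_derive x v (fun y => a y * b y) (da * b x + a x * db).
Proof.
move=> [a1 <-] [b1 <-]; split; first exact: (@derivableM R _ a b x v a1 b1).
apply: etrans (@deriveM R _ a b x v a1 b1) _.
by rewrite addrC; congr (_ + _); exact: mulrC.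
Qed.

Lemma cplx_deriveD F G x v (L L' : C) : cplx_derive F x v L -> cplx_derive G x v L' ->
  cplx_derive (fun y => F y + G y) x v (L + L').
Proof.
move=> [h1 h2] [h3 h4]; split.
  have h := is_deriveDr h1 h3; rewrite -cReD in h.
  by congr is_derive: h; apply/funext => y; rewrite cReD.
have h := is_deriveDr h2 h4; rewrite -cImD in h.
by congr is_derive: h; apply/funext => y; rewrite cImD.
Qed.

Lemma cplx_deriveM F G x v (L L' : C) : cplx_derive F x v L -> cplx_derive G x v L' ->
  cplx_derive (fun y => F y * G y) x v (L * G x + F x * L').
Proof.
move=> [h1 h2] [h3 h4]; split.
  have h := is_deriveBr (is_deriveMr h1 h3) (is_deriveMr h2 h4).
  congr is_derive: h; first by apply/funext => y; rewrite cReM.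
  by rewrite cReD !cReM; ring.
have h := is_deriveDr (is_deriveMr h1 h4) (is_deriveMr h2 h3).
congr is_derive: h; first by apply/funext => y; rewrite cImM.
by rewrite cImD !cImM; ring.
Qed.

Lemma cplx_derive_cst (c : C) x v : cplx_derive (fun=> c) x v 0.
Proof. by split; exact: is_derive_cst. Qed.

Lemma cplx_derive_real (a : RV -> R) x v (da : R) : is_derive x v a da ->
  cplx_derive (fun y => (a y)%:C%C) x v da%:C%C.
Proof. by split=> //=; exact: is_derive_cst. Qed.

Lemma cplx_deriveZ (c : C) F x v (L : C) : cplx_derive F x v L -> cplx_derive (fun y => c * F y) x v (c * L).
Proof.
by move=> h; have := cplx_deriveM (cplx_derive_cst c x v) h; rewrite mul0r add0r.
Qed.

Lemma cplx_derive_sum (J : Type) (r : seq J) (F : J -> RV -> C) x v (L : J -> C) :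
  (forall j, cplx_derive (F j) x v (L j)) ->
  cplx_derive (fun y => \sum_(j <- r) F j y) x v (\sum_(j <- r) L j).
Proof.
move=> h; elim: r => [|j r IH].
  rewrite big_nil (_ : (fun y => _) = fun=> 0); first exact: cplx_derive_cst.
  by apply/funext => y; rewrite big_nil.
rewrite big_cons (_ : (fun y => _) = fun y => F j y + \sum_(j <- r) F j y).
  exact: cplx_deriveD.
by apply/funext => y; rewrite big_cons.
Qed.

Lemma dot_delta_slice s k (L : V) : dot (slice s (delta_mx 0 k)) L = s k * L 0 k.
Proof.
rewrite /dot (bigD1 k) //= mxE mxE !eqxx mulr1 big1 ?addr0 // => j jk.
by rewrite !mxE eqxx (negbTE jk) mulr0 mul0r.
Qed.

(** The derivative along the k-th axis of the slice is [s k] times the k-th complex partial, and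
    [s k] is not 0. Vanishing on the slice near [x] therefore passes from a function to its
    partials, and by induction to all iterated ones. *)
Lemma slice_vanish_pderivs s f p x : (forall j, cmod (s j) = 1) ->
  (\forall y \near p + slice s x, analytic_germ f y) ->
  (\forall y \near x, f (p + slice s y) = 0) -> forall ks, pderivs ks f (p + slice s x) = 0.
Proof.
move=> s1 /(slice_near s1) hA h ks.
suff /nbhs_singleton : \forall y \near x, pderivs ks f (p + slice s y) = 0 by [].
elim: ks => [//|k ks IH]; have IH' := nbhs_interior IH.
apply: filterS2 IH' hA => y /= hy Ay.
have c1 := analytic_germ_cplx_derive (delta_mx 0 k) s1 (analytic_germ_pderivs ks Ay).
have c2 : cplx_derive (fun z => pderivs ks f (p + slice s z)) y (delta_mx 0 k) 0.
  by apply: (cplx_derive_near _ (cplx_derive_cst 0 _ _)); apply: filterS hy => z /= ->.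
have := cplx_derive_uniq c1 c2; rewrite dot_delta_slice => /eqP.
rewrite mulf_eq0 => /orP[/eqP sk|/eqP //].
by have := s1 k; rewrite sk cmod0 => /esym /eqP; rewrite oner_eq0.
Qed.

(** The derivative along the slice in direction v is the restriction of the analytic function \sum_j
    s_j v_j d_j f, again of the kind considered; hence the induction on the order with [f]
    general. *)
Lemma analytic_germ_smooth s f p (W : set RV) : (forall j, cmod (s j) = 1) -> open W ->
  (forall x, W x -> analytic_germ f (p + slice s x)) ->
  forall k, smooth_order k W (fun x => complex.Re (f (p + slice s x))) /\
            smooth_order k W (fun x => complex.Im (f (p + slice s x))).
Proof.
move=> s1 oW hA k; elim: k f hA => [|k IH] f hA.
  by split; split=> // x Wx; have [] := analytic_germ_diff s1 (hA x Wx).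
have hv v : let g y := \sum_j slice s v 0 j * pderiv j f y in
    smooth_order k W (fun x => complex.Re (g (p + slice s x))) /\ smooth_order k W (fun x => complex.Im (g (p + slice s x))).
  apply: IH => x Wx; apply: analytic_germ_sum => j; apply: analytic_germ_mul; first exact: analytic_germ_cst.
  exact/analytic_germ_pderiv/hA.
split; split=> [x Wx|v]; try by have [] := analytic_germ_diff s1 (hA x Wx).
  by apply: (smooth_order_ext oW _ (hv v).1) => x Wx; have [[_ ->] _] := analytic_germ_cplx_derive v s1 (hA x Wx).
by apply: (smooth_order_ext oW _ (hv v).2) => x Wx; have [_ [_ ->]] := analytic_germ_cplx_derive v s1 (hA x Wx).
Qed.

(** Complex linear in [v] by construction; it equals ['D_v w q] for analytic fields. *)
Definition vec_derive (v : V) (w : V -> V) q : V := \row_j dot v (grad (fun y => w y 0 j) q).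

Lemma analytic_germ_is_derive (w : V -> V) q (v : V) : (forall j, analytic_germ (fun y => w y 0 j) q) ->
  'D_v w q = vec_derive v w q.
Proof.
move=> hA; apply/cvg_lim => //.
have /choice [Kd hKd] : forall j, exists Kd : R * R, 0 < Kd.2 /\ forall h, polydisc Kd.2 h ->
    cmod (w (q + h) 0 j - w q 0 j - dot h (grad (fun y => w y 0 j) q)) <= Kd.1 * l1 h ^+ 2.
  by move=> j; have [K [d h]] := analytic_germ_strong_diff (hA j); exists (K, d).
have lv0 := l1_ge0 v.
apply/cvg_ballP => _ /ltcP[e e0 ->].
have : \forall h \near (0 : C)^', forall j, cmod ((w (q + h *: v) 0 j - w q 0 j) / h
     - dot v (grad (fun y => w y 0 j) q)) < e.
  apply: filter_forall => j; have [d0 hd] := hKd j.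
  pose c := (`|(Kd j).1| + 1) * (l1 v + 1) ^+ 2.
  have c0 : 0 < c by rewrite mulr_gt0 ?exprn_gt0 // ltr_pwDr.
  (* The first bound puts [h *: v] in the polydisc of the estimate; the second makes the remainder,
     at most c |h|^2, smaller than e |h|. *)
  pose m := Num.min ((Kd j).2 / (l1 v + 1)) (e / (2 * c)).
  have m0 : 0 < m by rewrite lt_min !divr_gt0 ?mulr_gt0 // ltr_pwDr.
  exists m%:C%C => /=; first by rewrite ltcR.
  move=> h /=; rewrite sub0r normrN normE ltcR lt_min => /andP[h1 h2] hN0.
  have nh : 0 < cmod h by rewrite lt_def cmod_ge0 andbT; apply: contra hN0 => /eqP/cmod_eq0 ->.
  have b : polydisc (Kd j).2 (h *: v).
    move=> i; rewrite mxE cmodM; apply: le_trans (ler_wpM2l (cmod_ge0 _) (cmod_l1 v i)) _.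
    move: h1; rewrite ltr_pdivlMr ?ltr_pwDr // => /ltW; apply: le_trans.
    by rewrite ler_wpM2l ?cmod_ge0 // lerDl.
  have lh : l1 (h *: v) = cmod h * l1 v.
    by rewrite /l1 mulr_sumr; apply: eq_bigr => i _; rewrite mxE cmodM.
  have := hd _ b; rewrite dotZ lh => H.
  rewrite -(ltr_pM2l nh) -cmodM mulrBr mulrCA divff // mulr1 (le_lt_trans H) //.
  have -> : (Kd j).1 * (cmod h * l1 v) ^+ 2 = cmod h * (cmod h * ((Kd j).1 * l1 v ^+ 2)) by ring.
  rewrite ltr_pM2l //; apply: le_lt_trans (_ : cmod h * c < _).
    rewrite ler_wpM2l ?cmod_ge0 // /c; apply: le_trans (_ : `|(Kd j).1| * l1 v ^+ 2 <= _).
      by rewrite ler_wpM2r ?exprn_ge0 // ler_norm.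
    by apply: ler_pM; rewrite ?exprn_ge0 ?lerDl //; apply: lerXn2r; rewrite ?nnegrE ?addr_ge0 ?lerDl.
  have c2 : 0 < 2 * c by exact: mulr_gt0.
  move: h2; rewrite ltr_pdivlMr // => h2; apply: le_lt_trans h2.
  by rewrite ler_wpM2l ?cmod_ge0 // ler_peMl ?(ltW c0) // ler1n.
apply: (@filterS _ _ (dnbhs_filter _)) => h hh /=; split; first by rewrite ltcR.
move=> i j; rewrite (ord1 i) !mxE /ball /= normE ltcR cmodBC.
by have := hh j; rewrite [h *: v + q]addrC mulrC.
Qed.

End Slices.

(** * Alpha-planes and unit vectors *)

Lemma ord4P (P : 'I_4 -> Prop) : P 0 -> P 1 -> P 2 -> P 3 -> forall i, P i.
Proof.
move=> p0 p1 p2 p3 [[|[|[|[|m]]]] lt] //.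
- by rewrite (_ : Ordinal lt = 0) //; exact/val_inj.
- by rewrite (_ : Ordinal lt = 1) //; exact/val_inj.
- by rewrite (_ : Ordinal lt = 2) //; exact/val_inj.
- by rewrite (_ : Ordinal lt = 3) //; exact/val_inj.
Qed.

Lemma sum4 (T : nmodType) (F : 'I_4 -> T) : \sum_i F i = F 0 + F 1 + F 2 + F 3.
Proof.
rewrite !big_ord_recl big_ord0 addr0 !addrA.
by congr (F _ + F _ + F _ + F _); exact/val_inj.
Qed.

Section Det4.
Variable K : comRingType.
Implicit Types F : nat -> nat -> K.

(** Entries indexed by natural numbers let the indices of the cofactor expansion reduce by
    computation. *)
Definition detn n F : K := \det (\matrix_(i < n, j < n) F i j).

Lemma detnS n F : detn n.+1 F =
  \sum_(j < n.+1) F 0%N j * ((-1) ^+ j * detn n (fun i k => F i.+1 (bump j k))).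
Proof.
rewrite /detn (expand_det_row _ ord0); apply: eq_bigr => j _; rewrite mxE /cofactor add0n.
by congr (_ * (_ * \det _)); apply/matrixP => i k; rewrite !mxE.
Qed.

Lemma detn1 F : detn 1%N F = F 0%N 0%N.
Proof. by rewrite /detn det_mx11 mxE. Qed.

Lemma detn2 F : detn 2%N F = F 0%N 0%N * F 1%N 1%N - F 0%N 1%N * F 1%N 0%N.
Proof. by rewrite detnS !big_ord_recl big_ord0 !detn1 /= /bump /=; ring. Qed.

Lemma detn3 F : detn 3%N F =
  F 0%N 0%N * (F 1%N 1%N * F 2%N 2%N - F 1%N 2%N * F 2%N 1%N) - F 0%N 1%N * (F 1%N 0%N * F 2%N 2%N - F 1%N 2%N * F 2%N 0%N)
    + F 0%N 2%N * (F 1%N 0%N * F 2%N 1%N - F 1%N 1%N * F 2%N 0%N).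
Proof. by rewrite detnS !big_ord_recl big_ord0 !detn2 /= /bump /=; ring. Qed.

Lemma detn4 F : detn 4%N F =
    F 0 0 * (F 1 1 * (F 2 2 * F 3 3 - F 2 3 * F 3 2) - F 1 2 * (F 2 1 * F 3 3 - F 2 3 * F 3 1)
      + F 1 3 * (F 2 1 * F 3 2 - F 2 2 * F 3 1))
  - F 0 1 * (F 1 0 * (F 2 2 * F 3 3 - F 2 3 * F 3 2) - F 1 2 * (F 2 0 * F 3 3 - F 2 3 * F 3 0)
      + F 1 3 * (F 2 0 * F 3 2 - F 2 2 * F 3 0))
  + F 0 2 * (F 1 0 * (F 2 1 * F 3 3 - F 2 3 * F 3 1) - F 1 1 * (F 2 0 * F 3 3 - F 2 3 * F 3 0)
      + F 1 3 * (F 2 0 * F 3 1 - F 2 1 * F 3 0))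
  - F 0 3 * (F 1 0 * (F 2 1 * F 3 2 - F 2 2 * F 3 1) - F 1 1 * (F 2 0 * F 3 2 - F 2 2 * F 3 0)
      + F 1 2 * (F 2 0 * F 3 1 - F 2 1 * F 3 0)).
Proof. by rewrite detnS !big_ord_recl big_ord0 !detn3 /= /bump /=; ring. Qed.
End Det4.

Lemma scaleNii (L : numClosedFieldType) n (v : 'rV[L]_n) : - 'i *: ('i *: v) = v.
Proof. by rewrite scalerA mulNr -expr2 sqrCi opprK scale1r. Qed.
Lemma scaleiNi (L : numClosedFieldType) n (v : 'rV[L]_n) : 'i *: (- 'i *: v) = v.
Proof. by rewrite scalerA mulrN -expr2 sqrCi opprK scale1r. Qed.
Lemma scaleNiD (L : numClosedFieldType) n (x y : 'rV[L]_n) : - 'i *: (x + 'i *: y) = y + 'i *: - x.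
Proof. by rewrite scalerDr scaleNii addrC scaleNr scalerN. Qed.

Section AlphaAlgebra.
Variable R : realType.
Local Notation C := (Cplx R).
Local Notation V := 'rV[Cplx R]_4.
Local Notation RV := 'rV[R]_4.
Implicit Types (u X Y : RV) (v w : V).

(* [Jmat u] acts on row vectors: it sends e_0 to [u], and [X] orthogonal to e_0
   and [u] to the cross product of [u] and [X]. *)
Definition Jmat u : 'M[R]_4 := \matrix_(i, j)
  nth 0 (nth [::] [:: [:: 0; u 0 1; u 0 2; u 0 3];
                      [:: - u 0 1; 0; u 0 3; - u 0 2];
                      [:: - u 0 2; - u 0 3; 0; u 0 1];
                      [:: - u 0 3; u 0 2; - u 0 1; 0]] i) j.

Definition unit3 u := u 0 0 = 0 /\ u 0 1 ^+ 2 + u 0 2 ^+ 2 + u 0 3 ^+ 2 = 1.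

Lemma mulJ (u X : RV) : [/\ (X *m Jmat u) 0 0 = - (u 0 1 * X 0 1 + u 0 2 * X 0 2 + u 0 3 * X 0 3),
  (X *m Jmat u) 0 1 = X 0 0 * u 0 1 + (u 0 2 * X 0 3 - u 0 3 * X 0 2),
  (X *m Jmat u) 0 2 = X 0 0 * u 0 2 + (u 0 3 * X 0 1 - u 0 1 * X 0 3) &
  (X *m Jmat u) 0 3 = X 0 0 * u 0 3 + (u 0 1 * X 0 2 - u 0 2 * X 0 1)].
Proof. by split; rewrite mxE sum4 !mxE /=; ring. Qed.

Lemma Jmat_tr u : (Jmat u)^T = - Jmat u.
Proof.
by apply/matrixP => i j; rewrite !mxE; elim/ord4P: i; elim/ord4P: j; rewrite /= ?opprK ?oppr0.
Qed.

Lemma Jmat_sq u : unit3 u -> Jmat u *m Jmat u = - 1%:M.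
Proof.
move=> [_ u1]; apply/matrixP => i j; rewrite !mxE sum4 !mxE.
elim/ord4P: i; elim/ord4P: j => /=; rewrite ?mulr1n ?mulr0n; try ring; rewrite -u1; ring.
Qed.

Definition Jmatc u : 'M[C]_4 := map_mx (real_complex R) (Jmat u).

Definition in_plane u v := v *m Jmatc u = - 'i *: v.

Lemma Re_Ci (a b : R) : complex.Re (a%:C%C + 'i * b%:C%C : C) = a.
Proof. by rewrite -complexiE /=; ring. Qed.
Lemma Im_Ci (a b : R) : complex.Im (a%:C%C + 'i * b%:C%C : C) = b.
Proof. by rewrite -complexiE /=; ring. Qed.

Lemma eucl_mul X (M : 'M[R]_4) : eucl X *m map_mx (real_complex R) M = eucl (X *m M).
Proof.
apply/rowP => j; rewrite !mxE rmorph_sum; apply: eq_bigr => k _.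
by rewrite !mxE rmorphM.
Qed.

Lemma euclN X : eucl (- X) = - eucl X.
Proof. by apply/rowP => j; rewrite !mxE rmorphN. Qed.

Lemma eucl_in_plane u X : unit3 u -> in_plane u (eucl X + 'i *: eucl (X *m Jmat u)).
Proof.
move=> hu; rewrite /in_plane mulmxDl -scalemxAl !eucl_mul -mulmxA Jmat_sq // mulmxN mulmx1.
by rewrite euclN scaleNiD.
Qed.

Definition rpart v : RV := \row_j complex.Re (v 0 j).
Definition ipart v : RV := \row_j complex.Im (v 0 j).

Lemma rpart_i X Y : rpart (eucl X + 'i *: eucl Y) = X.
Proof. by apply/rowP => j; rewrite 5!mxE Re_Ci. Qed.
Lemma ipart_i X Y : ipart (eucl X + 'i *: eucl Y) = Y.
Proof. by apply/rowP => j; rewrite 5!mxE Im_Ci. Qed.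

Lemma reimE v : v = eucl (rpart v) + 'i *: eucl (ipart v).
Proof. by apply/rowP => j; rewrite 6!mxE; apply: Cplx_eq; rewrite ?Re_Ci ?Im_Ci. Qed.

Lemma reim_inj X Y X' Y' : eucl X + 'i *: eucl Y = eucl X' + 'i *: eucl Y' -> X = X' /\ Y = Y'.
Proof.
by move=> h; split; [rewrite -(rpart_i X Y) h rpart_i|rewrite -(ipart_i X Y) h ipart_i].
Qed.

Lemma in_plane_reim u v : unit3 u -> in_plane u v <-> ipart v = rpart v *m Jmat u.
Proof.
move=> hu; split=> [|h]; last by rewrite (reimE v) h; exact: eucl_in_plane.
rewrite /in_plane {1 2}(reimE v) mulmxDl -scalemxAl !eucl_mul scaleNiD -euclN.
by case/reim_inj.
Qed.

Lemma dotC4 v w : dot v w = dot w v.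
Proof. by apply: eq_bigr => k _; rewrite mulrC. Qed.

Lemma dotE v w : dot v w = (v *m w^T) 0 0.
Proof. by rewrite mxE; apply: eq_bigr => k _; rewrite mxE. Qed.

Lemma dotJ u v w : dot (v *m Jmatc u) w = - dot v (w *m Jmatc u).
Proof.
rewrite !dotE trmx_mul /Jmatc map_trmx Jmat_tr map_mxN mulNmx mulmxN mulmxA.
by rewrite [in RHS]mxE opprK.
Qed.

Lemma isotropic_eq (L : numClosedFieldType) (a : L) : - 'i * a = - (- 'i * a) -> a = 0.
Proof.
move/eqP; rewrite -addr_eq0 -mulr2n mulrn_eq0 /= mulf_eq0 oppr_eq0 (negbTE (neq0Ci _)) /=.
by move/eqP.
Qed.

(** J is skew for the bilinear form, so moving it from [v] to [w] gives -i d = i d for the product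
    d. *)
Lemma in_plane_isotropic u v w : in_plane u v -> in_plane u w -> dot v w = 0.
Proof.
move=> hv hw; have := dotJ u v w; rewrite hv hw dotZ (dotC4 v (_ *: _)) dotZ (dotC4 w).
exact: isotropic_eq.
Qed.

(** Testing against X + i JX with X real, and moving J onto [v] by skew-symmetry, shows that v - i
    Jv is orthogonal to every real X. *)
Lemma in_plane_perp u v : unit3 u -> (forall w, in_plane u w -> dot v w = 0) -> in_plane u v.
Proof.
move=> hu h.
have key k : dot (v + - 'i *: (v *m Jmatc u)) (eucl (delta_mx 0 k)) = 0.
  have E := h _ (eucl_in_plane (delta_mx 0 k) hu); rewrite dotC4 dotD dotZ in E.
  by rewrite dotD dotZ dotJ eucl_mul mulrNN (dotC4 v (eucl (delta_mx 0 k))) (dotC4 v).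
have {key} e : v = 'i *: (v *m Jmatc u).
  apply/rowP => k; have dd j : eucl (delta_mx 0 k : RV) 0 j = (j == k)%:R.
    by rewrite 2!mxE eqxx /=; case: eqP.
  have := key k; rewrite /dot (bigD1 k) //= big1 ?addr0; last first.
    by move=> j jk; rewrite dd (negbTE jk) mulr0.
  rewrite dd eqxx mulr1 scaleNr; move: ('i *: _) => y.
  by rewrite !mxE => /eqP; rewrite subr_eq0 => /eqP.
by rewrite /in_plane {2}e scaleNii.
Qed.
End AlphaAlgebra.

Lemma span2P (L : fieldType) (vT : vectType L) (a b v : vT) :
  v \in <<[:: a; b]>>%VS <-> exists x y, v = x *: a + y *: b.
Proof.
rewrite span_cons span_seq1; split=> [/memv_addP[_ /vlineP[x ->] [_ /vlineP[y ->] ->]]|[x [y ->]]].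
  by exists x, y.
by apply: memv_add; apply/vlineP; [exists x|exists y].
Qed.

Lemma comb_i (L : numClosedFieldType) n (x y : 'rV[L]_n) (a b c d : L) :
  a *: x + b *: (- 'i *: x) + c *: y + d *: (- 'i *: y) = (a - b * 'i) *: x + (c - d * 'i) *: y.
Proof. by rewrite !scalerA !mulrN -addrA -!scalerDl. Qed.

Lemma scale_comb (L : numClosedFieldType) n (x : 'rV[L]_n) (a b : L) :
  (a * 'i + b) *: x = a *: ('i *: x) + b *: x.
Proof. by rewrite scalerDl scalerA. Qed.

Section AlphaPlane.
Variable R : realType.
Local Notation C := (Cplx R).
Local Notation V := 'rV[Cplx R]_4.
Local Notation RV := 'rV[R]_4.
Implicit Types (u X Y D : RV) (v w : V).

Lemma in_planeD u v w : in_plane u v -> in_plane u w -> in_plane u (v + w).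
Proof. by move=> hv hw; rewrite /in_plane mulmxDl hv hw scalerDr. Qed.
Lemma in_planeZ u (c : C) v : in_plane u v -> in_plane u (c *: v).
Proof. by move=> hv; rewrite /in_plane -scalemxAl hv !scalerA mulrC. Qed.

(** The six numbers are the entries above the diagonal of a skew orthogonal matrix: its rows are
    unit vectors and its Pfaffian is 1. The row equations add up to twice the sum of the six
    squares, which is thus 2, and (c - x)^2 + (b + y)^2 + (a - z)^2 = 2 - 2 Pf = 0. *)
Lemma self_dual (x y z a b c : R) :
  x ^+ 2 + y ^+ 2 + z ^+ 2 = 1 -> x ^+ 2 + a ^+ 2 + b ^+ 2 = 1 ->
  y ^+ 2 + a ^+ 2 + c ^+ 2 = 1 -> z ^+ 2 + b ^+ 2 + c ^+ 2 = 1 ->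
  x * c - y * b + z * a = 1 -> [/\ c = x, b = - y & a = z].
Proof.
move=> h1 h2 h3 h4 h5.
have h : (c - x) ^+ 2 + ((b + y) ^+ 2 + (a - z) ^+ 2) = 0 by nra.
have := h; move/eqP; rewrite !paddr_eq0 ?addr_ge0 ?sqr_ge0 // !sqrf_eq0 subr_eq0 addr_eq0 subr_eq0.
by case/and3P => /eqP -> /eqP -> /eqP ->.
Qed.

Definition J0 : 'M[R]_4 := \matrix_(i, j)
  nth 0 (nth [::] [:: [:: 0; 1; 0; 0]; [:: -1; 0; 0; 0];
                      [:: 0; 0; 0; 1]; [:: 0; 0; -1; 0]] i) j.

Lemma J0_orth : J0 *m J0^T = 1%:M.
Proof.
apply/matrixP => i j; rewrite !mxE sum4 !mxE.
by elim/ord4P: i; elim/ord4P: j => /=; ring.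
Qed.

(** E^T J0 E is the complex structure with e_0 -> e_1 and e_2 -> e_3 for the rows of [E]. It is skew
    and orthogonal, and its Pfaffian is det E, a polynomial identity checked by expansion. This is
    where the orientation selects the self-dual structures. *)
Lemma so4_J (E : 'M[R]_4) : E *m E^T = 1%:M -> \det E = 1 ->
  exists2 u, unit3 u & Jmat u = E^T *m J0 *m E.
Proof.
move=> orth dE; set J := E^T *m J0 *m E.
have JJ : J *m J^T = 1%:M.
  rewrite /J !trmx_mul trmxK !mulmxA -(mulmxA _ E) orth mulmx1 -(mulmxA E^T) J0_orth mulmx1.
  exact: mulmx1C.
have JE a b : J a b = E 0 a * E 1 b - E 1 a * E 0 b + E 2 a * E 3 b - E 3 a * E 2 b.
  by rewrite /J mxE sum4 !mxE !sum4 !mxE /=; ring.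
have pf : J 0 1 * J 2 3 - J 0 2 * J 1 3 + J 0 3 * J 1 2 = 1.
  rewrite -dE !JE; clear.
  pose F i j := E (inord i) (inord j).
  have EF i j : E i j = F i j by rewrite /F !inord_val.
  have -> : \det E = detn 4 F by congr (\det _); apply/matrixP => i j; rewrite mxE EF.
  by rewrite detn4 !EF /=; ring.
have skew a b : J a b = - J b a by rewrite !JE; ring.
have diag a : J a a = 0 by rewrite JE; ring.
clearbody J.
have row1 a : J a 0 ^+ 2 + J a 1 ^+ 2 + J a 2 ^+ 2 + J a 3 ^+ 2 = 1.
  have <- : (J *m J^T) a a = 1 by rewrite JJ mxE eqxx.
  by rewrite mxE sum4 !mxE !expr2.
have r0 := row1 0; have r1 := row1 1; have r2 := row1 2; have r3 := row1 3.
rewrite diag in r0; rewrite diag (skew 1 0) in r1.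
rewrite diag (skew 2 0) (skew 2 1) in r2; rewrite diag (skew 3 0) (skew 3 1) (skew 3 2) in r3.
have [] := @self_dual (J 0 1) (J 0 2) (J 0 3) (J 1 2) (J 1 3) (J 2 3) => //.
- by rewrite -r0; ring.
- by rewrite -r1; ring.
- by rewrite -r2; ring.
- by rewrite -r3; ring.
move=> e1 e2 e3; exists (\row_k J 0 k).
  by split; rewrite !mxE ?diag //; rewrite -r0; ring.
apply/matrixP => i j; rewrite !mxE.
elim/ord4P: i; elim/ord4P: j => /=; rewrite ?diag //.
all: by rewrite ?e1 ?e2 ?e3 // [RHS]skew ?e1 ?e2 ?e3 ?opprK.
Qed.

(** The real isomorphism X -> X + i JX of R^4 onto the plane, which carries J to multiplication by
    -i. *)
Definition jgraph u X : V := eucl X + 'i *: eucl (X *m Jmat u).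

Lemma euclD X Y : eucl (X + Y) = eucl X + eucl Y.
Proof. by apply/rowP => j; rewrite !mxE rmorphD. Qed.
Lemma euclZ (a : R) X : eucl (a *: X) = a%:C%C *: eucl X.
Proof. by apply/rowP => j; rewrite !mxE rmorphM. Qed.
Lemma jgraphD u X Y : jgraph u (X + Y) = jgraph u X + jgraph u Y.
Proof. by rewrite /jgraph mulmxDl !euclD scalerDr addrACA. Qed.
Lemma jgraphZ u (a : R) X : jgraph u (a *: X) = a%:C%C *: jgraph u X.
Proof. by rewrite /jgraph -scalemxAl !euclZ scalerDr !scalerA mulrC. Qed.
Lemma jgraph_J u X : unit3 u -> jgraph u (X *m Jmat u) = - 'i *: jgraph u X.
Proof.
move=> hu; rewrite {1}/jgraph -mulmxA Jmat_sq // mulmxN mulmx1 euclN; symmetry.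
exact: scaleNiD.
Qed.

Lemma in_plane_jgraph u v : unit3 u -> in_plane u v -> v = jgraph u (rpart v).
Proof. by move=> hu /(in_plane_reim _ hu) h; rewrite /jgraph -h -reimE. Qed.

Lemma alpha_plane_in_plane (P : {vspace V}) : is_alpha_plane P ->
  exists2 u, unit3 u & forall v, v \in P <-> in_plane u v.
Proof.
move=> [E [orth dE ->]]; have [u hu uJ] := so4_J orth dE; exists u => //.
have rJ r : row r E *m Jmat u = row r (J0 *m E).
  by rewrite -row_mul uJ !mulmxA orth mul1mx.
have r0 : row 0 E *m Jmat u = row 1 E.
  by apply: etrans (rJ 0) _; apply/rowP => j; rewrite !mxE sum4 !mxE /=; ring.
have r2 : row 2 E *m Jmat u = row 3 E.
  by apply: etrans (rJ 2) _; apply/rowP => j; rewrite !mxE sum4 !mxE /=; ring.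
pose v1 := eucl (row 0 E) + 'i *: eucl (row 1 E).
pose v2 := eucl (row 2 E) + 'i *: eucl (row 3 E).
have g X Y : X *m Jmat u = Y -> jgraph u X = eucl X + 'i *: eucl Y by move=> <-.
have g' X Y : X *m Jmat u = Y -> jgraph u Y = - 'i *: jgraph u X.
  by move=> <-; exact: jgraph_J.
have g0 : jgraph u (row 0 E) = v1 := g _ _ r0.
have g2 : jgraph u (row 2 E) = v2 := g _ _ r2.
have g1 : jgraph u (row 1 E) = - 'i *: v1 := etrans (g' _ _ r0) (congr1 _ g0).
have g3 : jgraph u (row 3 E) = - 'i *: v2 := etrans (g' _ _ r2) (congr1 _ g2).
have i1 : in_plane u v1 by rewrite -g0; exact: eucl_in_plane.
have i2 : in_plane u v2 by rewrite -g2; exact: eucl_in_plane.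
move=> v; split.
  case/span2P => a [b ->].
  exact: in_planeD (in_planeZ a i1) (in_planeZ b i2).
move=> /(in_plane_jgraph hu) ->; rewrite -/v1 -/v2.
(* The real part is expanded in the rows of [E], whose images under [jgraph u] are v1, -i v1, v2 and
   -i v2. *)
have -> : rpart v = rpart v *m E^T *m E by rewrite -mulmxA (mulmx1C orth) mulmx1.
rewrite mulmx_sum_row sum4 !jgraphD !jgraphZ g0 g1 g2 g3; apply/span2P.
by eexists; eexists; exact: comb_i.
Qed.

Definition nsq X : R := X 0 0 ^+ 2 + X 0 1 ^+ 2 + X 0 2 ^+ 2 + X 0 3 ^+ 2.

Lemma nsq_gt0 X : X != 0 -> 0 < nsq X.
Proof.
move=> X0; rewrite lt_def !addr_ge0 ?sqr_ge0 // andbT; apply: contra X0.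
rewrite /nsq !paddr_eq0 ?addr_ge0 ?sqr_ge0 // !sqrf_eq0.
move=> /andP[/andP[/andP[/eqP h0 /eqP h1] /eqP h2] /eqP h3].
by apply/eqP/rowP; elim/ord4P; rewrite mxE.
Qed.

(* [u] is the quaternion quotient [X^-1 Y] of the real and imaginary parts of a vector of the plane. *)
Definition uquot X Y : RV := \row_j nth 0 [:: 0;
    X 0 0 * Y 0 1 - Y 0 0 * X 0 1 + (X 0 2 * Y 0 3 - X 0 3 * Y 0 2);
    X 0 0 * Y 0 2 - Y 0 0 * X 0 2 + (X 0 3 * Y 0 1 - X 0 1 * Y 0 3);
    X 0 0 * Y 0 3 - Y 0 0 * X 0 3 + (X 0 1 * Y 0 2 - X 0 2 * Y 0 1)] j.

Lemma uquotE u v : unit3 u -> in_plane u v -> uquot (rpart v) (ipart v) = nsq (rpart v) *: u.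
Proof.
move=> hu /(in_plane_reim _ hu) ->; move: (rpart v) => X.
have [m0 m1 m2 m3] := mulJ u X.
by apply/rowP; elim/ord4P; rewrite [LHS]mxE [RHS]mxE /= ?m0 ?m1 ?m2 ?m3 /nsq ?hu.1; ring.
Qed.

Lemma in_plane_rpart_neq0 u v : unit3 u -> in_plane u v -> v != 0 -> rpart v != 0.
Proof.
move=> hu h; apply: contra => /eqP e; rewrite (in_plane_jgraph hu h) e /jgraph mul0mx.
have -> : eucl (0 : RV) = 0 by apply/rowP => j; rewrite !mxE.
by rewrite scaler0 addr0.
Qed.

Lemma ddt_J u : u 0 0 = 0 -> ddt R *m Jmat u = u.
Proof.
move=> u0; have [m0 m1 m2 m3] := mulJ u (ddt R).
by apply/rowP; elim/ord4P; rewrite ?m0 ?m1 ?m2 ?m3 !mxE /= ?u0; ring.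
Qed.

Lemma mink_eucl X : X 0 0 = 0 -> mink X = eucl X.
Proof. by move=> X0; apply/rowP => j; rewrite !mxE; case: eqP => // ->; rewrite X0 mulr0. Qed.

Lemma minkD X Y : mink (X + Y) = mink X + mink Y.
Proof. by apply/rowP => j; rewrite !mxE; case: eqP; rewrite rmorphD ?mulrDr. Qed.

Lemma minkZ (a : R) X : mink (a *: X) = a%:C%C *: mink X.
Proof. by apply/rowP => j; rewrite !mxE; case: eqP; rewrite rmorphM // mulrCA. Qed.

Lemma mink_ddt : mink (ddt R) = - 'i *: eucl (ddt R).
Proof.
apply/rowP; elim/ord4P; rewrite [LHS]mxE [RHS]mxE [in RHS]mxE !mxE /= ?mulr0 //.
Qed.

(** Under [mink] the vector d/dt becomes -i e_0, and u = J e_0: the vector is -i times e_0 + i J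
    e_0. *)
Lemma mink_w_in_plane u : unit3 u -> in_plane u (mink (ddt R + u)).
Proof.
move=> hu; have u0 := hu.1; have -> : mink (ddt R + u) = - 'i *: jgraph u (ddt R).
  by rewrite minkD mink_ddt (mink_eucl u0) /jgraph ddt_J // scalerDr scaleNii.
exact/in_planeZ/eucl_in_plane.
Qed.

Lemma screen_J u X : X 0 0 = 0 -> mink_dot X u = 0 -> u 0 0 = 0 -> X *m Jmat u = Jperp u X.
Proof.
move=> X0; rewrite /mink_dot X0 mul0r oppr0 add0r => Xu u0.
have [m0 m1 m2 m3] := mulJ u X.
apply/rowP; elim/ord4P; rewrite ?m0 ?m1 ?m2 ?m3 mxE /= ?X0.
  by rewrite -[RHS]oppr0 -Xu; ring.
all: by ring.
Qed.

Lemma Jperp0 u X : Jperp u X 0 0 = 0. Proof. by rewrite mxE. Qed.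

Lemma screen_in_plane u X : unit3 u -> screen u X -> in_plane u (mink X + 'i *: mink (Jperp u X)).
Proof.
move=> hu [X0 Xu]; rewrite (mink_eucl X0) (mink_eucl (Jperp0 u X)) -(screen_J X0 Xu hu.1).
exact: eucl_in_plane.
Qed.

Lemma in_plane_screen u D X : unit3 u -> D 0 0 = 0 -> X 0 0 = 0 ->
  in_plane u (mink D + 'i *: mink X) <-> mink_dot D u = 0 /\ X = Jperp u D.
Proof.
move=> hu d0 x0; rewrite (mink_eucl d0) (mink_eucl x0) in_plane_reim // rpart_i ipart_i.
split=> [e|[h ->]]; last by rewrite screen_J // hu.1.
have h : mink_dot D u = 0.
  have [m0 _ _ _] := mulJ u D; rewrite -e x0 in m0.
  move/esym/eqP: m0; rewrite oppr_eq0 => /eqP m0.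
  by rewrite /mink_dot d0 -[RHS]m0; ring.
by split=> //; rewrite -screen_J // hu.1.
Qed.

(** Subtracting the multiple of d/dt + u with the same t-component leaves a vector of the plane with
    zero imaginary part. Then J kills its real part, so it is 0. *)
Lemma in_plane_mink_line u X : unit3 u -> in_plane u (mink X) <-> exists s : R, X = s *: (ddt R + u).
Proof.
move=> hu; split=> [h|[s ->]]; last by rewrite minkZ; exact/in_planeZ/mink_w_in_plane.
exists (X 0 0); pose X' := X - X 0 0 *: (ddt R + u).
have X'0 : X' 0 0 = 0 by rewrite !mxE /= hu.1; ring.
suff : X' = 0 by move/eqP; rewrite subr_eq0 => /eqP.
have h' : in_plane u (mink X' + 'i *: mink 0).
  have -> : mink (0 : RV) = 0 by apply/rowP => j; rewrite !mxE; case: eqP; rewrite ?mulr0.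
  rewrite scaler0 addr0 /X' -scaleNr minkD; apply: in_planeD => //; rewrite minkZ.
  exact/in_planeZ/mink_w_in_plane.
have z0 : (0 : RV) 0 0 = 0 by rewrite mxE.
have [hd hJ] := (in_plane_screen hu X'0 z0).1 h'.
have hX : X' *m Jmat u = 0 by rewrite (screen_J X'0 hd hu.1) -hJ.
have := congr1 (mulmx X') (Jmat_sq hu); rewrite mulmxA hX mul0mx mulmxN mulmx1.
by move/eqP; rewrite eq_sym oppr_eq0 => /eqP.
Qed.

Lemma jgraph_ddt u : unit3 u -> jgraph u (ddt R) = 'i *: mink (ddt R + u).
Proof.
move=> hu; rewrite minkD mink_ddt (mink_eucl hu.1) scalerDr scaleiNi /jgraph.
by rewrite ddt_J // hu.1.
Qed.

Lemma jgraph_u u : unit3 u -> jgraph u u = mink (ddt R + u).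
Proof.
move=> hu; have := jgraph_J (ddt R) hu; rewrite ddt_J ?hu.1 // jgraph_ddt // => ->.
exact: scaleNii.
Qed.

(** The real part is decomposed along e_0, u and the screen. As u = J e_0, the first two both
    contribute multiples of d/dt + u, with coefficients i and 1. *)
Lemma in_plane_split u v : unit3 u -> in_plane u v -> exists (a : C) X,
  screen u X /\ v = a *: mink (ddt R + u) + (mink X + 'i *: mink (Jperp u X)).
Proof.
move=> hu /(in_plane_jgraph hu); move: (rpart v) => X ->; have [u0 u1] := hu.
pose s := mink_dot X u; pose X' := X - X 0 0 *: ddt R - s *: u.
have X'0 : X' 0 0 = 0 by rewrite !mxE /= u0; ring.
have Xu : mink_dot X' u = 0.
  rewrite /mink_dot u0 mulr0 oppr0 add0r !mxE /= /s /mink_dot u0.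
  move: u1; move: (u 0 1) (u 0 2) (u 0 3) (X 0 1) (X 0 2) (X 0 3) => a b c x y z h.
  have -> : (x - X 0 0 * 0 - (- (X 0 0 * 0) + x * a + y * b + z * c) * a) * a +
   (y - X 0 0 * 0 - (- (X 0 0 * 0) + x * a + y * b + z * c) * b) * b +
   (z - X 0 0 * 0 - (- (X 0 0 * 0) + x * a + y * b + z * c) * c) * c
   = (x * a + y * b + z * c) * (1 - (a ^+ 2 + b ^+ 2 + c ^+ 2)) by ring.
  by rewrite h subrr mulr0.
have XE : X = (X 0 0 *: ddt R + s *: u) + X' by rewrite addrC /X' -[X - _ - _]addrA -opprD subrK.
exists ((X 0 0)%:C%C * 'i + s%:C%C), X'; split=> //.
have e1 : jgraph u X = jgraph u (X 0 0 *: ddt R + s *: u) + jgraph u X'.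
  exact: etrans (congr1 (jgraph u) XE) (jgraphD _ _ _).
have e2 : jgraph u (X 0 0 *: ddt R) = (X 0 0)%:C%C *: ('i *: mink (ddt R + u)) :=
  etrans (jgraphZ _ _ _) (congr1 _ (jgraph_ddt hu)).
have e3 : jgraph u (s *: u) = s%:C%C *: mink (ddt R + u) :=
  etrans (jgraphZ _ _ _) (congr1 _ (jgraph_u hu)).
have e4 : jgraph u X' = mink X' + 'i *: mink (Jperp u X').
  by rewrite (mink_eucl X'0) (mink_eucl (Jperp0 u X')) -(screen_J X'0 Xu u0).
rewrite e1 jgraphD e2 e3 e4; congr (_ + _); symmetry.
exact: scale_comb.
Qed.

(** Every real X is the real part of the vector X + i J_u X of the plane, on which the eigenvalue
    equation has real part JX = J_u X. *)
Lemma corresponding_Jmat u (P : {vspace V}) (J : 'M[R]_4) : unit3 u ->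
  (forall v, v \in P <-> in_plane u v) ->
  (forall v, v \in P -> v *m map_mx (real_complex R) J = - 'i *: v) -> J = Jmat u.
Proof.
move=> hu hP hJ; apply/row_matrixP => k; rewrite !rowE; move: (delta_mx 0 k) => X.
have := hJ _ ((hP _).2 (eucl_in_plane X hu)).
rewrite mulmxDl -scalemxAl !eucl_mul => /(congr1 (@rpart R)); rewrite rpart_i => ->.
have -> : - 'i *: (eucl X + 'i *: eucl (X *m Jmat u)) = eucl (X *m Jmat u) + 'i *: eucl (- X).
  by rewrite euclN; exact: scaleNiD.
by rewrite rpart_i.
Qed.

Lemma in_plane_nonzero u : unit3 u -> exists2 v, in_plane u v & v != 0.
Proof.
move=> hu; exists (mink (ddt R + u)); first exact: mink_w_in_plane.
apply/eqP => /rowP /(_ 0); rewrite !mxE /= hu.1 addr0 mulr1 => /eqP.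
by rewrite oppr_eq0 (negbTE (neq0Ci _)).
Qed.
End AlphaPlane.

(** * Holomorphic distributions *)

Section VectorFields.
Variables (R : realType) (n : nat).
Local Notation C := (Cplx R).
Local Notation V := 'rV[Cplx R]_n.+1.
Local Notation RV := 'rV[R]_n.+1.
Implicit Types (p q v : V) (w : V -> V) (F G : RV -> V) (x X : RV) (L : V).

Definition vec_cplx_derive F x X L := forall j, cplx_derive (fun y => F y 0 j) x X (L 0 j).

Lemma cplx_derive_dot F G x X L L' : vec_cplx_derive F x X L -> vec_cplx_derive G x X L' ->
  cplx_derive (fun y => dot (F y) (G y)) x X (dot L (G x) + dot (F x) L').
Proof.
move=> hF hG; rewrite /dot -big_split.
by apply: cplx_derive_sum => j; exact: cplx_deriveM.
Qed.

Lemma analytic_germ_vec_cplx_derive (s : 'I_n.+1 -> C) w p x X : (forall j, cmod (s j) = 1) ->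
  (forall j, analytic_germ (fun y => w y 0 j) (p + slice s x)) ->
  vec_cplx_derive (fun y => w (p + slice s y)) x X (vec_derive (slice s X) w (p + slice s x)).
Proof. by move=> s1 hA j; rewrite mxE; exact: analytic_germ_cplx_derive. Qed.

Lemma vec_deriveD v v' w q : vec_derive (v + v') w q = vec_derive v w q + vec_derive v' w q.
Proof. by apply/rowP => j; rewrite !mxE dotD. Qed.
Lemma vec_deriveZ (c : C) v w q : vec_derive (c *: v) w q = c *: vec_derive v w q.
Proof. by apply/rowP => j; rewrite !mxE dotZ. Qed.

Lemma dotDr v v' q : dot q (v + v') = dot q v + dot q v'.
Proof. by rewrite /dot -big_split; apply: eq_bigr => k _; rewrite mxE mulrDr. Qed.
Lemma dotZr (c : C) v q : dot q (c *: v) = c * dot q v.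
Proof. by rewrite /dot mulr_sumr; apply: eq_bigr => k _; rewrite mxE; ring. Qed.

Lemma analytic_fieldP (W : set V) w : analytic_field W w <->
  forall q, W q -> forall j, analytic_germ (fun y => w y 0 j) q.
Proof.
by split=> h q Wq j; [apply: analytic_at_germ|apply: germ_analytic_at]; exact: h.
Qed.

Lemma analytic_comb (W : set V) w w' (a b : C) :
  (forall q, W q -> forall j, analytic_germ (fun y => w y 0 j) q) ->
  (forall q, W q -> forall j, analytic_germ (fun y => w' y 0 j) q) ->
  forall q, W q -> forall j, analytic_germ (fun y => (a *: w y + b *: w' y) 0 j) q.
Proof.
move=> h h' q Wq j.
rewrite (_ : (fun y => _) = fun y => a * w y 0 j + b * w' y 0 j).
  by apply: analytic_germ_add; apply: analytic_germ_mul; try exact: analytic_germ_cst; [exact: h|exact: h'].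
by apply/funext => y; rewrite !mxE.
Qed.

Lemma analytic_germ_vec_derive (W : set V) w w' : 
  (forall q, W q -> forall j, analytic_germ (fun y => w y 0 j) q) ->
  (forall q, W q -> forall j, analytic_germ (fun y => w' y 0 j) q) ->
  forall q, W q -> forall j, analytic_germ (fun y => vec_derive (w y) w' y 0 j) q.
Proof.
move=> h h' q Wq j.
rewrite (_ : (fun y => _) = fun y => \sum_k w y 0 k * pderiv k (fun z => w' z 0 j) y).
  by apply: analytic_germ_sum => k; apply: analytic_germ_mul; [exact: h|apply: analytic_germ_pderiv; exact: h'].
by apply/funext => y; rewrite mxE.
Qed.

Lemma analytic_germ_dot w w' q : (forall j, analytic_germ (fun y => w y 0 j) q) ->
  (forall j, analytic_germ (fun y => w' y 0 j) q) -> analytic_germ (fun y => dot (w y) (w' y)) q.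
Proof. by move=> h h'; apply: analytic_germ_sum => k; exact: analytic_germ_mul. Qed.

Lemma lie_bracket_vec_derive (W : set V) w w' : analytic_field W w -> analytic_field W w' ->
  forall q, W q -> lie_bracket w w' q = vec_derive (w q) w' q - vec_derive (w' q) w q.
Proof.
move=> /analytic_fieldP h /analytic_fieldP h' q Wq; rewrite /lie_bracket.
by rewrite (analytic_germ_is_derive _ (h q Wq)) (analytic_germ_is_derive _ (h' q Wq)).
Qed.

Lemma analytic_bracket (W : set V) w w' : open W -> analytic_field W w -> analytic_field W w' ->
  analytic_field W (lie_bracket w w').
Proof.
move=> oW hw hw'; have h := (analytic_fieldP _ _).1 hw; have h' := (analytic_fieldP _ _).1 hw'.
apply/analytic_fieldP => q Wq j.
have a1 := analytic_germ_vec_derive h h' Wq j; have a2 := analytic_germ_vec_derive h' h Wq j.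
apply: analytic_germ_near (analytic_germ_add a1 (analytic_germ_mul (analytic_germ_cst (-1) q) a2)).
have nW : nbhs q W by exact: open_nbhs_nbhs.
apply: filterS nW => y Wy; rewrite (lie_bracket_vec_derive hw hw' Wy) mulN1r.
by move: (vec_derive _ _ _) (vec_derive _ _ _) => a b; rewrite !mxE.
Qed.

Definition eucl_coef : 'I_n.+1 -> C := fun=> 1.
Lemma eucl_coef_cmod j : cmod (eucl_coef j) = 1. Proof. exact: cmod1. Qed.
Lemma slice0 (s : 'I_n.+1 -> C) p : p + slice s 0 = p.
Proof.
rewrite (_ : slice s 0 = 0) ?addr0 //; by apply/rowP => j; rewrite !mxE mulr0.
Qed.

Lemma cplx_re_im v : exists X Y : RV, v = slice eucl_coef X + 'i *: slice eucl_coef Y.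
Proof.
exists (\row_j complex.Re (v 0 j)), (\row_j complex.Im (v 0 j)); apply/rowP => j.
by rewrite !mxE /eucl_coef !mul1r; apply: Cplx_eq; rewrite ?Re_Ci ?Im_Ci.
Qed.

(** Along real directions this is the product rule on the Euclidean slice through [q]. A complex
    direction is X + iY with X and Y real, and the left side is complex linear in [v]. *)
Lemma dot_vec_derive0 (W : set V) w w' q v : open W -> W q ->
  analytic_field W w -> analytic_field W w' -> (forall y, W y -> dot (w y) (w' y) = 0) ->
  dot (vec_derive v w q) (w' q) + dot (w q) (vec_derive v w' q) = 0.
Proof.
move=> oW Wq /analytic_fieldP h /analytic_fieldP h' z.
have real X : dot (vec_derive (slice eucl_coef X) w q) (w' q) + dot (w q) (vec_derive (slice eucl_coef X) w' q) = 0.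
  have hq : W (q + slice eucl_coef 0) by rewrite slice0.
  have c1 := cplx_derive_dot (analytic_germ_vec_cplx_derive X eucl_coef_cmod (h _ hq)) (analytic_germ_vec_cplx_derive X eucl_coef_cmod (h' _ hq)).
  have c2 : cplx_derive (fun y => dot (w (q + slice eucl_coef y)) (w' (q + slice eucl_coef y))) 0 X 0.
    have nW : \forall y \near q + slice eucl_coef 0, W y by exact: open_nbhs_nbhs.
    apply: (cplx_derive_near _ (cplx_derive_cst 0 _ _)); apply: filterS (slice_near eucl_coef_cmod nW) => y Wy.
    by rewrite z.
  by have := cplx_derive_uniq c1 c2; rewrite slice0.
have [X [Y ->]] := cplx_re_im v.
rewrite !vec_deriveD !vec_deriveZ dotD dotZ dotDr dotZr addrACA -mulrDr !real mulr0 addr0 //.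
Qed.
End VectorFields.

Section Frames.
Variable R : realType.
Local Notation C := (Cplx R).
Local Notation V := 'rV[Cplx R]_4.
Variables (A : set V) (Pi : V -> {vspace V}).
Hypothesis openA : open A.
Hypothesis planeA : forall q, A q -> exists2 u, unit3 u & forall v, v \in Pi q <-> in_plane u v.
Implicit Types (p q v : V) (w : V -> V) (W : set V).

Lemma Pi_iso q v v' : A q -> v \in Pi q -> v' \in Pi q -> dot v v' = 0.
Proof. by move=> /planeA[u hu h] /h a /h b; exact: in_plane_isotropic a b. Qed.
Lemma Pi_perp q v : A q -> (forall v', v' \in Pi q -> dot v v' = 0) -> v \in Pi q.
Proof. by move=> /planeA[u hu h] z; apply/h/in_plane_perp => // v' /h; exact: z. Qed.

Definition frame W w1 w2 := [/\ open W, W `<=` A, analytic_field W w1, analytic_field W w2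
  & forall q, W q -> Pi q = <<[:: w1 q; w2 q]>>%VS].

(** Integrability at one point, formulated without a frame, so that it can be compared between
    points covered by different frames. *)
Definition good q := forall W w w', open W -> W q -> W `<=` A ->
  section_over Pi W w -> section_over Pi W w' -> lie_bracket w w' q \in Pi q.

Lemma frame1 W w1 w2 q : frame W w1 w2 -> W q -> w1 q \in Pi q.
Proof. by case=> _ _ _ _ h Wq; rewrite h //; apply/span2P; exists 1, 0; rewrite scale1r scale0r addr0. Qed.
Lemma frame2 W w1 w2 q : frame W w1 w2 -> W q -> w2 q \in Pi q.
Proof. by case=> _ _ _ _ h Wq; rewrite h //; apply/span2P; exists 0, 1; rewrite scale1r scale0r add0r. Qed.

Definition beta w1 w2 v q := dot (vec_derive v w1 q) (w2 q).

Lemma betaC W w1 w2 v q : frame W w1 w2 -> W q ->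
  [/\ dot (vec_derive v w1 q) (w1 q) = 0, dot (vec_derive v w2 q) (w2 q) = 0 &
      dot (vec_derive v w2 q) (w1 q) = - beta w1 w2 v q].
Proof.
move=> fr Wq; have [oW WA a1 a2 sp] := fr.
have z11 y : W y -> dot (w1 y) (w1 y) = 0.
  by move=> Wy; apply: (Pi_iso (WA _ Wy)); exact: frame1 fr Wy.
have z22 y : W y -> dot (w2 y) (w2 y) = 0.
  by move=> Wy; apply: (Pi_iso (WA _ Wy)); exact: frame2 fr Wy.
have z12 y : W y -> dot (w1 y) (w2 y) = 0.
  by move=> Wy; apply: (Pi_iso (WA _ Wy)); [exact: frame1 fr Wy|exact: frame2 fr Wy].
have e11 := dot_vec_derive0 v oW Wq a1 a1 z11; have e22 := dot_vec_derive0 v oW Wq a2 a2 z22.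
have e12 := dot_vec_derive0 v oW Wq a1 a2 z12.
have half (a b : C) : a = b -> a + b = 0 -> b = 0.
  by move=> -> /eqP; rewrite -mulr2n mulrn_eq0 => /eqP.
split.
- by rewrite dotC4; apply: half (e11); exact: dotC4.
- by rewrite dotC4; apply: half (e22); exact: dotC4.
- by apply/eqP; rewrite -addr_eq0 addrC (dotC4 (vec_derive v w2 q)); apply/eqP.
Qed.

Lemma beta_comb w1 w2 a b v v' q : beta w1 w2 (a *: v + b *: v') q = a * beta w1 w2 v q + b * beta w1 w2 v' q.
Proof. by rewrite /beta vec_deriveD !vec_deriveZ dotD !dotZ. Qed.

Lemma bracket_perp W w1 w2 q : frame W w1 w2 -> W q ->
  dot (lie_bracket w1 w2 q) (w1 q) = - beta w1 w2 (w1 q) q /\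
  dot (lie_bracket w1 w2 q) (w2 q) = - beta w1 w2 (w2 q) q.
Proof.
move=> fr Wq; have [oW WA a1 a2 sp] := fr; rewrite (lie_bracket_vec_derive a1 a2 Wq) -scaleN1r !dotD !dotZ.
have [_ b2 b3] := betaC (w1 q) fr Wq; have [c1 c2 c3] := betaC (w2 q) fr Wq.
by rewrite b2 b3 c1 mulr0 addr0 mulN1r add0r.
Qed.

Lemma sectionPi W w1 w2 q v : frame W w1 w2 -> W q ->
  (v \in Pi q) <-> exists a b, v = a *: w1 q + b *: w2 q.
Proof. by case=> _ _ _ _ sp Wq; rewrite sp //; exact: span2P. Qed.

Lemma in_Pi_frame W w1 w2 q v : frame W w1 w2 -> W q ->
  dot v (w1 q) = 0 -> dot v (w2 q) = 0 -> v \in Pi q.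
Proof.
move=> fr Wq h1 h2; have [_ WA _ _ _] := fr; apply: (Pi_perp (WA _ Wq)) => v' /(sectionPi _ fr Wq)[a [b ->]].
by rewrite dotDr !dotZr h1 h2 !mulr0 addr0.
Qed.

Lemma beta0_Pi W w1 w2 q : frame W w1 w2 -> W q ->
  beta w1 w2 (w1 q) q = 0 -> beta w1 w2 (w2 q) q = 0 ->
  forall v, v \in Pi q -> beta w1 w2 v q = 0.
Proof.
move=> fr Wq h1 h2 v /(sectionPi _ fr Wq)[a [b ->]].
by rewrite beta_comb h1 h2 !mulr0 addr0.
Qed.

(** The product rule moves the derivative from [w] to the frame, after which [w] occurs only through
    its value at [q]. Its coefficients in the frame are thus two numbers, and their dependence on
    the point never matters. *)
Lemma vec_derive_section W w1 w2 W' w q v : frame W w1 w2 -> W q -> open W' -> W' q -> W' `<=` A ->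
  section_over Pi W' w -> beta w1 w2 v q = 0 -> vec_derive v w q \in Pi q.
Proof.
move=> fr Wq oW' W'q W'A [aw sw] bv; have [oW WA a1 a2 sp] := fr.
have oI : open (W `&` W') by exact: openI.
have restr (W'' : set V) u : W `&` W' `<=` W'' -> analytic_field W'' u -> analytic_field (W `&` W') u.
  by move=> s h y /s; exact: h.
have aw' := restr _ _ (@subIsetr _ W W') aw.
have a1' := restr _ _ (@subIsetl _ W W') a1; have a2' := restr _ _ (@subIsetl _ W W') a2.
have z1 y : (W `&` W') y -> dot (w y) (w1 y) = 0.
  move=> [Wy W'y]; apply: (Pi_iso (WA _ Wy)); [exact: sw|exact: frame1 fr Wy].
have z2 y : (W `&` W') y -> dot (w y) (w2 y) = 0.
  move=> [Wy W'y]; apply: (Pi_iso (WA _ Wy)); [exact: sw|exact: frame2 fr Wy].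
have Iq : (W `&` W') q by [].
have e1 := dot_vec_derive0 v oI Iq aw' a1' z1; have e2 := dot_vec_derive0 v oI Iq aw' a2' z2.
have [b1 b2 b3] := betaC v fr Wq.
have [a [b ew]] := (sectionPi (w q) fr Wq).1 (sw _ W'q).
have cz (x : C) : x * 0 = 0 by exact: mulr0.
apply: (in_Pi_frame fr Wq).
  move: e1; rewrite ew (dotD (a *: w1 q)) !dotZ (dotC4 (w1 q)) b1 (dotC4 (w2 q)) -/(beta w1 w2 v q) bv.
  by rewrite !mulr0 !addr0.
move: e2; rewrite ew (dotD (a *: w1 q)) !dotZ (dotC4 (w1 q)) b3 bv (dotC4 (w2 q)) b2.
by rewrite oppr0 !mulr0 !addr0.
Qed.

Lemma frame_section W w1 w2 : frame W w1 w2 -> section_over Pi W w1 /\ section_over Pi W w2.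
Proof.
move=> fr; have [oW WA a1 a2 sp] := fr; split; split=> // q Wq.
  exact: frame1 fr Wq.
exact: frame2 fr Wq.
Qed.

Lemma good_beta W w1 w2 q : frame W w1 w2 -> W q ->
  good q <-> beta w1 w2 (w1 q) q = 0 /\ beta w1 w2 (w2 q) q = 0.
Proof.
move=> fr Wq; have [oW WA a1 a2 sp] := fr; split=> [g|[h1 h2]].
  have [s1 s2] := frame_section fr; have := g W w1 w2 oW Wq WA s1 s2 => br.
  have [p1 p2] := bracket_perp fr Wq.
  rewrite (Pi_iso (WA _ Wq) br (frame1 fr Wq)) in p1.
  rewrite (Pi_iso (WA _ Wq) br (frame2 fr Wq)) in p2.
  by move/esym/eqP: p1; move/esym/eqP: p2; rewrite !oppr_eq0 => /eqP -> /eqP ->.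
move=> W' w w' oW' W'q W'A s s'.
rewrite (lie_bracket_vec_derive s.1 s'.1 W'q); apply: memvB.
  by apply: (vec_derive_section fr Wq oW' W'q W'A s'); apply: (beta0_Pi fr Wq h1 h2); exact: s.2.
by apply: (vec_derive_section fr Wq oW' W'q W'A s); apply: (beta0_Pi fr Wq h1 h2); exact: s'.2.
Qed.

Lemma bracket_good W w1 w2 q : frame W w1 w2 -> W q -> lie_bracket w1 w2 q \in Pi q -> good q.
Proof.
move=> fr Wq br; apply/(good_beta fr Wq); have [oW WA a1 a2 sp] := fr.
have [p1 p2] := bracket_perp fr Wq.
rewrite (Pi_iso (WA _ Wq) br (frame1 fr Wq)) in p1.
rewrite (Pi_iso (WA _ Wq) br (frame2 fr Wq)) in p2.
by move/esym/eqP: p1; move/esym/eqP: p2; rewrite !oppr_eq0 => /eqP -> /eqP ->.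
Qed.

Lemma integrable_good : integrable_distribution A Pi <-> forall q, A q -> good q.
Proof.
split=> [h q Aq W w w' oW Wq WA s s'|h W w w' oW WA s s'].
  by have [_ ->] := h W w w' oW WA s s'.
split; first exact: analytic_bracket oW s.1 s'.1.
by move=> q Wq; apply: (h q (WA _ Wq)) s s'.
Qed.

Lemma analytic_germ_beta W w1 w2 q : frame W w1 w2 -> W q ->
  analytic_germ (fun y => beta w1 w2 (w1 y) y) q /\ analytic_germ (fun y => beta w1 w2 (w2 y) y) q.
Proof.
move=> [oW WA /analytic_fieldP a1 /analytic_fieldP a2 sp] Wq; split; apply: analytic_germ_dot => //.
- exact: (analytic_germ_vec_derive a1 a1 Wq).
- exact: a2.
- exact: (analytic_germ_vec_derive a2 a1 Wq).
- exact: a2.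
Qed.

(** Quantified over all frames, so that flatness of points near [q] can be read in a frame fixed
    around [q]. *)
Definition flat q := forall W w1 w2, frame W w1 w2 -> W q -> forall ks,
  pderivs ks (fun y => beta w1 w2 (w1 y) y) q = 0 /\ pderivs ks (fun y => beta w1 w2 (w2 y) y) q = 0.

Hypothesis frames : forall q, A q -> exists W w1 w2, frame W w1 w2 /\ W q.

Lemma flat_good q : A q -> flat q -> \forall y \near q, good y.
Proof.
move=> Aq f; have [W [w1 [w2 [fr Wq]]]] := frames Aq; have h := f _ _ _ fr Wq.
have [oW _ _ _ _] := fr; have [A1 A2] := analytic_germ_beta fr Wq.
have n1 := flat_vanish A1 (fun ks => (h ks).1); have n2 := flat_vanish A2 (fun ks => (h ks).2).
have nW : nbhs q W by exact: open_nbhs_nbhs.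
near=> y; have Wy : W y by near: y.
by apply/(good_beta fr Wy); split; near: y.
Unshelve. all: by end_near. Qed.

Lemma good_flat q : A q -> (\forall y \near q, good y) -> flat q.
Proof.
move=> Aq g W w1 w2 fr Wq ks; have [oW _ _ _ _] := fr.
have nW : nbhs q W by exact: open_nbhs_nbhs.
split; apply: vanish_near_pderivs; near=> y.
  have Wy : W y by near: y.
  have gy : good y by near: y.
  by have [-> _] := (good_beta fr Wy).1 gy.
have Wy : W y by near: y.
have gy : good y by near: y.
by have [_ ->] := (good_beta fr Wy).1 gy.
Unshelve. all: by end_near. Qed.

(* Flatness of the coefficients passes to the limit by continuity of the iterated
   partials, and to a neighbourhood by the series at the point itself, so no
   series has to be expanded again about another centre. *)
Lemma flat_closed q : A q -> closure [set y | A y /\ flat y] q -> flat q.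
Proof.
move=> Aq cl W w1 w2 fr Wq ks; have [A1 A2] := analytic_germ_beta fr Wq; have [oW _ _ _ _] := fr.
have nW : nbhs q W by exact: open_nbhs_nbhs.
have van (f : V -> C) : analytic_germ f q -> (forall y, W y -> flat y -> pderivs ks f y = 0) -> pderivs ks f q = 0.
  move=> Af z; apply: cmod_le0; apply: (@le_geo _ _ _ 1) => N; rewrite add0r.
  have e0 : 0 < 1 / 2 ^+ N :> R by rewrite divr_gt0 ?exprn_gt0.
  have c := strong_diff_cont (analytic_germ_strong_diff (analytic_germ_pderivs ks Af)) e0.
  have [y [[Ay fy] [Wy]]] := cl _ (filterI nW c).
  by rewrite (z y Wy fy) sub0r cmodN.
split; apply: van => // y Wy fy; by have [] := fy _ _ _ fr Wy ks.
Qed.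

(** The flat points of A form a nonempty set, closed in A and open: near a flat point all points are
    good, and a point with good neighbours is flat in every frame. *)
Lemma flat_all q0 : connected A -> A q0 -> flat q0 -> forall q, A q -> good q.
Proof.
move=> cA A0 f0.
pose Z := [set q | A q /\ flat q].
suff ZA : Z = A.
  by move=> q; rewrite -{1}ZA => -[Aq fq]; exact: nbhs_singleton (flat_good Aq fq).
apply: cA; first by exists q0.
- exists Z; last by apply/seteqP; split=> q // -[] //.
  rewrite openE => q [Aq fq].
  have nA : nbhs q A by exact: open_nbhs_nbhs.
  have := nbhs_interior (flat_good Aq fq).
  by move=> h; apply: filterS2 nA h => y Ay hy; split=> //; exact: good_flat.
- exists (closure Z); first exact: closed_closure.
  apply/seteqP; split=> q; first by move=> [Aq fq]; split=> //; apply: subset_closure.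
  by move=> [Aq cq]; split=> //; exact: flat_closed.
Qed.

(** Goodness along the slice makes beta(w1) and beta(w2) vanish on it near [p], which is flatness at
    [p]. *)
Lemma good_slice (s : 'I_4 -> C) p : (forall j, cmod (s j) = 1) -> connected A -> A p ->
  (forall x, A (p + slice s x) -> good (p + slice s x)) -> forall q, A q -> good q.
Proof.
move=> s1 cA Ap h; apply: (flat_all cA Ap) => W w1 w2 fr Wp ks.
have [oW WA _ _ _] := fr.
have nW : \forall y \near p + slice s 0, W y by rewrite slice0; exact: open_nbhs_nbhs.
have nx := slice_near s1 nW.
rewrite -(slice0 s p); split; apply: slice_vanish_pderivs => //.
- by apply: filterS nW => y Wy; have [] := analytic_germ_beta fr Wy.
- by apply: filterS nx => x Wx; have [] := (good_beta fr Wx).1 (h x (WA _ Wx)).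
- by apply: filterS nW => y Wy; have [] := analytic_germ_beta fr Wy.
- by apply: filterS nx => x Wx; have [] := (good_beta fr Wx).1 (h x (WA _ Wx)).
Qed.
End Frames.

(** * The Euclidean slice *)

Section RealVectorDerivatives.
Variables (R : realType).
Local Notation RV := 'rV[R]_4.
Implicit Types (F X Y : RV -> RV) (x v : RV) (J : RV -> 'M[R]_4).

Lemma smooth_order_sub n k (V W : set 'rV[R]_n.+1) phi : W `<=` V -> smooth_order k V phi -> smooth_order k W phi.
Proof.
move=> WV; elim: k phi => [|k IH] phi [h1 h2]; split=> //.
- by move=> y /WV; exact: h1.
- by move=> y /WV; exact: h1.
- by move=> v; exact/IH/h2.
Qed.

Lemma is_derive_rV F x v (L : RV) : (forall j, is_derive x v (fun y => F y 0 j) (L 0 j)) ->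
  is_derive x v F L.
Proof.
move=> h; have d : derivable F x v.
  by apply/derivable_mxP => i j; rewrite (ord1 i); have [] := h j.
split=> //; rewrite derive_mx //; apply/rowP => j; rewrite mxE.
by have [_ ->] := h j.
Qed.

Lemma is_derive_sum4 (F : 'I_4 -> RV -> R) x v (L : 'I_4 -> R) :
  (forall j, is_derive x v (F j) (L j)) -> is_derive x v (fun y => \sum_j F j y) (\sum_j L j).
Proof.
move=> h; rewrite sum4 (_ : (fun y => _) = fun y => F 0 y + F 1 y + F 2 y + F 3 y).
  by do 3 apply: is_deriveDr => //.
by apply/funext => y; rewrite sum4.
Qed.

Definition matrix_derive J x v : 'M[R]_4 := \matrix_(i, j) 'D_v (fun y => J y i j) x.

Lemma is_derive_mulmx F J x v : derivable F x v -> (forall i j, derivable (fun y => J y i j) x v) ->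
  is_derive x v (fun y => F y *m J y) (F x *m matrix_derive J x v + 'D_v F x *m J x).
Proof.
move=> dF dJ; apply: is_derive_rV => j.
have dFi i : is_derive x v (fun y => F y 0 i) ('D_v F x 0 i).
  by rewrite derive_mx // mxE; apply: derivableP; apply: (derivable_mxP F x v).1.
have dJi i : is_derive x v (fun y => J y i j) (matrix_derive J x v i j).
  by rewrite mxE; exact: derivableP.
have := is_derive_sum4 (fun i => is_deriveMr (dFi i) (dJi i)).
have -> : (fun y => \sum_i F y 0 i * J y i j) = fun y => (F y *m J y) 0 j.
  by apply/funext => y; rewrite mxE.
have -> // : \sum_i ('D_v F x 0 i * J x i j + F x 0 i * matrix_derive J x v i j) = (F x *m matrix_derive J x v + 'D_v F x *m J x) 0 j.
by rewrite big_split addrC mxE; congr (_ + _); rewrite mxE.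
Qed.

(** What remains of N_J(X, Y) at [x], with a = X x and b = Y x, once the derivatives of X and Y have
    cancelled by J^2 = -1. Arbitrary fields can then be traded for constant ones or for real parts
    of sections. *)
Definition nijenhuis_tensor J x (a b : RV) : RV :=
  b *m matrix_derive J x (a *m J x) - a *m matrix_derive J x (b *m J x)
  + a *m matrix_derive J x b *m J x - b *m matrix_derive J x a *m J x.

Lemma nijenhuis_tensor_alg (K : comRingType) n (a b c1 c2 c3 c4 : 'rV[K]_n) (M D1 D2 D3 D4 : 'M[K]_n) :
  M *m M = - 1%:M ->
  (b *m D1 + c1 *m M) - (a *m D2 + c2 *m M) - (c1 - (a *m D3 + c3 *m M)) *m M
   - ((b *m D4 + c4 *m M) - c2) *m M - (c4 - c3)
  = b *m D1 - a *m D2 + a *m D3 *m M - b *m D4 *m M.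
Proof.
move=> MM; rewrite !mulmxBl !mulmxDl -!(mulmxA _ M M) MM !mulmxN !mulmx1.
move: (b *m D1) (a *m D2) (a *m D3 *m M) (b *m D4 *m M) (c1 *m M) (c2 *m M) => t1 t2 t3 t4 t5 t6.
by apply/rowP => j; rewrite !mxE; ring.
Qed.

Lemma nijenhuisE J X Y x : J x *m J x = - 1%:M ->
  (forall v, derivable X x v) -> (forall v, derivable Y x v) ->
  (forall i j v, derivable (fun y => J y i j) x v) ->
  nijenhuis J X Y x = nijenhuis_tensor J x (X x) (Y x).
Proof.
move=> JJ dX dY dJ; rewrite /nijenhuis /lie_bracket /actJ.
have dXJ v : 'D_v (fun y => X y *m J y) x = X x *m matrix_derive J x v + 'D_v X x *m J x.
  by have [_ ->] := is_derive_mulmx (dX v) (fun i j => dJ i j v).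
have dYJ v : 'D_v (fun y => Y y *m J y) x = Y x *m matrix_derive J x v + 'D_v Y x *m J x.
  by have [_ ->] := is_derive_mulmx (dY v) (fun i j => dJ i j v).
rewrite !dXJ !dYJ; exact: nijenhuis_tensor_alg.
Qed.
End RealVectorDerivatives.

Section PlaneField.
Variable R : realType.
Local Notation C := (Cplx R).
Local Notation V := 'rV[Cplx R]_4.
Local Notation RV := 'rV[R]_4.
Variables (A : set V) (Pi : V -> {vspace V}) (U : V -> RV).
Hypothesis openA : open A.
Hypothesis U_unit : forall q, A q -> unit3 (U q).
Hypothesis U_plane : forall q, A q -> forall v, v \in Pi q <-> in_plane (U q) v.
Hypothesis frames : forall q, A q -> exists W w1 w2, frame A Pi W w1 w2 /\ W q.
Implicit Types (p q v : V) (w : V -> V) (W : set V) (s : 'I_4 -> C) (x X : RV).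

Lemma planeU q : A q -> exists2 u, unit3 u & forall v, v \in Pi q <-> in_plane u v.
Proof. by move=> Aq; exists (U q); [exact: U_unit|exact: U_plane]. Qed.

Lemma nonzero_section q : A q -> exists W w, [/\ open W, W q, W `<=` A, section_over Pi W w & w q != 0].
Proof.
move=> Aq; have [W [w1 [w2 [fr Wq]]]] := frames Aq.
have [oW WA a1 a2 sp] := fr; have [s1 s2] := frame_section fr.
have [v hv v0] := in_plane_nonzero (U_unit Aq).
have [a [b ev]] := (sectionPi v fr Wq).1 ((U_plane Aq v).2 hv).
have [e1|n1] := eqVneq (w1 q) 0; last by exists W, w1.
exists W, w2; split=> //; apply: contra v0 => /eqP e2.
by rewrite ev e1 e2 !scaler0 addr0.
Qed.

(** Along the slice u is [uquot] of the real and imaginary parts of a section divided by [nsq] of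
    the real part. These parts are smooth as restrictions of analytic functions. *)
Lemma U_smooth s p x : (forall j, cmod (s j) = 1) -> A (p + slice s x) ->
  exists W : set RV, [/\ open W, W x, (forall y, W y -> A (p + slice s y)) &
    forall k j, smooth_order k W (fun y => U (p + slice s y) 0 j)].
Proof.
move=> s1 Ax; have [W0 [w [oW0 Wx WA [aw sw] wn]]] := nonzero_section Ax.
pose W1 := [set y | W0 (p + slice s y)].
have oW1 : open W1 by exact: slice_open.
pose re y : RV := rpart (w (p + slice s y)); pose im y : RV := ipart (w (p + slice s y)).
have hA := (analytic_fieldP _ _).1 aw.
have Sre k i : smooth_order k W1 (fun y => re y 0 i).
  apply: (smooth_order_ext oW1 _ ((analytic_germ_smooth s1 oW1 (fun y Wy => hA _ Wy i)) k).1) => y _.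
  by rewrite mxE.
have Sim k i : smooth_order k W1 (fun y => im y 0 i).
  apply: (smooth_order_ext oW1 _ ((analytic_germ_smooth s1 oW1 (fun y Wy => hA _ Wy i)) k).2) => y _.
  by rewrite mxE.
have Snsq k : smooth_order k W1 (fun y => nsq (re y)).
  have S i := smooth_orderM oW1 (Sre k i) (Sre k i).
  exact: (smooth_orderD oW1 (smooth_orderD oW1 (smooth_orderD oW1 (S 0) (S 1)) (S 2)) (S 3)).
have Squot k j : smooth_order k W1 (fun y => uquot (re y) (im y) 0 j).
  have M1 i i' := smooth_orderM oW1 (Sre k i) (Sim k i'); have M2 i i' := smooth_orderM oW1 (Sim k i) (Sre k i').
  have B i i' l l' : smooth_order k W1 (fun y => re y 0 i * im y 0 i' - im y 0 l * re y 0 l').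
    exact: (smooth_orderD oW1 (M1 i i') (smooth_orderN oW1 (M2 l l'))).
  have B' i i' l l' : smooth_order k W1 (fun y => re y 0 i * im y 0 i' - re y 0 l * im y 0 l').
    exact: (smooth_orderD oW1 (M1 i i') (smooth_orderN oW1 (M1 l l'))).
  elim/ord4P: j.
  - by apply: (smooth_order_ext oW1 _ (smooth_order_cst k 0 oW1)) => y _; rewrite mxE.
  - by apply: (smooth_order_ext oW1 _ (smooth_orderD oW1 (B 0 1 0 1) (B' 2 3 3 2))) => y _; rewrite [RHS]mxE.
  - by apply: (smooth_order_ext oW1 _ (smooth_orderD oW1 (B 0 2 0 2) (B' 3 1 1 3))) => y _; rewrite [RHS]mxE.
  - by apply: (smooth_order_ext oW1 _ (smooth_orderD oW1 (B 0 3 0 3) (B' 1 2 2 1))) => y _; rewrite [RHS]mxE.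
(* Openness holds by construction; continuity of [nsq (re y)] is called upon only at [x], to place
   it in [W2]. *)
pose W2 := interior [set y | W1 y /\ nsq (re y) != 0].
have sub2 y : W2 y -> W1 y /\ nsq (re y) != 0 by move=> /interior_subset.
have oW2 : open W2 by exact: open_interior.
exists W2; split=> //.
- have n0 : nsq (re x) != 0.
    by rewrite gt_eqF // nsq_gt0 //; apply: in_plane_rpart_neq0 (U_unit Ax) _ wn; apply/(U_plane Ax)/sw.
  have c : {for x, continuous (fun y => nsq (re y))}.
    by apply: differentiable_continuous; exact: smooth_order_diff (Snsq 0%N) Wx.
  have nW1 : nbhs x W1 by exact: open_nbhs_nbhs.
  have nn : \forall y \near x, nsq (re y) != 0.
    have : \forall z \near nsq (re x), z != 0 by exact: open_nbhs_nbhs (conj (@open_neq _ 0) n0).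
    exact: c.
  by apply: filterS2 nW1 nn.
- by move=> y /sub2[W1y _]; exact: WA.
- move=> k j; have W21 : W2 `<=` W1 by move=> y /sub2[].
  have SV : smooth_order k W2 (fun y => (nsq (re y))^-1).
    by apply: (smooth_orderV oW2); [move=> y /sub2[]|exact: smooth_order_sub W21 (Snsq k)].
  apply: (smooth_order_ext oW2 _ (smooth_orderM oW2 (smooth_order_sub W21 (Squot k j)) SV)) => y /sub2[W1y n0].
  rewrite (uquotE (U_unit (WA _ W1y))); last by apply/(U_plane (WA _ W1y)); exact: sw.
  by rewrite mxE mulrAC divff // mul1r.
Qed.

Lemma U_diff s p x j : (forall j, cmod (s j) = 1) -> A (p + slice s x) ->
  differentiable (fun y => U (p + slice s y) 0 j) x.
Proof.
by move=> s1 Ax; have [W [oW Wx _ h]] := U_smooth s1 Ax; exact: smooth_order_diff (h 0%N j) Wx.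
Qed.
End PlaneField.

Section EuclideanSlice.
Variable R : realType.
Local Notation C := (Cplx R).
Local Notation V := 'rV[Cplx R]_4.
Local Notation RV := 'rV[R]_4.
Variables (A : set V) (Pi : V -> {vspace V}) (U : V -> RV) (p : V) (J : RV -> 'M[R]_4).
Hypothesis openA : open A.
Hypothesis U_unit : forall q, A q -> unit3 (U q).
Hypothesis U_plane : forall q, A q -> forall v, v \in Pi q <-> in_plane (U q) v.
Hypothesis frames : forall q, A q -> exists W w1 w2, frame A Pi W w1 w2 /\ W q.
Hypothesis corrJ : corresponding_J A Pi p J.
Implicit Types (q v : V) (w : V -> V) (W : set V) (x X Y : RV).

Lemma slice_eucl x : slice (@eucl_coef R 3) x = eucl x.
Proof. by apply/rowP => j; rewrite !mxE mul1r. Qed.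

Lemma JmatE x : A (p + eucl x) -> J x = Jmat (U (p + eucl x)).
Proof.
by move=> Ax; apply: (corresponding_Jmat (U_unit Ax) (U_plane Ax)) => v /(corrJ Ax) [].
Qed.

Lemma near_eucl W x : open W -> W (p + eucl x) -> \forall y \near x, W (p + eucl y).
Proof.
move=> oW Wx; have : \forall y \near p + slice (@eucl_coef R 3) x, W y.
  by rewrite slice_eucl; exact: open_nbhs_nbhs.
by move/(slice_near (@eucl_coef_cmod R 3)); apply: filterS => y; rewrite slice_eucl.
Qed.

Lemma Jmat_entry i j : (exists k, forall u : RV, Jmat u i j = u 0 k) \/
  (exists k, forall u : RV, Jmat u i j = - u 0 k) \/ (forall u : RV, Jmat u i j = 0).
Proof.
elim/ord4P: i; elim/ord4P: j; first [by right; right => u; rewrite mxE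
 |by left; exists 1 => u; rewrite mxE|by left; exists 2 => u; rewrite mxE
 |by left; exists 3 => u; rewrite mxE|by right; left; exists 1 => u; rewrite mxE
 |by right; left; exists 2 => u; rewrite mxE|by right; left; exists 3 => u; rewrite mxE].
Qed.

Lemma J_derivable x i j X : A (p + eucl x) -> derivable (fun y => J y i j) x X.
Proof.
move=> Ax; have dU k : derivable (fun y => U (p + eucl y) 0 k) x X.
  apply: diff_derivable; have := @U_diff R A Pi U U_unit U_plane frames (@eucl_coef R 3) p x k (@eucl_coef_cmod R 3).
  rewrite slice_eucl => /(_ Ax).
  by rewrite (_ : (fun y => _) = fun y => U (p + eucl y) 0 k) //; apply/funext => y; rewrite slice_eucl.
have dN k : derivable (fun y => - U (p + eucl y) 0 k) x X by exact: derivableN (dU k).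
apply: (@near_eq_derivable _ _ _ (fun y => Jmat (U (p + eucl y)) i j)).
  by apply: filterS (near_eucl openA Ax) => y Ay; rewrite JmatE.
have [[k hk]|[[k hk]|h0]] := Jmat_entry i j.
- by rewrite (_ : (fun y => _) = fun y => U (p + eucl y) 0 k) //; apply/funext => y.
- by rewrite (_ : (fun y => _) = fun y => - U (p + eucl y) 0 k) //; apply/funext => y.
- by rewrite (_ : (fun y => _) = cst 0); [exact: derivable_cst|apply/funext => y; rewrite h0].
Qed.

Lemma J_sq x : A (p + eucl x) -> J x *m J x = - 1%:M.
Proof. by move=> Ax; rewrite (JmatE Ax); exact/Jmat_sq/U_unit. Qed.

Definition re_field w y : RV := rpart (w (p + eucl y)).
Definition im_field w y : RV := ipart (w (p + eucl y)).

Lemma re_field_is_derive W w x X : open W -> W (p + eucl x) -> analytic_field W w ->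
  is_derive x X (re_field w) (rpart (vec_derive (eucl X) w (p + eucl x))) /\
  is_derive x X (im_field w) (ipart (vec_derive (eucl X) w (p + eucl x))).
Proof.
move=> oW Wx /analytic_fieldP hA.
have h := @analytic_germ_vec_cplx_derive R 3 (@eucl_coef R 3) w p x X (@eucl_coef_cmod R 3).
rewrite !slice_eucl in h; have {}h := h (hA _ Wx).
by split; apply: is_derive_rV => j; have [h1 h2] := h j;
  [congr is_derive: h1|congr is_derive: h2]; rewrite ?mxE //; apply/funext => y;
  rewrite mxE slice_eucl.
Qed.

(** Near [x] the field J X is the imaginary part of the section, so every derivative in N_J is the
    real or imaginary part of a complex derivative of a section. Expanding the bracket by complex
    linearity in the direction matches the terms. *)
Lemma nijenhuis_sections W w w' x : open W -> W (p + eucl x) -> W `<=` A ->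
  section_over Pi W w -> section_over Pi W w' ->
  nijenhuis J (re_field w) (re_field w') x =
   - rpart (lie_bracket w w' (p + eucl x)) - ipart (lie_bracket w w' (p + eucl x)) *m J x.
Proof.
move=> oW Wx WA [aw sw] [aw' sw']; have Ax := WA _ Wx.
have ipfE u y : section_over Pi W u -> W (p + eucl y) -> im_field u y = re_field u y *m J y.
  move=> [_ su] Wy; rewrite (JmatE (WA _ Wy)); apply/(in_plane_reim _ (U_unit (WA _ Wy))).
  by apply/(U_plane (WA _ Wy)); exact: su.
have nW := near_eucl oW Wx.
have DJ u X : section_over Pi W u -> 'D_X (actJ J (re_field u)) x = 'D_X (im_field u) x.
  by move=> su; apply: near_eq_derive; apply: filterS nW => y Wy; rewrite ipfE.
have D u X : section_over Pi W u -> 'D_X (re_field u) x = rpart (vec_derive (eucl X) u (p + eucl x)).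
  by move=> [au _]; have [[_ ->] _] := re_field_is_derive X oW Wx au.
have Di u X : section_over Pi W u -> 'D_X (im_field u) x = ipart (vec_derive (eucl X) u (p + eucl x)).
  by move=> [au _]; have [_ [_ ->]] := re_field_is_derive X oW Wx au.
have s : section_over Pi W w by []. have s' : section_over Pi W w' by [].
have aE u : section_over Pi W u -> actJ J (re_field u) x = im_field u x by move=> su; rewrite /actJ ipfE.
have rpartD (a b : V) : rpart (a + b) = rpart a + rpart b by apply/rowP => j; rewrite !mxE cReD.
have ipartD (a b : V) : ipart (a + b) = ipart a + ipart b by apply/rowP => j; rewrite !mxE cImD.
have rpartN (a : V) : rpart (- a) = - rpart a by apply/rowP => j; rewrite !mxE cReN.
have ipartN (a : V) : ipart (- a) = - ipart a by apply/rowP => j; rewrite !mxE cImN.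
have Rei (z : C) : complex.Re ('i * z) = - complex.Im z.
  by rewrite -complexiE cReM /=; ring.
have Imi (z : C) : complex.Im ('i * z) = complex.Re z.
  by rewrite -complexiE cImM /=; ring.
have rparti (a : V) : rpart ('i *: a) = - ipart a by apply/rowP => j; rewrite !mxE Rei.
have iparti (a : V) : ipart ('i *: a) = rpart a by apply/rowP => j; rewrite !mxE Imi.
have wE u : u (p + eucl x) = eucl (re_field u x) + 'i *: eucl (im_field u x) by exact: reimE.
have vE u u' : vec_derive (u (p + eucl x)) u' (p + eucl x) =
    vec_derive (eucl (re_field u x)) u' (p + eucl x) + 'i *: vec_derive (eucl (im_field u x)) u' (p + eucl x).
  by rewrite -vec_deriveZ -vec_deriveD -wE.
rewrite (lie_bracket_vec_derive aw aw' Wx) !vE.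
rewrite !(rpartD, ipartD, rpartN, ipartN, rparti, iparti).
have -> : nijenhuis J (re_field w) (re_field w') x =
  lie_bracket (actJ J (re_field w)) (actJ J (re_field w')) x
  - lie_bracket (actJ J (re_field w)) (re_field w') x *m J x
  - lie_bracket (re_field w) (actJ J (re_field w')) x *m J x - lie_bracket (re_field w) (re_field w') x by [].
rewrite /lie_bracket.
rewrite !aE // !DJ // !D // !Di // !mulmxBl !mulmxDl.
move: (rpart _ *m _) (rpart _ *m _) (ipart _ *m _) (ipart _ *m _) => t1 t2 t3 t4.
move: (rpart _) (rpart _) (ipart _) (ipart _) => t5 t6 t7 t8.
by apply/rowP => j; rewrite !mxE; ring.
Qed.

Lemma re_field_derivable W w x X : open W -> W (p + eucl x) -> analytic_field W w ->
  derivable (re_field w) x X.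
Proof. by move=> oW Wx aw; have [[]] := re_field_is_derive X oW Wx aw. Qed.

Lemma nijenhuis_tensor_sections W w w' x : open W -> W (p + eucl x) -> W `<=` A ->
  section_over Pi W w -> section_over Pi W w' ->
  nijenhuis_tensor J x (re_field w x) (re_field w' x) =
   - rpart (lie_bracket w w' (p + eucl x)) - ipart (lie_bracket w w' (p + eucl x)) *m J x.
Proof.
move=> oW Wx WA s s'; have Ax := WA _ Wx.
rewrite -(nijenhuis_sections oW Wx WA s s'); symmetry; apply: nijenhuisE.
- exact: J_sq.
- by move=> X; exact: re_field_derivable oW Wx s.1.
- by move=> X; exact: re_field_derivable oW Wx s'.1.
- by move=> i j X; exact: J_derivable.
Qed.

Lemma nijenhuis_tensor0_iff W w w' x : open W -> W (p + eucl x) -> W `<=` A ->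
  section_over Pi W w -> section_over Pi W w' ->
  nijenhuis_tensor J x (re_field w x) (re_field w' x) = 0 <-> lie_bracket w w' (p + eucl x) \in Pi (p + eucl x).
Proof.
move=> oW Wx WA s s'; have Ax := WA _ Wx; have JJ := J_sq Ax.
rewrite (nijenhuis_tensor_sections oW Wx WA s s'); set L := lie_bracket _ _ _.
apply: (iff_trans _ (iff_sym (U_plane Ax L))); apply: (iff_trans _ (iff_sym (in_plane_reim L (U_unit Ax)))).
rewrite -(JmatE Ax); split=> [e|->]; last first.
  by rewrite -mulmxA JJ mulmxN mulmx1 opprK addNr.
have {}e : rpart L = - (ipart L *m J x) by apply/eqP; rewrite -addr_eq0 -oppr_eq0 opprD; apply/eqP.
by rewrite e mulNmx -mulmxA JJ mulmxN mulmx1 opprK.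
Qed.

Lemma section_through q (v : V) : A q -> v \in Pi q -> forall W w1 w2, frame A Pi W w1 w2 -> W q ->
  exists2 w, section_over Pi W w & w q = v.
Proof.
move=> Aq vq W w1 w2 fr Wq; have [oW WA a1 a2 sp] := fr.
have [a [b ->]] := (sectionPi v fr Wq).1 vq.
pose w y := a *: w1 y + b *: w2 y.
have aw : analytic_field W w.
  by apply/analytic_fieldP; apply: analytic_comb; exact/analytic_fieldP.
have sw y : W y -> w y \in Pi y by move=> Wy; apply/(sectionPi _ fr Wy); exists a, b.
by exists w; first exact: conj aw sw.
Qed.

(** Any real vector is the real part of a vector of the plane, hence at [x] of a section with
    constant coefficients in a frame. Conversely the bracket of the frame itself suffices for
    goodness. *)
Lemma good_nijenhuis_tensor x : A (p + eucl x) -> good A Pi (p + eucl x) <-> forall a b, nijenhuis_tensor J x a b = 0.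
Proof.
move=> Ax; have [W [w1 [w2 [fr Wx]]]] := frames Ax; have [oW WA a1 a2 sp] := fr.
split=> [g a b|h].
  have hJ c : jgraph (U (p + eucl x)) c \in Pi (p + eucl x) by apply/(U_plane Ax)/eucl_in_plane/U_unit.
  have [w s ew] := section_through Ax (hJ a) fr Wx.
  have [w' s' ew'] := section_through Ax (hJ b) fr Wx.
  have ra : re_field w x = a by rewrite /re_field ew /jgraph rpart_i.
  have rb : re_field w' x = b by rewrite /re_field ew' /jgraph rpart_i.
  by rewrite -ra -rb; apply/(nijenhuis_tensor0_iff oW Wx WA s s'); exact: g oW Wx WA s s'.
have [s1 s2] := frame_section fr.
by apply: (bracket_good (planeU U_unit U_plane) fr Wx); apply/(nijenhuis_tensor0_iff oW Wx WA s1 s2).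
Qed.

Lemma smooth_cst (W : set RV) (a : RV) : smooth_field W (cst a).
Proof.
move=> k; elim: k a => [|k IH] a /=; first by move=> x _; exact: cst_continuous.
move=> v; split=> [x _|]; first exact: derivable_cst.
rewrite (_ : 'D_v (cst a) = cst 0); first exact: IH.
by apply/funext => x; rewrite derive_cst.
Qed.

Lemma integrable_J_nijenhuis_tensor : integrable_J (eucl_slice A p) J <->
  forall x, A (p + eucl x) -> forall a b, nijenhuis_tensor J x a b = 0.
Proof.
split=> [h x Ax a b|h X Y sX sY x Ax].
  (* Constant fields already realise every pair of values at [x]. *)
  rewrite -(h (cst a) (cst b) (smooth_cst _ _) (smooth_cst _ _) x Ax); symmetry.
  apply: (@nijenhuisE _ J (cst a) (cst b)); first exact: J_sq.
  - by move=> v; exact: derivable_cst.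
  - by move=> v; exact: derivable_cst.
  - by move=> i j v; exact: J_derivable.
rewrite nijenhuisE ?h //; first exact: J_sq.
- by move=> v; have [+ _] := sX 1%N v; apply.
- by move=> v; have [+ _] := sY 1%N v; apply.
- by move=> i j v; exact: J_derivable.
Qed.

Lemma integrable_iff_J : connected A -> A p ->
  integrable_distribution A Pi <-> integrable_J (eucl_slice A p) J.
Proof.
move=> cA Ap; apply: (iff_trans (integrable_good A Pi)); apply: (iff_trans _ (iff_sym integrable_J_nijenhuis_tensor)).
split=> [g x Ax|h]; first by apply/good_nijenhuis_tensor => //; exact: g.
apply: (good_slice openA (planeU U_unit U_plane) frames (@eucl_coef_cmod R 3) cA Ap) => x.
by rewrite slice_eucl => Ax; apply/good_nijenhuis_tensor => //; exact: h.
Qed.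
End EuclideanSlice.

(** * The Minkowski slice *)

Lemma diff_comb (R : realType) (V : normedModType R) (f : V -> R) (x v w : V) (a b : R) :
  'd f x (a *: v + b *: w) = a * 'd f x v + b * 'd f x w.
Proof. by rewrite linearD !linearZ. Qed.

Lemma derive_comb (R : realType) n (f : 'rV[R]_n.+1 -> R) (x v w : 'rV[R]_n.+1) (a b : R) :
  differentiable f x -> 'D_(a *: v + b *: w) f x = a * 'D_v f x + b * 'D_w f x.
Proof.
move=> d; rewrite (deriveE (a *: v + b *: w) d) (deriveE v d) (deriveE w d).
exact: diff_comb.
Qed.

Lemma dot_vec_derive_pair (R : realType) n (a b z w v v' q : 'rV[Cplx R]_n.+1)
    (f : 'rV[Cplx R]_n.+1 -> 'rV[Cplx R]_n.+1) (c : Cplx R) :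
  dot a w = - dot z (vec_derive v f q) -> dot b w = - dot z (vec_derive v' f q) ->
  dot (a + c *: b) w = - dot z (vec_derive (v + c *: v') f q).
Proof.
by move=> ha hb; rewrite dotD dotZ ha hb vec_deriveD vec_deriveZ dotDr dotZr mulrN -opprD.
Qed.

Section MinkowskiSlice.
Variable R : realType.
Local Notation C := (Cplx R).
Local Notation V := 'rV[Cplx R]_4.
Local Notation RV := 'rV[R]_4.
Variables (A : set V) (Pi : V -> {vspace V}) (U : V -> RV) (p : V).
Hypothesis openA : open A.
Hypothesis U_unit : forall q, A q -> unit3 (U q).
Hypothesis U_plane : forall q, A q -> forall v, v \in Pi q <-> in_plane (U q) v.
Hypothesis frames : forall q, A q -> exists W w1 w2, frame A Pi W w1 w2 /\ W q.
Implicit Types (q v : V) (w : V -> V) (W : set V) (x X Y D : RV).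

Definition mink_coef (j : 'I_4) : C := if j == 0 then - 'i else 1.

Lemma mink_coef_cmod j : cmod (mink_coef j) = 1.
Proof.
rewrite /mink_coef; case: eqP => _; last exact: cmod1.
by rewrite cmodN -complexiE /cmod /= expr0n expr1n add0r sqrtr1.
Qed.

Lemma mink_coord X j : mink X 0 j = mink_coef j * (X 0 j)%:C%C.
Proof. by rewrite mxE /mink_coef; case: eqP; rewrite ?mul1r. Qed.

Lemma slice_mink X : slice mink_coef X = mink X.
Proof. by apply/rowP => j; rewrite mink_coord mxE. Qed.

Lemma near_mink W x : open W -> W (p + mink x) -> \forall y \near x, W (p + mink y).
Proof.
move=> oW Wx; have : \forall y \near p + slice mink_coef x, W y.
  by rewrite slice_mink; exact: open_nbhs_nbhs.
by move/(slice_near mink_coef_cmod); apply: filterS => y; rewrite slice_mink.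
Qed.

Definition ray_dir x : RV := U (p + mink x).

Lemma ray_dir_diff x j : A (p + mink x) -> differentiable (fun y => ray_dir y 0 j) x.
Proof.
move=> Ax; have := @U_diff R A Pi U U_unit U_plane frames mink_coef p x j mink_coef_cmod.
rewrite slice_mink => /(_ Ax).
by rewrite (_ : (fun y => _) = fun y => ray_dir y 0 j) //; apply/funext => y; rewrite slice_mink.
Qed.

Definition ray_dir_derive x X : RV := \row_j 'D_X (fun y => ray_dir y 0 j) x.

Lemma ray_dir_is_derive x X j : A (p + mink x) -> is_derive x X (fun y => ray_dir y 0 j) (ray_dir_derive x X 0 j).
Proof. by move=> Ax; rewrite mxE; apply/derivableP/diff_derivable/ray_dir_diff. Qed.

Lemma ray_dir_derive0 x : A (p + mink x) -> ray_dir_derive x 0 = 0.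
Proof. by move=> Ax; apply/rowP => j; rewrite !mxE derive0. Qed.

Lemma ray_dir_derive_t x X : A (p + mink x) -> ray_dir_derive x X 0 0 = 0.
Proof.
move=> Ax; rewrite mxE -[RHS](derive_cst (0 : R) x X); apply: near_eq_derive.
by apply: filterS (near_mink openA Ax) => y Ay; rewrite /ray_dir (U_unit Ay).1.
Qed.

Lemma ray_dir_derive_orth x X : A (p + mink x) -> mink_dot (ray_dir_derive x X) (ray_dir x) = 0.
Proof.
move=> Ax; have h j := is_deriveMr (ray_dir_is_derive X j Ax) (ray_dir_is_derive X j Ax).
have [_ e1] := is_deriveDr (is_deriveDr (h 1) (h 2)) (h 3).
have e0 : 'D_X (fun y => ray_dir y 0 1 * ray_dir y 0 1 + ray_dir y 0 2 * ray_dir y 0 2 + ray_dir y 0 3 * ray_dir y 0 3) x = 0.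
  have nA := near_mink openA Ax; rewrite -[RHS](derive_cst (1 : R) x X); apply: near_eq_derive.
  by apply: filterS nA => y Ay; rewrite -!expr2 /ray_dir (U_unit Ay).2.
have : 2 * mink_dot (ray_dir_derive x X) (ray_dir x) = 0.
  rewrite -e0 e1 /mink_dot ray_dir_derive_t //; ring.
by move/eqP; rewrite mulf_eq0 pnatr_eq0 /= => /eqP.
Qed.

Lemma mink_w_vec_cplx_derive x X : A (p + mink x) ->
  vec_cplx_derive (fun y => mink (ddt R + ray_dir y)) x X (mink (ray_dir_derive x X)).
Proof.
move=> Ax j; rewrite mink_coord.
have h : is_derive x X (fun y => ddt R 0 j + ray_dir y 0 j) (0 + ray_dir_derive x X 0 j).
  by apply: is_deriveDr; exact: ray_dir_is_derive.
rewrite add0r in h.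
have := cplx_deriveZ (mink_coef j) (cplx_derive_real h).
rewrite (_ : (fun y => _) = fun y => mink (ddt R + ray_dir y) 0 j) //.
by apply/funext => y; rewrite mink_coord [(ddt R + ray_dir y) 0 j]mxE.
Qed.

Lemma mink_w_Pi x : A (p + mink x) -> mink (ddt R + ray_dir x) \in Pi (p + mink x).
Proof. by move=> Ax; apply/(U_plane Ax)/mink_w_in_plane/U_unit. Qed.

Lemma ray_dir_derive_dot W w x X : open W -> W (p + mink x) -> W `<=` A -> section_over Pi W w ->
  dot (mink (ray_dir_derive x X)) (w (p + mink x)) =
  - dot (mink (ddt R + ray_dir x)) (vec_derive (mink X) w (p + mink x)).
Proof.
move=> oW Wx WA [/analytic_fieldP hA sw]; have Ax := WA _ Wx.
have h := @analytic_germ_vec_cplx_derive R 3 mink_coef w p x X mink_coef_cmod.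
rewrite !slice_mink in h; have {}h := h (hA _ Wx).
have c1 := cplx_derive_dot (mink_w_vec_cplx_derive X Ax) h.
have c2 : cplx_derive (fun y => dot (mink (ddt R + ray_dir y)) (w (p + slice mink_coef y))) x X 0.
  apply: (cplx_derive_near _ (cplx_derive_cst 0 _ _)); apply: filterS (near_mink oW Wx) => y Wy.
  rewrite slice_mink (Pi_iso (planeU U_unit U_plane) (WA _ Wy)) //; last exact: sw.
  exact: mink_w_Pi (WA _ Wy).
by have := cplx_derive_uniq c1 c2; rewrite slice_mink => /eqP; rewrite addr_eq0 => /eqP.
Qed.

(** Let d be the derivative of u along v = X + iY and write d/dt + u = a w1 + b w2 at the point.
    Differentiating the isotropy relations gives g(d, w1) = -b beta(v) and g(d, w2) = a beta(v),
    where a and b are not both 0. So beta(v) = 0 iff d is orthogonal to the plane, iff d lies in it.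
    As d has no t-component, this says that its imaginary part is the rotated real part. *)
Lemma beta_ray_dir_derive W w1 w2 x X Y : frame A Pi W w1 w2 -> W (p + mink x) ->
  beta w1 w2 (mink X + 'i *: mink Y) (p + mink x) = 0 <-> ray_dir_derive x Y = Jperp (ray_dir x) (ray_dir_derive x X).
Proof.
move=> fr Wx; have [oW WA a1 a2 sp] := fr; have [s1 s2] := frame_section fr.
have Ax := WA _ Wx; set q := p + mink x in Wx Ax *; set v := mink X + 'i *: mink Y.
set d := mink (ray_dir_derive x X) + 'i *: mink (ray_dir_derive x Y).
have [b1 b2 b3] := betaC (planeU U_unit U_plane) v fr Wx.
have [a [b ew]] := (sectionPi _ fr Wx).1 (mink_w_Pi Ax).
have dd w : section_over Pi W w -> dot d (w q) = - dot (mink (ddt R + ray_dir x)) (vec_derive v w q).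
  by move=> s; exact: dot_vec_derive_pair (ray_dir_derive_dot X oW Wx WA s) (ray_dir_derive_dot Y oW Wx WA s).
have e1 : dot d (w1 q) = - (b * beta w1 w2 v q).
  by rewrite (dd _ s1) ew dotD !dotZ (dotC4 (w1 q)) b1 mulr0 add0r (dotC4 (w2 q)).
have e2 : dot d (w2 q) = a * beta w1 w2 v q.
  by rewrite (dd _ s2) ew dotD !dotZ (dotC4 (w1 q)) b3 (dotC4 (w2 q)) b2 mulr0 addr0 mulrN opprK.
have hd : d \in Pi q <-> ray_dir_derive x Y = Jperp (ray_dir x) (ray_dir_derive x X).
  apply: (iff_trans (U_plane Ax d)); apply: (iff_trans (in_plane_screen (U_unit Ax) (ray_dir_derive_t X Ax) (ray_dir_derive_t Y Ax))).
  by split=> [[]//|h]; split=> //; exact: ray_dir_derive_orth.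
apply: (iff_trans _ hd); split=> [z|dP].
  by apply: (in_Pi_frame (planeU U_unit U_plane) fr Wx); rewrite ?e1 ?e2 z mulr0 ?oppr0.
have z1 : dot d (w1 q) = 0 by apply: (Pi_iso (planeU U_unit U_plane) Ax dP); exact: frame1 fr Wx.
have z2 : dot d (w2 q) = 0 by apply: (Pi_iso (planeU U_unit U_plane) Ax dP); exact: frame2 fr Wx.
apply/eqP/negPn/negP => nb.
have b0 : b = 0 by move/eqP: z1; rewrite e1 oppr_eq0 mulf_eq0 (negbTE nb) orbF => /eqP.
have a0 : a = 0 by move/eqP: z2; rewrite e2 mulf_eq0 (negbTE nb) orbF => /eqP.
have /rowP /(_ 0) := ew; rewrite a0 b0 !scale0r addr0 mink_coord !mxE /= (U_unit Ax).1 addr0 mulr1.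
by move/eqP; rewrite /mink_coef eqxx oppr_eq0 (negbTE (neq0Ci _)).
Qed.

Definition geodesic x := ray_dir_derive x (ddt R + ray_dir x) = 0.
Definition conformal x := forall X, screen (ray_dir x) X -> ray_dir_derive x (Jperp (ray_dir x) X) = Jperp (ray_dir x) (ray_dir_derive x X).

Lemma Jperp_eq0 (u D : RV) : unit3 u -> D 0 0 = 0 -> mink_dot D u = 0 -> Jperp u D = 0 -> D = 0.
Proof.
move=> hu d0 du h; have e : D *m Jmat u = 0 by rewrite (screen_J d0 du hu.1).
have := congr1 (mulmx D) (Jmat_sq hu); rewrite mulmxA e mul0mx mulmxN mulmx1.
by move/eqP; rewrite eq_sym oppr_eq0 => /eqP.
Qed.

Lemma good_mink x : A (p + mink x) -> good A Pi (p + mink x) <-> geodesic x /\ conformal x.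
Proof.
move=> Ax; have [W [w1 [w2 [fr Wx]]]] := frames Ax; have hu := U_unit Ax.
have mink0 : mink (0 : RV) = 0 by apply/rowP => j; rewrite mink_coord !mxE mulr0.
have bw : beta w1 w2 (mink (ddt R + ray_dir x)) (p + mink x) = 0 <-> geodesic x.
  (* With Y = 0 the criterion reads 0 = Jperp u (D_w u), and the rotation is injective on the
     screen. *)
  have := beta_ray_dir_derive (ddt R + ray_dir x) 0 fr Wx; rewrite mink0 scaler0 addr0 ray_dir_derive0 // => h.
  apply: (iff_trans h); split=> [e|->].
    by apply: (Jperp_eq0 hu (ray_dir_derive_t _ Ax) (ray_dir_derive_orth _ Ax)).
  by apply/rowP; elim/ord4P; rewrite !mxE /= ?mulr0 ?subrr.
apply: (iff_trans (good_beta (planeU U_unit U_plane) fr Wx)); split=> [[h1 h2]|[g c]].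
  have b0 := beta0_Pi fr Wx h1 h2; split; first by apply/bw/b0/mink_w_Pi.
  by move=> X sX; apply/(beta_ray_dir_derive X (Jperp (ray_dir x) X) fr Wx)/b0/(U_plane Ax)/screen_in_plane.
have b0 v : v \in Pi (p + mink x) -> beta w1 w2 v (p + mink x) = 0.
  move=> /(U_plane Ax) /(in_plane_split hu)[a [X [sX ->]]].
  rewrite -[X in _ + X]scale1r beta_comb bw.2 // mulr0 add0r mul1r.
  by apply/(beta_ray_dir_derive X (Jperp (ray_dir x) X) fr Wx)/c.
by split; apply: b0; [exact: frame1 fr Wx|exact: frame2 fr Wx].
Qed.
End MinkowskiSlice.

Lemma is_derive_affine (R : realType) (c d s : R) : is_derive s 1 (fun t => c + t * d) d.
Proof.
have d1 : derivable (fun t : R => t) s 1 by exact: derivable_id.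
have d2 : derivable (cst d) s 1 by exact: derivable_cst.
have d3 : derivable (cst c) s 1 by exact: derivable_cst.
have d4 := derivableM d1 d2; split; first exact: (derivableD d3 d4).
apply: etrans (deriveD d3 d4) _.
apply: etrans (congr2 +%R (derive_cst c s 1) (deriveM d1 d2)) _.
rewrite (derive_cst d s 1) (derive_id s 1).
by rewrite /GRing.scale /= mulr0 !add0r mulr1.
Qed.

Lemma is_derive_lincomb (R : realType) (f g : R -> R) (c d s df dg : R) :
  is_derive s 1 f df -> is_derive s 1 g dg ->
  is_derive s 1 (fun t => c * f t + d * g t) (c * df + d * dg).
Proof.
move=> [f1 <-] [g1 <-].
have f2 := @derivableZ R _ _ f c s 1 f1; have g2 := @derivableZ R _ _ g d s 1 g1.
split; first exact: derivableD f2 g2.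
exact: etrans (deriveD f2 g2) (congr2 +%R (deriveZ c f1) (deriveZ d g1)).
Qed.

Lemma continuous_sum_norm (R : realType) (T : topologicalType) (I : Type) (r : seq I) (f : I -> T -> R) :
  (forall k, continuous (f k)) -> continuous (fun s => \sum_(k <- r) `|f k s|).
Proof.
move=> h; elim: r => [|k r IH] s.
  rewrite (_ : (fun s => _) = cst 0); first exact: cst_continuous.
  by apply/funext => t; rewrite big_nil.
rewrite (_ : (fun s => _) = fun s => `|f k s| + \sum_(k <- r) `|f k s|).
  by apply: cvgD; [apply: cvg_norm; exact: h|exact: IH].
by apply/funext => t; rewrite big_cons.
Qed.

(** * Derivatives along curves and straightness of the integral curves *)

Section Curves.
Variables (R : realType) (n : nat).
Local Notation RV := 'rV[R]_n.+1.
Implicit Types (g : R -> RV) (f : R -> R) (phi : RV -> R) (x v : RV) (s t a b : R).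

Lemma chain_rule phi g s v : is_derive s 1 g v -> differentiable phi (g s) ->
  is_derive s 1 (phi \o g) ('D_v phi (g s)).
Proof.
move=> [d1 <-] dphi; have dg : differentiable g s by exact/derivable1_diffP.
have dc : differentiable (phi \o g) s by exact: differentiable_comp.
split; first exact: diff_derivable.
by rewrite deriveE // diff_comp //= -deriveE // -deriveE.
Qed.

Lemma is_derive_coord g s v j : is_derive s 1 g v -> is_derive s 1 (fun t => g t 0 j) (v 0 j).
Proof.
move=> [d <-]; split; first exact: ((derivable_mxP g s 1).1 d 0 j).
by rewrite derive_mx // mxE.
Qed.

Lemma is_derive_row g s v : (forall j, is_derive s 1 (fun t => g t 0 j) (v 0 j)) -> is_derive s 1 g v.
Proof.
move=> h; have d : derivable g s 1.
  by apply/derivable_mxP => i j; rewrite (ord1 i); have [] := h j.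
split=> //; rewrite derive_mx //; apply/rowP => j; rewrite mxE.
by have [_ ->] := h j.
Qed.

Lemma is_derive_line x v s : is_derive s 1 (fun t => x + t *: v) v.
Proof.
apply: is_derive_row => j; have -> : (fun t => (x + t *: v) 0 j) = (fun t => x 0 j + t * v 0 j).
  by apply/funext => t; rewrite !mxE.
exact: is_derive_affine.
Qed.

Lemma lipschitz f (df : R -> R) (M : R) s t : s <= t ->
  (forall r, s <= r <= t -> is_derive r 1 f (df r) /\ `|df r| <= M) -> `|f t - f s| <= M * (t - s).
Proof.
move=> st h.
have hc : {within `[s, t], continuous f}.
  apply: derivable_within_continuous => r; rewrite in_itv /= => hr.
  by have [[]] := h r hr.
have [|c] := @MVT_segment R f df s t st _ hc.
  move=> r; rewrite in_itv /= => /andP[h1 h2].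
  by have [] := h r _; rewrite ?(ltW h1) ?(ltW h2).
rewrite in_itv /= => hcc ->; rewrite normrM (ger0_norm (x := t - s)) ?subr_ge0 //.
by rewrite ler_wpM2r ?subr_ge0 //; have [] := h c hcc.
Qed.

Lemma const_itv f a b s t : (forall r, a < r < b -> is_derive r 1 f 0) ->
  a < s < b -> a < t < b -> f s = f t.
Proof.
move=> h.
suff H (c d : R) : a < c < b -> a < d < b -> c <= d -> f c = f d.
  by move=> hs ht; case: (leP s t) => [/H -> //|/ltW /H <-].
move=> /andP[ac cb] /andP[ad db] cd.
have : `|f d - f c| <= 0 * (d - c).
  apply: (@lipschitz f (fun=> 0)) => // r /andP[cr rd]; rewrite normr0; split=> //; apply: h.
  by rewrite (lt_le_trans ac cr) (le_lt_trans rd db).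
rewrite mul0r normr_le0 subr_eq0 => /eqP ->; by [].
Qed.

Lemma lipschitz0 f (df : R -> R) (M d c : R) : `|c| <= d ->
  (forall r : R, `|r| <= d -> is_derive r 1 f (df r) /\ `|df r| <= M) -> `|f c - f 0| <= M * `|c|.
Proof.
move=> cd h; case: (leP 0 c) => c0.
  rewrite (ger0_norm c0) -[X in _ * X]subr0; apply: (@lipschitz f df M 0 c c0) => r /andP[r0 rc].
  by apply: h; rewrite (ger0_norm r0) (le_trans rc) // (le_trans (ler_norm _) cd).
rewrite distrC; apply: le_trans (@lipschitz f df M c 0 (ltW c0) _) _; last by rewrite sub0r ltr0_norm.
move=> r /andP[cr r0]; apply: h; rewrite ler0_norm // (le_trans _ cd) // ltr0_norm // lerN2 //.
Qed.

Lemma derive_delta phi x v : differentiable phi x ->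
  'D_v phi x = \sum_j v 0 j * 'D_(delta_mx 0 j) phi x.
Proof.
move=> d; rewrite deriveE // {1}(row_sum_delta v) linear_sum /=; apply: eq_bigr => j _.
by rewrite linearZ /= deriveE.
Qed.

Variables (AM : set RV) (u : RV -> RV) (e0 : RV).
Hypothesis u_smooth : forall x, AM x -> exists W : set RV, [/\ open W, W x, W `<=` AM &
    forall k j, smooth_order k W (fun y => u y 0 j)].
Hypothesis geo : forall x j, AM x -> 'D_(e0 + u x) (fun y => u y 0 j) x = 0.

Lemma u_smooth_diff x j : AM x -> differentiable (fun y => u y 0 j) x.
Proof. by move=> /u_smooth[W [oW Wx _ h]]; exact: smooth_order_diff (h 0%N j) Wx. Qed.

Lemma partials_bounded x : AM x -> exists d B : R, [/\ 0 < d, 0 <= B & forall v, (forall j, `|v 0 j| <= d) ->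
  AM (x + v) /\ forall j k, `|'D_(delta_mx 0 j) (fun y => u y 0 k) (x + v)| <= B].
Proof.
move=> Ax; have [W [oW Wx WA hS]] := u_smooth Ax.
pose D (jk : 'I_n.+1 * 'I_n.+1) y := 'D_(delta_mx 0 jk.1) (fun z => u z 0 jk.2) y.
have near1 : \forall y \near x, forall jk, `|D jk x - D jk y| <= 1.
  apply: (@filter_forall _ _ (fun jk y => `|D jk x - D jk y| <= 1) _ (nbhs_filter x)) => -[j k].
  have c : {for x, continuous ('D_(delta_mx 0 j) (fun z => u z 0 k))}.
    have [_ /(_ (delta_mx 0 j)) h] := hS 1%N k.
    by apply: differentiable_continuous; exact: h.1 x Wx.
  exact: (proj1 (@cvgrPdist_le _ _ _ _ (nbhs_filter x) (D (j, k)) (D (j, k) x)) c 1 ltr01).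
have nW : \forall y \near x, W y by exact: open_nbhs_nbhs.
have hb : nbhs x [set y | W y /\ forall jk, `|D jk x - D jk y| <= 1].
  exact: (@filterI _ _ (nbhs_filter x) _ _ nW near1).
have [d d0 hd] := (nbhs_cube _ _).1 hb.
exists d, (1 + \sum_jk `|D jk x|); split=> //.
  by rewrite addr_ge0 // sumr_ge0.
move=> v /hd [Wv hv]; split=> [|j k]; first exact: WA.
have := hv (j, k); rewrite /D /= => h1.
have h2 : `|D (j, k) x| <= \sum_jk `|D jk x| by rewrite (bigD1 (j, k)) //= lerDl sumr_ge0.
rewrite -(subrK ('D_(delta_mx 0 j) (fun z => u z 0 k) x) ('D_(delta_mx 0 j) (fun y => u y 0 k) (x + v))).
by apply: le_trans (ler_normD _ _) _; rewrite distrC lerD.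
Qed.

(* Along the line, D_(e0 + u y) u = 0 is known at the point [y] and D_(e0 + u x) u is
   wanted: it is bounded by [B] times the distance from [u y] to [u x].  By the mean
   value theorem the maximum of this distance over a short segment is then at most
   half of itself. *)
Lemma straight x : AM x -> exists2 d : R, 0 < d & forall s, `|s| <= d ->
  AM (x + s *: (e0 + u x)) /\ u (x + s *: (e0 + u x)) = u x.
Proof.
move=> Ax; have [d [B [d0 B0 hB]]] := partials_bounded Ax; set w := e0 + u x.
pose S := \sum_j `|w 0 j|; have S0 : 0 <= S by exact: sumr_ge0.
(* The first bound keeps the segment in the cube where the partials of u are at most [B]; the second
   makes (n + 1) B e at most 1/2, which is the contraction factor. *)
pose e := Num.min (d / (1 + S)) (1 / (2 * n.+1%:R * (B + 1))).
have e0' : 0 < e.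
  have S1 : 0 < 1 + S by rewrite ltr_pwDl.
  have B1 : 0 < B + 1 by rewrite ltr_wpDl.
  have N1 : 0 < n.+1%:R :> R by rewrite ltr0n.
  by rewrite lt_min !divr_gt0 // !mulr_gt0.
have small s : `|s| <= e -> forall j, `|(s *: w) 0 j| <= d.
  move=> se j; rewrite mxE normrM; apply: le_trans (_ : d / (1 + S) * (1 + S) <= _); last first.
    by rewrite divfK // gt_eqF // ltr_pwDl.
  apply: ler_pM => //; first by apply: le_trans se _; rewrite ge_min lexx.
  apply: le_trans (_ : S <= _); last by rewrite lerDr.
  by rewrite /S (bigD1 j) //= lerDl sumr_ge0.
have inA s (se : `|s| <= e) : AM (x + s *: w) := (hB _ (small s se)).1.
pose f k s := u (x + s *: w) 0 k - u x 0 k.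
pose Phi s := \sum_k `|f k s|.
have Phi0 s : 0 <= Phi s by exact: sumr_ge0.
have line s : is_derive s 1 (fun t => x + t *: w) w by exact: is_derive_line.
have df k s : `|s| <= e -> is_derive s 1 (f k) ('D_w (fun y => u y 0 k) (x + s *: w)).
  move=> se; have h := chain_rule (line s) (u_smooth_diff k (inA s se)).
  have h' : is_derive s 1 (fun t => u (x + t *: w) 0 k - u x 0 k) ('D_w (fun y => u y 0 k) (x + s *: w) - 0).
    exact: is_deriveB.
  by rewrite subr0 in h'.
have bd k s : `|s| <= e -> `|'D_w (fun y => u y 0 k) (x + s *: w)| <= B * Phi s.
  move=> se; set y := x + s *: w; have Ay : AM y by exact: inA.
  have -> : w = 1 *: (e0 + u y) + (-1) *: (u y - u x).
    by rewrite scale1r scaleN1r opprB addrA addrAC addrK.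
  rewrite (derive_comb _ _ _ _ (u_smooth_diff k Ay)) geo // mulr0 add0r mulN1r normrN.
  rewrite (derive_delta _ (u_smooth_diff k Ay)); apply: le_trans (ler_norm_sum _ _ _) _.
  rewrite /Phi mulr_sumr; apply: ler_sum => j _; rewrite normrM mulrC; apply: ler_pM => //.
    by have [_ ->] := hB _ (small s se).
  by rewrite /f !mxE.
have cf k : {within `[- e, e], continuous (f k)}.
  apply: derivable_within_continuous => r; rewrite in_itv /= -ler_norml => hr.
  by have [] := df k r hr.
have cPhi : {within `[- e, e], continuous Phi}.
  exact: continuous_sum_norm cf.
have ee : - e <= e by rewrite (le_trans _ (ltW e0')) // oppr_le0 ltW.
have [c] := EVT_max ee cPhi; rewrite in_itv /= -ler_norml => hc hmax.
have M0 : 0 <= B * Phi c by rewrite mulr_ge0.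
have key : Phi c <= n.+1%:R * (B * Phi c * e).
  apply: le_trans (_ : \sum_(k < n.+1) B * Phi c * e <= _); last first.
    by rewrite sumr_const card_ord mulr_natl.
  apply: ler_sum => k _.
  have f00 : f k 0 = 0 by rewrite /f scale0r addr0 subrr.
  rewrite -[f k c]subr0 -f00; apply: le_trans (_ : B * Phi c * `|c| <= _); last by rewrite ler_wpM2l.
  apply: (lipschitz0 hc) => r hr; split; first exact: df.
  apply: le_trans (bd k r hr) _; rewrite ler_wpM2l //; apply: hmax.
  by rewrite in_itv /= -ler_norml.
have Pc : Phi c = 0.
  apply/eqP; rewrite eq_le Phi0 andbT.
  have e1 : e * (2 * n.+1%:R * (B + 1)) <= 1.
    by rewrite -ler_pdivlMr ?mulr_gt0 ?ltr0n ?ltr_wpDl // ge_min lexx orbT.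
  have e2 : n.+1%:R * (B * Phi c * e) <= Phi c * (e * (n.+1%:R * (B + 1))).
    rewrite -subr_ge0 (_ : _ - _ = Phi c * (e * n.+1%:R)); last by ring.
    by rewrite !mulr_ge0 ?(ltW e0').
  have e3 : Phi c * (e * (2 * n.+1%:R * (B + 1))) <= Phi c by rewrite ler_piMr.
  have e4 : Phi c * (e * (2 * n.+1%:R * (B + 1))) = 2 * (Phi c * (e * (n.+1%:R * (B + 1)))) by ring.
  lra.
exists e => // s hs; split; first exact: inA.
apply/rowP => k; apply/eqP; rewrite -subr_eq0 -normr_le0.
apply: le_trans (_ : Phi s <= _); first by rewrite /Phi (bigD1 k) //= lerDl sumr_ge0.
by rewrite -Pc; apply: hmax; rewrite in_itv /= -ler_norml.
Qed.
End Curves.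

(** * Shear-free ray congruences *)

Section RayCongruence.
Variable R : realType.
Local Notation C := (Cplx R).
Local Notation V := 'rV[Cplx R]_4.
Local Notation RV := 'rV[R]_4.
Variables (A : set V) (Pi : V -> {vspace V}) (U : V -> RV) (p : V).
Hypothesis openA : open A.
Hypothesis U_unit : forall q, A q -> unit3 (U q).
Hypothesis U_plane : forall q, A q -> forall v, v \in Pi q <-> in_plane (U q) v.
Hypothesis frames : forall q, A q -> exists W w1 w2, frame A Pi W w1 w2 /\ W q.
Implicit Types (q v : V) (x X Y D : RV).

Local Notation AM := (mink_slice A p).
Local Notation ray_dir := (ray_dir U p).
Local Notation ray_field := (fun x => ddt R + ray_dir x).

Lemma open_AM : open AM.
Proof.
have := slice_open (p := p) (@mink_coef_cmod R) openA; congr open.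
by apply/seteqP; split=> x /=; rewrite slice_mink.
Qed.

Lemma ray_dir_smooth x : AM x -> exists W : set RV, [/\ open W, W x, W `<=` AM &
    forall k j, smooth_order k W (fun y => ray_dir y 0 j)].
Proof.
move=> Ax; have [|W [oW Wx WA h]] := @U_smooth R A Pi U U_unit U_plane frames (@mink_coef R) p x (@mink_coef_cmod R).
  by rewrite slice_mink.
exists W; split=> // [y /WA|k j]; first by rewrite slice_mink.
have := h k j; congr (smooth_order _ _ _); apply/funext => y; by rewrite slice_mink.
Qed.

Lemma ray_field_derive (w : RV -> RV) x X : (forall y, AM y -> w y = ray_field y) -> AM x -> 'D_X w x = ray_dir_derive U p x X.
Proof.
move=> e Ax; have -> : 'D_X w x = 'D_X ray_field x.
  by apply: near_eq_derive; exact: open_near open_AM Ax e.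
suff [_ ->] : is_derive x X ray_field (ray_dir_derive U p x X) by [].
apply: is_derive_rV => j.
have h := is_deriveDr (is_derive_cst (ddt R 0 j) x X) (ray_dir_is_derive U_unit U_plane frames X j Ax).
rewrite add0r in h; congr is_derive: h.
by apply/funext => y; rewrite [RHS]mxE.
Qed.

Lemma geodesic_coord x j : AM x -> geodesic U p x -> 'D_(ray_field x) (fun y => ray_dir y 0 j) x = 0.
Proof. by move=> Ax /rowP /(_ j); rewrite !mxE. Qed.

Lemma ray_dir_unit x : AM x -> ray_dir x 0 0 = 0 /\ mink_dot (ray_dir x) (ray_dir x) = 1.
Proof.
move=> Ax; have [h0 h1] := U_unit Ax; split=> //.
by rewrite /mink_dot -h1 /ray_dir h0; ring.
Qed.

Lemma ray_field_null x : AM x -> ray_field x != 0 /\ mink_dot (ray_field x) (ray_field x) = 0.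
Proof.
move=> Ax; have [h0 h1] := ray_dir_unit Ax.
have c0 : (ddt R + ray_dir x) 0 0 = 1 by rewrite mxE h0 mxE /= addr0.
have c1 : (ddt R + ray_dir x) 0 1 = ray_dir x 0 1 by rewrite mxE [ddt R 0 1]mxE /= add0r.
have c2 : (ddt R + ray_dir x) 0 2 = ray_dir x 0 2 by rewrite mxE [ddt R 0 2]mxE /= add0r.
have c3 : (ddt R + ray_dir x) 0 3 = ray_dir x 0 3 by rewrite mxE [ddt R 0 3]mxE /= add0r.
split; first by apply/eqP => /rowP /(_ 0); rewrite c0 mxE => /eqP; rewrite oner_eq0.
move: h1; rewrite /mink_dot c0 c1 c2 c3 h0 => h.
by apply/eqP; rewrite -(subrr 1) -[X in _ == X - _]h; apply/eqP; ring.
Qed.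

(** Through each point the explicit line is an integral curve, by [straight]. Along an arbitrary
    integral curve g the chain rule makes u constant, so g(s) - s w is constant as well and g runs
    on a line. *)
Lemma geodesic_foliates : (forall x, AM x -> geodesic U p x) -> foliates_by_null_lines AM ray_field.
Proof.
move=> geo; split=> [x Ax|a b g ig].
  have [d d0 hd] := straight ray_dir_smooth (fun y j Ay => geodesic_coord j Ay (geo y Ay)) Ax.
  exists (- d), d, (fun s => x + s *: ray_field x); split.
  - by rewrite oppr_lt0 d0.
  - move=> s /andP[s1 s2]; have [|As us] := hd s.
      by rewrite ler_norml !ltW.
    by split=> //; rewrite us; exact: is_derive_line.
  - by rewrite scale0r addr0.
have [[s0 hs0]|none] := pselect (exists s0, a < s0 < b); last first.
  (* For an empty interval a null line must still be named: any one will do. *)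
  exists [set 0 + s *: (ddt R + delta_mx 0 1) | s in [set: R]].
    exists 0, (ddt R + delta_mx 0 1); split=> //.
      by apply/eqP => /rowP /(_ 0); rewrite !mxE /= addr0 => /eqP; rewrite oner_eq0.
    by rewrite /mink_dot !mxE /=; ring.
  by move=> s hs; case: none; exists s.
have [A0 _] := ig s0 hs0; have [n0 n1] := ray_field_null A0.
have cu s j : a < s < b -> ray_dir (g s) 0 j = ray_dir (g s0) 0 j.
  move=> hs; apply: (@const_itv _ (fun t => ray_dir (g t) 0 j) a b) => // r hr.
  have [Ar dr] := ig r hr.
  have := chain_rule dr (ray_dir_diff U_unit U_plane frames j Ar).
  by rewrite geodesic_coord //; exact: geo.
exists [set g s0 + s *: ray_field (g s0) | s in [set: R]]; first by exists (g s0), (ray_field (g s0)).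
move=> s hs; exists (s - s0) => //; apply/rowP => j.
have cg : g s 0 j - s * ray_field (g s0) 0 j = g s0 0 j - s0 * ray_field (g s0) 0 j.
  apply: (@const_itv _ (fun t => g t 0 j - t * ray_field (g s0) 0 j) a b) => // r hr.
  have [Ar dr] := ig r hr; have h1 := is_derive_coord j dr.
  have h2 := is_derive_affine 0 (ray_field (g s0) 0 j) r.
  have h3 := is_derive_lincomb 1 (-1) h1 h2.
  congr is_derive: h3; first by apply/funext => t; rewrite add0r mul1r mulN1r.
  by rewrite mul1r mulN1r mxE [X in _ - X]mxE cu // subrr.
move/eqP: cg; rewrite subr_eq => /eqP cg; rewrite cg; move: (ddt R + ray_dir (g s0)) => w.
by rewrite !mxE; ring.
Qed.

(** On a line with direction v the velocity is parallel to v, and the t-component 1 of w fixes the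
    factor: w = v / v_0 along the curve. So u is constant on it, and its derivative at time 0 is D_w
    u at the given point. *)
Lemma foliates_geodesic (w : RV -> RV) : (forall y, AM y -> w y = ray_field y) ->
  foliates_by_null_lines AM w -> forall x, AM x -> geodesic U p x.
Proof.
move=> e [fol lines] x Ax; have [a [b [g [ab ig g0]]]] := fol x Ax.
have [_ [q [v [v0 _ ->]]] hL] := lines a b g ig.
have wv s j : a < s < b -> v 0 j = w (g s) 0 j * v 0 0.
  move=> hs; have [As ds] := ig s hs.
  (* The combination v_j g_0 - v_0 g_j is constant on a line of direction v, whatever the
     parametrisation. *)
  have h := is_derive_lincomb (v 0 j) (- v 0 0) (is_derive_coord 0 ds) (is_derive_coord j ds).
  have [_ e1] := h.
  have e2 : 'D_1 (fun t => v 0 j * g t 0 0 + - v 0 0 * g t 0 j) s = 0.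
    rewrite -[RHS](derive_cst (v 0 j * q 0 0 - v 0 0 * q 0 j) s 1); apply: near_eq_derive.
    have : \forall t \near s, t \in `]a, b[ by apply: near_in_itvoo; rewrite in_itv.
    apply: filterS => t; rewrite in_itv /= => ht; have [r _ <-] := hL t ht.
    by rewrite !mxE; ring.
  have w0 : w (g s) 0 0 = 1 by rewrite e // mxE (ray_dir_unit As).1 mxE /= addr0.
  by move: e1; rewrite e2 w0 mulr1 mulNr => /esym/eqP; rewrite subr_eq0 mulrC => /eqP.
have vn0 : v 0 0 != 0.
  apply: contra v0 => /eqP v00; apply/eqP/rowP => j.
  by rewrite (wv 0 j) // v00 mulr0 mxE.
have cu s j : a < s < b -> ray_dir (g s) 0 j = v 0 j / v 0 0 - ddt R 0 j.
  move=> hs; have [As ds] := ig s hs.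
  rewrite (wv s j hs) mulfK // e //; move: (ddt R) (ray_dir (g s)) => c d.
  by rewrite !mxE addrAC subrr add0r.
have [A0 d0] := ig 0 ab; rewrite g0 in A0 d0; rewrite e // in d0.
apply/rowP => j; rewrite mxE [RHS]mxE.
have dj : differentiable (fun y => ray_dir y 0 j) (g 0) by rewrite g0; exact: (ray_dir_diff U_unit U_plane frames j Ax).
have dg : is_derive (0 : R) 1 g (ray_field x) by exact: d0.
have [_ <-] : is_derive (0 : R) 1 ((fun y => ray_dir y 0 j) \o g) ('D_(ray_field x) (fun y => ray_dir y 0 j) x).
  by have := chain_rule dg dj; rewrite g0.
rewrite -[RHS](derive_cst (v 0 j / v 0 0 - ddt R 0 j) (0 : R) 1); apply: near_eq_derive.
have : \forall t \near (0 : R), t \in `]a, b[ by apply: near_in_itvoo; rewrite in_itv.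
by apply: filterS => t; rewrite in_itv /= => /cu ->.
Qed.

Lemma ray_field_smooth : smooth_field AM ray_field.
Proof.
move=> k; apply: smooth_order_Ck; first exact: open_AM.
move=> j; apply: smooth_order_local => x Ax; have [W [oW Wx _ h]] := ray_dir_smooth Ax.
exists W; split=> //; apply: (smooth_order_ext oW _ (smooth_orderD oW (smooth_order_cst k (ddt R 0 j) oW) (h k j))) => y _.
by rewrite [RHS]mxE.
Qed.

Lemma W_line x : AM x -> corresponding_W Pi p x = [set s *: ray_field x | s in [set: R]].
Proof.
move=> Ax; apply/seteqP; split=> v.
  by move=> /(U_plane Ax) /(in_plane_mink_line _ (U_unit Ax)) [s ->]; exists s.
by move=> [s _ <-]; apply/(U_plane Ax)/(in_plane_mink_line _ (U_unit Ax)); exists s.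
Qed.

Lemma ray_field_uniq x (u' : RV) : AM x -> u' 0 0 = 0 ->
  corresponding_W Pi p x = [set s *: (ddt R + u') | s in [set: R]] -> u' = ray_dir x.
Proof.
move=> Ax u0; rewrite W_line // => /seteqP[/(_ (ray_field x)) h _].
have [|s _ es] := h; first by exists 1; rewrite ?scale1r.
have s1 : s = 1.
  have /rowP /(_ 0) := es; rewrite mxE mxE u0 [RHS]mxE (ray_dir_unit Ax).1.
  by rewrite [ddt R 0 0]mxE /= !addr0 mulr1.
by move: es; rewrite s1 scale1r => /addrI.
Qed.

(** D_X w = D_X u has no t-component, so [screen_proj] leaves it unchanged. *)
Lemma shear_conformal (w : RV -> RV) : (forall y, AM y -> w y = ray_field y) ->
  shear_free AM w <-> forall x, AM x -> conformal U p x.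
Proof.
move=> e.
have prj x X : AM x -> screen_proj (w x) ('D_X w x) = ray_dir_derive U p x X.
  move=> Ax; rewrite /screen_proj (ray_field_derive X e Ax) (ray_dir_derive_t openA U_unit X Ax).
  by rewrite scale0r subr0.
have wu x : AM x -> w x - ddt R = ray_dir x by move=> Ax; rewrite e // addrC addKr.
split=> h x Ax; first by move=> X sX; have := h x Ax X; rewrite wu // !prj //; exact.
by move=> u X; rewrite /u wu // => sX; rewrite !prj //; exact: h.
Qed.

Lemma integrable_iff_rays : connected A -> A p ->
  integrable_distribution A Pi <->
  defines_shear_free_ray_congruence AM (corresponding_W Pi p).
Proof.
move=> cA Ap; apply: (iff_trans (integrable_good A Pi)).
have gm x : AM x -> good A Pi (p + mink x) <-> geodesic U p x /\ conformal U p x.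
  by move=> Ax; exact: good_mink.
split=> [h|[u' [hu sm fol sf]]].
  have g x (Ax : AM x) := (gm x Ax).1 (h _ Ax).
  exists ray_dir; split.
  - by move=> x Ax; have [h0 h1] := ray_dir_unit Ax; split=> //; exact: W_line.
  - exact: ray_field_smooth.
  - by apply: geodesic_foliates => x Ax; have [] := g x Ax.
  - by apply/shear_conformal => // x Ax; have [] := g x Ax.
(* W and the normalisation determine the field on [AM], so the given congruence is the one directed
   by [ray_dir]. *)
have e y : AM y -> ddt R + u' y = ray_field y.
  by move=> Ay; have [h0 _ hW] := hu y Ay; congr (_ + _); exact: ray_field_uniq.
have geo := foliates_geodesic e fol; have conf := (shear_conformal e).1 sf.
apply: (good_slice openA (planeU U_unit U_plane) frames (@mink_coef_cmod R) cA Ap) => x.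
by rewrite slice_mink => Ax; apply/gm => //; split; [exact: geo|exact: conf].
Qed.
End RayCongruence.

Theorem propositionS5p2 (R : realType) (A : set 'rV[Cplx R]_4)
    (Pi : 'rV[Cplx R]_4 -> {vspace 'rV[Cplx R]_4}) (p : 'rV[Cplx R]_4)
    (J : 'rV[R]_4 -> 'M[R]_4)
    (openA : open A) (connectedA : connected A)
    (alphaPi : alpha_distribution A Pi) (Ap : A p)
    (corrJ : corresponding_J A Pi p J) :
  (integrable_distribution A Pi <-> integrable_J (eucl_slice A p) J) /\
  (integrable_distribution A Pi <->
     defines_shear_free_ray_congruence (mink_slice A p) (corresponding_W Pi p)).
Proof.
have [planes framesPi] := alphaPi.
have frames q : A q -> exists W w1 w2, frame A Pi W w1 w2 /\ W q.
  move=> /framesPi[W [w1 [w2 [[oW Wq] WA a1 a2 sp]]]].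
  by exists W, w1, w2; split.
have /choice[U hU] : forall q, exists u : 'rV[R]_4, A q -> unit3 u /\ forall v, v \in Pi q <-> in_plane u v.
  move=> q; have [Aq|nA] := pselect (A q); last by exists 0.
  by have [u hu hv] := alpha_plane_in_plane (planes q Aq); exists u.
have U_unit q (Aq : A q) := (hU q Aq).1; have U_plane q (Aq : A q) := (hU q Aq).2.
split; first exact: (integrable_iff_J openA U_unit U_plane frames corrJ connectedA Ap).
exact: (integrable_iff_rays openA U_unit U_plane frames connectedA Ap).
Qed.
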